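(* Let $\Psi\in\mathrm{VConv}_n(U,\mathcal{M}(U))$ be locally determined. Then there exists a unique function $\psi\in C(U)$ such that for $f\in\mathrm{Conv}(U,\mathbb{R})$ \begin{align*} \Psi(f)[B]=\int_{B}\psi(x)d\mathrm{MA}(f,x)\quad\text{for all relatively compact Borel sets}~B\subset U. \end{align*} Moreover, $\psi$ is given by \begin{align*} \psi(x)=\frac{1}{\omega_n}\Psi(h_{B_1(0)}(\cdot-x)|_U)[\{x\}]\quad\text{for}~ x\in U. \end{align*}
   Context: $U\subset\mathbb{R}^n$ is open convex, $\mathrm{Conv}(U,\mathbb{R})$ the finite-valued convex functions on $U$ (uniform convergence on compacts), $\mathcal{M}(U)$ the complex Radon measures on $U$ (weak*-topology). $\mathrm{VConv}_n(U,\mathcal{M}(U))$ is the space of continuous valuations $\Psi:\mathrm{Conv}(U,\mathbb{R})\to\mathcal{M}(U)$ with $\Psi(f+l)=\Psi(f)$ for affine $l$ and $\Psi(tf)=t^n\Psi(f)$ for $t\ge0$. $\Psi$ is locally determined if $f\equiv h$ on open $V\subset U$ implies $\Psi(f)[B\cap V]=\Psi(h)[B\cap V]$ for relatively compact Borel $B\subset U$. $\mathrm{MA}$ is the real Monge-Amp\`ere measure, $\omega_n$ the volume of the unit ball $B_1(0)$, and $h_{B_1(0)}=|\cdot|$ its support function. *)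

(* Defs.v *)
From HB Require Import structures.
From mathcomp Require Import all_boot all_order all_algebra.
From mathcomp Require Import all_classical all_reals all_analysis.
From mathcomp Require Import complex.
Set Implicit Arguments. Unset Strict Implicit. Unset Printing Implicit Defensive.
Import Order.TTheory GRing.Theory Num.Theory.
Import numFieldNormedType.Exports.
Local Open Scope classical_set_scope.
Local Open Scope ring_scope.
Local Open Scope ereal_scope.
Local Open Scope ring_scope.

Section Defs.
Variables (R : realType) (n : nat).

Notation V := 'rV[R]_n.

Definition Vb : Type := g_sigma_algebraType (@open V).
Definition borel (B : set V) : Prop := @measurable _ Vb B.

Definition dotp (x y : V) : R := \sum_(i < n) x ord0 i * y ord0 i.
Definition enorm (x : V) : R := Num.sqrt (dotp x x).

Definition convex_set (U : set V) : Prop :=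
  forall x y t, U x -> U y -> 0 <= t <= 1 -> U ((1 - t) *: x + t *: y).
Definition convex_on (U : set V) (f : V -> R) : Prop :=
  forall x y t, U x -> U y -> 0 <= t <= 1 ->
    f ((1 - t) *: x + t *: y) <= (1 - t) * f x + t * f y.

Definition affine (l : V -> R) : Prop :=
  exists (a : V) (c : R), forall x, l x = dotp a x + c.

Definition rel_compact (U B : set V) : Prop :=
  compact (closure B) /\ closure B `<=` U.

Definition box (a b : V) : set V := [set x | forall i, a ord0 i <= x ord0 i <= b ord0 i].
Definition box_vol (a b : V) : R := \prod_(i < n) (b ord0 i - a ord0 i).
Definition leb_outer (A : set V) : \bar R :=
  ereal_inf [set S | exists a b : nat -> V,
     (forall k i, a k ord0 i <= b k ord0 i) /\
     A `<=` \bigcup_k box (a k) (b k) /\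
     S = (\sum_(0 <= k <oo) (box_vol (a k) (b k))%:E)%E].

Definition omega : R := fine (leb_outer [set x | enorm x <= 1]).

Definition subdiff (U : set V) (f : V -> R) (x : V) : set V :=
  [set p | forall y, U y -> f x + dotp p (y - x) <= f y].
Definition subdiff_img (U : set V) (f : V -> R) (B : set V) : set V :=
  \bigcup_(x in B) subdiff U f x.

(* m is (a Borel measure on R^n representing) the real Monge-Ampere measure
   MA(f, .) of f on U:  MA(f,B) = |df(B)| for Borel B subset of U. *)
Definition is_MA (U : set V) (f : V -> R) (m : {measure set Vb -> \bar R}) : Prop :=
  forall B : set V, borel B -> B `<=` U -> m B = leb_outer (subdiff_img U f B).

Definition cintegral (m : {measure set Vb -> \bar R}) (B : set V) (psi : V -> R[i]) : R[i] :=
  (Rintegral m B (fun x => complex.Re (psi x)) +i* Rintegral m B (fun x => complex.Im (psi x)))%C.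

(* Complex Radon measures on U: represented as (mu1 - mu2) + i (mu3 - mu4) with
   mu_k positive Borel measures that are locally finite in U. *)
Record cradon (U : set V) := CRadon {
  cr1 : {measure set Vb -> \bar R};
  cr2 : {measure set Vb -> \bar R};
  cr3 : {measure set Vb -> \bar R};
  cr4 : {measure set Vb -> \bar R};
  cr_locfin : forall K : set V, compact K -> K `<=` U ->
     [/\ (cr1 K < +oo)%E, (cr2 K < +oo)%E, (cr3 K < +oo)%E & (cr4 K < +oo)%E] }.

(* value mu[B] (meaningful for relatively compact Borel B in U) *)
Definition cval (U : set V) (mu : cradon U) (B : set V) : R[i] :=
  ((fine (cr1 mu B) - fine (cr2 mu B)) +i* (fine (cr3 mu B) - fine (cr4 mu B)))%C.

Definition Cc (U : set V) (phi : V -> R) : Prop :=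
  continuous phi /\ compact (closure [set x | phi x != 0]) /\
  closure [set x | phi x != 0] `<=` U.

Definition cint_re (U : set V) (mu : cradon U) (phi : V -> R) : R :=
  Rintegral (cr1 mu) setT phi - Rintegral (cr2 mu) setT phi.
Definition cint_im (U : set V) (mu : cradon U) (phi : V -> R) : R :=
  Rintegral (cr3 mu) setT phi - Rintegral (cr4 mu) setT phi.

Definition weak_cvg (U : set V) (mu_ : nat -> cradon U) (mu : cradon U) : Prop :=
  forall phi, Cc U phi ->
    (fun j => cint_re (mu_ j) phi) @ \oo --> cint_re mu phi /\
    (fun j => cint_im (mu_ j) phi) @ \oo --> cint_im mu phi.

Definition loc_unif_cvg (U : set V) (f_ : nat -> V -> R) (f : V -> R) : Prop :=
  forall K : set V, compact K -> K `<=` U ->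
  forall e : R, 0 < e -> \forall j \near \oo, forall x, K x -> `|f_ j x - f x| < e.

(* Psi in VConv_n(U, M(U)).  Elements of Conv(U,R) are represented by
   functions V -> R that are convex on U (values off U are irrelevant). *)
Definition is_VConv (U : set V) (Psi : (V -> R) -> cradon U) : Prop :=
  (forall f g, convex_on U f -> convex_on U g -> convex_on U (fun x => Num.min (f x) (g x)) ->
     forall B, borel B -> rel_compact U B ->
     (cval (Psi (fun x => Num.max (f x) (g x))) B + cval (Psi (fun x => Num.min (f x) (g x))) B
      = cval (Psi f) B + cval (Psi g) B)%R) /\
  (* continuity (Conv(U,R) is metrizable, so sequential continuity) *)
  (forall f_ f, (forall j, convex_on U (f_ j)) -> convex_on U f ->
     loc_unif_cvg U f_ f -> weak_cvg (fun j => Psi (f_ j)) (Psi f)) /\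
  (forall f l, convex_on U f -> affine l ->
     forall B, borel B -> rel_compact U B -> cval (Psi (f \+ l)) B = cval (Psi f) B) /\
  (forall f (t : R), convex_on U f -> 0 <= t ->
     forall B, borel B -> rel_compact U B ->
     cval (Psi (fun x => t * f x)) B = ((t ^+ n)%:C * cval (Psi f) B)%C).

Definition locally_determined (U : set V) (Psi : (V -> R) -> cradon U) : Prop :=
  forall f h (W : set V), convex_on U f -> convex_on U h -> open W -> W `<=` U ->
    (forall x, W x -> f x = h x) ->
    forall B, borel B -> rel_compact U B -> cval (Psi f) (B `&` W) = cval (Psi h) (B `&` W).

Definition represents (U : set V) (Psi : (V -> R) -> cradon U) (psi : V -> R[i]) : Prop :=
  forall f, convex_on U f -> exists m, is_MA U f m /\
    forall B, borel B -> rel_compact U B -> cval (Psi f) B = cintegral m B psi.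

Definition continuous_on_C (U : set V) (psi : V -> R[i]) : Prop :=
  forall x, U x -> {for x, continuous (fun y => complex.Re (psi y))} /\
                  {for x, continuous (fun y => complex.Im (psi y))}.

End Defs.

(* Main.v *)
Require Import Defs.
From HB Require Import structures.
From mathcomp Require Import all_boot all_order all_algebra.
From mathcomp Require Import all_classical all_reals all_analysis.
From mathcomp Require Import complex measurable_realfun.
From mathcomp Require Import ring lra.
Import Order.TTheory GRing.Theory Num.Theory.
Import numFieldNormedType.Exports.
Local Open Scope classical_set_scope.
Local Open Scope ring_scope.

(** The real and imaginary parts of [Psi] are treated separately.  For fixed [x] and
    [B], evaluating on the cones [y |-> max_(w in J) <w, y - x>] gives a translation
    invariant valuation [Z] of the polytopes [conv J] that is homogeneous of degree
    [n].  Bisecting path simplices shows that [Z] vanishes on polytopes contained in a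
    hyperplane and is determined by its value on one simplex, so [Z] is a multiple of
    the volume of [conv J].  A polyhedral function coincides near each point with a
    cone over its active slopes.  Local determination therefore makes both [Psi] and
    the Monge-Ampere measure vanish on the strata whose slopes lie in a hyperplane;
    the other strata are single points [y], where the two differ by the factor
    [rho y].  Weak continuity of [Psi] and of the Monge-Ampere measure along simplicial
    cones with moving apex gives the continuity of [rho], and along polyhedral
    approximations it gives [Psi f = rho MA(f)].  The ball cone, whose subdifferential
    at the apex is the unit ball, identifies [rho] with [psi]. *)

Set Implicit Arguments. Unset Strict Implicit. Unset Printing Implicit Defensive.

(** * Homogeneous valuations on support functions of polytopes *)

(** Weak convergence does not pass to the mass of a fixed Borel set, so the valuation of polytopes
    obtained from [x] and [B] comes without continuity and has to be described by algebra alone.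
    Path simplices make this possible: bisecting one yields half-size path simplices whose edge
    sequences are signed permutations of the original sequence, a finite family. Homogeneity of
    degree [n] turns the bisection of an [m]-edge simplex into a relation with [2 ^ m] terms and
    common factor [2 ^ (- n)]: a contraction for [m < n], and for [m = n] a mean value that obeys a
    maximum principle. The symmetry so obtained yields invariance under shears, which is what
    characterises volume.

    A second obstacle is circularity: testing [Psi] against a density requires a continuous density,
    while continuity of the density is what has to be shown. Cones over one fixed simplex avoid
    this, because away from the apex their strata have slopes in a hyperplane and a constant density
    does the job. *)

Section DotProduct.
Variables (R : realType) (n : nat).
Notation V := 'rV[R]_n.
Implicit Types x y z w : V.

Lemma dotpE x y : dotp x y = (x *m y^T) ord0 ord0.
Proof. by rewrite mxE; apply: eq_bigr => i _; rewrite mxE. Qed.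

Lemma dotpC x y : dotp x y = dotp y x.
Proof. by apply: eq_bigr => i _; rewrite mulrC. Qed.

Lemma dotpDl x y z : dotp (x + y) z = dotp x z + dotp y z.
Proof. by rewrite !dotpE mulmxDl mxE. Qed.

Lemma dotpZl (a : R) x z : dotp (a *: x) z = a * dotp x z.
Proof. by rewrite !dotpE -scalemxAl mxE. Qed.

Lemma dotpNl x z : dotp (- x) z = - dotp x z.
Proof. by rewrite -scaleN1r dotpZl mulN1r. Qed.

Lemma dotpBl x y z : dotp (x - y) z = dotp x z - dotp y z.
Proof. by rewrite dotpDl dotpNl. Qed.

Lemma dotp0l z : dotp 0 z = 0.
Proof. by rewrite -(scale0r 0) dotpZl mul0r. Qed.

Lemma dotpDr x y z : dotp z (x + y) = dotp z x + dotp z y.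
Proof. by rewrite dotpC dotpDl !(dotpC _ z). Qed.

Lemma dotpZr (a : R) x z : dotp z (a *: x) = a * dotp z x.
Proof. by rewrite dotpC dotpZl (dotpC x). Qed.

Lemma dotpNr x z : dotp z (- x) = - dotp z x.
Proof. by rewrite dotpC dotpNl (dotpC x). Qed.

Lemma dotpBr x y z : dotp z (x - y) = dotp z x - dotp z y.
Proof. by rewrite dotpDr dotpNr. Qed.

Lemma dotp0r z : dotp z 0 = 0.
Proof. by rewrite dotpC dotp0l. Qed.

Lemma dotp_suml (I : Type) (r : seq I) (P : pred I) (c : I -> V) z :
  dotp (\sum_(i <- r | P i) c i) z = \sum_(i <- r | P i) dotp (c i) z.
Proof.
elim/big_rec2: _ => [|i a b _ <-]; first exact: dotp0l.
by rewrite dotpDl.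
Qed.

End DotProduct.

(** * Maxima over finite lists *)

Section MaxOfSeq.
Variables (R : realType) (T : eqType).
Implicit Types (g : T -> R) (J : seq T).

(* The value on the empty sequence is irrelevant and set to 0. *)
Definition lmax g J : R := \big[Num.max/head 0 (map g J)]_(a <- J) g a.

Lemma lmax_ge g J a : a \in J -> g a <= lmax g J.
Proof. by move=> aJ; exact: le_bigmax_seq. Qed.

Lemma lmax_in g J : J != [::] -> exists2 a, a \in J & lmax g J = g a.
Proof.
case: J => // a0 J _; rewrite /lmax big_seq /=.
have : exists2 a, a \in a0 :: J & g a0 = g a by exists a0 => //; exact: mem_head.
move: {1 2}(g a0) => x0 x0P.
elim/big_ind : _ => // [x y [a aJ ->] [b bJ ->]|i iJ]; last by exists i.
by have [ab|ab] := leP (g a) (g b); [exists b|exists a].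
Qed.

Lemma lmax_le g J c : J != [::] -> (forall a, a \in J -> g a <= c) ->
  lmax g J <= c.
Proof. by move=> /(lmax_in g)[a aJ ->]; exact. Qed.

Lemma lmax_eq g J c a : a \in J -> g a = c -> (forall b, b \in J -> g b <= c) ->
  lmax g J = c.
Proof.
move=> aJ gac Jc; apply/eqP; rewrite eq_le -{2}gac lmax_ge// andbT.
by apply: lmax_le => //; case: J aJ {Jc}.
Qed.

Lemma eq_lmax g g' J : {in J, g =1 g'} -> lmax g J = lmax g' J.
Proof.
move=> gg'; rewrite /lmax [LHS]big_seq [RHS]big_seq.
have -> : map g J = map g' J by apply/eq_in_map.
by apply: eq_bigr.
Qed.

Lemma eq_lmax_dom g J J' : J != [::] -> J' != [::] ->
  (forall a, a \in J -> exists2 b, b \in J' & g a <= g b) ->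
  (forall a, a \in J' -> exists2 b, b \in J & g a <= g b) ->
  lmax g J = lmax g J'.
Proof.
move=> J0 J'0 JJ' J'J; apply/eqP; rewrite eq_le; apply/andP; split.
  by apply: lmax_le => // a /JJ'[b bJ /le_trans]; apply; exact: lmax_ge.
by apply: lmax_le => // a /J'J[b bJ /le_trans]; apply; exact: lmax_ge.
Qed.

Lemma lmax_nil g : lmax g [::] = 0. Proof. by rewrite /lmax big_nil. Qed.

Lemma lmax1 g a : lmax g [:: a] = g a.
Proof. by apply: (@lmax_eq _ _ _ a) => // [|b]; rewrite inE// => /eqP->. Qed.

Lemma lmax_cons g a J : J != [::] -> lmax g (a :: J) = Num.max (g a) (lmax g J).
Proof.
move=> J0; have [b bJ bE] := lmax_in g J0; rewrite bE.
have hJ c : c \in J -> g c <= g b by rewrite -bE; exact: lmax_ge.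
have [ab|/ltW ab] := leP (g a) (g b).
  apply: (@lmax_eq _ _ _ b) => //; first by rewrite inE bJ orbT.
  by move=> c; rewrite inE => /orP[/eqP->//|/hJ].
apply: (@lmax_eq _ _ _ a) => //; first exact: mem_head.
by move=> c; rewrite inE => /orP[/eqP->//|/hJ/le_trans]; exact.
Qed.

End MaxOfSeq.

Lemma lmax_map (R : realType) (S T : eqType) (h : S -> T) (g : T -> R)
  (J : seq S) : lmax g (map h J) = lmax (g \o h) J.
Proof. by rewrite /lmax big_map -map_comp. Qed.

Notation hmax J z := (lmax (fun w => dotp w z) J).

(** * Edge sequences produced by bisection, and signed permutations *)

Section BisectionShapes.
Variable V : zmodType.
Implicit Types (u s p q : seq V).

(* Maubach's bisection: [shuffles (size u) u] lists the edge sequences of the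
   [2 ^ size u] half-size path simplices into which the path simplex with edge
   sequence [u] is cut. *)
Fixpoint shuffles (k : nat) u : seq (seq V) :=
  if k is k'.+1 then
    [seq rcons s (last 0 u) | s <- shuffles k' (take k' u)] ++
    [seq rcons s (- head 0 u) | s <- shuffles k' (behead u)]
  else [:: [::]].

Lemma size_shuffles k u : size (shuffles k u) = (2 ^ k)%N.
Proof.
by elim: k u => [|k IH] u //=; rewrite size_cat !size_map !IH addnn expnS mul2n.
Qed.

Lemma shuffles_self u : u \in shuffles (size u) u.
Proof.
elim/last_ind: u => [|u a IH]; first by rewrite inE.
rewrite size_rcons /= mem_cat last_rcons -cats1 take_size_cat// cats1.
by apply/orP; left; apply/mapP; exists u.
Qed.

(** The first branch of [shuffles] leaves the last edge in place; taking it once for each edge of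
    [q] reduces to the prefix [p]. *)
Lemma shuffles_prefix p q s : s \in shuffles (size p) p ->
  s ++ q \in shuffles (size (p ++ q)) (p ++ q).
Proof.
move=> sp; elim/last_ind: q => [|q a IH]; first by rewrite !cats0.
rewrite -!rcons_cat size_rcons /= mem_cat last_rcons.
apply/orP; left; apply/mapP; exists (s ++ q) => //.
by rewrite -cats1 take_size_cat.
Qed.

(** The second branch applied once inside a prefix: the leading edge moves to an arbitrary later
    position and changes sign. These moves alone will generate all signed permutations. *)
Lemma shuffles_move a p q : p ++ - a :: q \in shuffles (size p + size q).+1 (a :: p ++ q).
Proof.
have : rcons p (- a) \in shuffles (size (a :: p)) (a :: p).
  by rewrite /= mem_cat; apply/orP; right; apply/mapP; exists p => //;
    exact: shuffles_self.
move=> /(@shuffles_prefix _ q); rewrite cat_rcons.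
by rewrite size_cat /=.
Qed.

(** The orbit of [u] under the hyperoctahedral group, generated by the sign change of the first
    entry and the adjacent transpositions. *)
Inductive signed_perm u : seq V -> Prop :=
| sp_refl : signed_perm u u
| sp_flip a p : signed_perm u (a :: p) -> signed_perm u (- a :: p)
| sp_swap p a b q : signed_perm u (p ++ a :: b :: q) ->
    signed_perm u (p ++ b :: a :: q).

Lemma signed_perm_trans u s t : signed_perm u s -> signed_perm s t ->
  signed_perm u t.
Proof. by move=> us; elim=> // *; [exact: sp_flip|exact: sp_swap]. Qed.

Lemma signed_perm_sym u s : signed_perm u s -> signed_perm s u.
Proof.
elim=> [|a p _|p a b q _]; first exact: sp_refl.
  apply: signed_perm_trans; rewrite -{2}(opprK a).
  by apply: sp_flip; exact: sp_refl.
by apply: signed_perm_trans; apply: sp_swap; exact: sp_refl.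
Qed.

Lemma size_signed_perm u s : signed_perm u s -> size s = size u.
Proof. by elim=> // [p a b q _ <-]; rewrite !size_cat. Qed.

Lemma mem_signed_perm u s : signed_perm u s ->
  {subset s <= u ++ map -%R u}.
Proof.
elim=> [x xu|a p _ IH x|p a b q _ IH x]; first by rewrite mem_cat xu.
  rewrite inE => /orP[/eqP->|xp]; last by apply: IH; rewrite inE xp orbT.
  have := IH a; rewrite mem_head => /(_ isT).
  rewrite !mem_cat => /orP[au|/mapP[y yu ->]]; first by rewrite map_f ?orbT.
  by rewrite opprK yu.
by move=> H; apply: IH; move: H; rewrite !mem_cat !inE; case: (x \in p) => //=;
  rewrite orbCA.
Qed.

Lemma signed_perm_catr u s q : signed_perm u s -> signed_perm (u ++ q) (s ++ q).
Proof.
elim=> [|a p _ IH|p a b r _]; first exact: sp_refl.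
  by apply: sp_flip.
by rewrite -!catA => IH; apply: sp_swap.
Qed.

Lemma signed_perm_cons a u s : signed_perm u s -> signed_perm (a :: u) (a :: s).
Proof.
elim=> [|b p _ IH|p b c q _ IH]; first exact: sp_refl.
  by apply: (@sp_swap _ [::]); apply: sp_flip; apply: (@sp_swap _ [::]).
exact: (@sp_swap _ (a :: p)).
Qed.

Lemma signed_perm_rcons a u : signed_perm (a :: u) (rcons u a).
Proof.
elim: u => [|b u IH] /=; first exact: sp_refl.
apply: (@signed_perm_trans _ (b :: a :: u)); last exact: signed_perm_cons.
by apply: (@sp_swap _ [::]); exact: sp_refl.
Qed.

Lemma shuffles_signed_perm k u s : size u = k -> s \in shuffles k u ->
  signed_perm u s.
Proof.
elim: k u s => [|k IH] u s.
  by move=> /size0nil ->; rewrite inE => /eqP ->; exact: sp_refl.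
move=> uk /=; rewrite mem_cat => /orP[] /mapP[t].
  case/lastP: u uk => // u a; rewrite size_rcons last_rcons => -[uk].
  rewrite -cats1 take_size_cat// => /(IH _ _ uk) ut ->.
  by rewrite -cats1; exact: signed_perm_catr.
case: u uk => //= a u [uk] /(IH _ _ uk) ut ->.
apply: (@signed_perm_trans _ (- a :: u)).
  by apply: sp_flip; exact: sp_refl.
apply: (signed_perm_trans (signed_perm_rcons _ _)).
by rewrite -!cats1; exact: signed_perm_catr.
Qed.

(* Cyclic prefix moves with a sign change generate all signed permutations. *)
Lemma signed_perm_ind_shuffles (Q : seq V -> Prop) u :
  (forall s t, Q s -> t \in shuffles (size s) s -> Q t) ->
  forall s, signed_perm u s -> Q u -> Q s.
Proof.
move=> Qsh s us Qu.
have Qm a p q : Q (a :: p ++ q) -> Q (p ++ - a :: q).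
  by move=> /Qsh; apply; rewrite /= size_cat; exact: shuffles_move.
have Qf a p : Q (a :: p) -> Q (- a :: p) by exact: (Qm a [::]).
have Qi a p q : Q (a :: p ++ q) -> Q (p ++ a :: q).
  by move=> /Qf/Qm; rewrite opprK.
(* Rotations bring the pair that is to be transposed to the front. *)
have Qr p q : Q (p ++ q) -> Q (q ++ p).
  elim: p q => [|a p IH] q; first by rewrite cats0.
  move=> H; have := Qi a (p ++ q)%SEQ [::]; rewrite cats0 => /(_ H).
  by rewrite -catA cats1 => /IH; rewrite cat_rcons.
elim: us => // [a p _|p a b q _]; first exact: Qf.
move=> /Qr /= /(Qi a [:: b]) /= H.
by have := Qr (b :: a :: q) p H.
Qed.

Lemma perm_signed_perm u s : perm_eq u s -> signed_perm u s.
Proof.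
elim: u s => [|a u IH] s.
  by move=> /perm_size/esym/size0nil ->; exact: sp_refl.
move=> us; have /path.splitPr E : a \in s by rewrite -(perm_mem us) mem_head.
case: E us => p q; rewrite perm_sym perm_catC cat_cons perm_cons perm_catC.
rewrite perm_sym => /IH upq; apply: (signed_perm_trans (signed_perm_cons a upq)).
have := signed_perm_catr q (signed_perm_rcons a p).
by rewrite cat_rcons.
Qed.

End BisectionShapes.

Section AllSeqs.
Variable T : eqType.

Fixpoint all_seqs (L : seq T) (m : nat) : seq (seq T) :=
  if m is m'.+1 then allpairs cons L (all_seqs L m') else [:: [::]].

Lemma mem_all_seqs L s : {subset s <= L} -> s \in all_seqs L (size s).
Proof.
elim: s => //= a s IH sL; apply: allpairs_f; first by rewrite sL ?mem_head.
by apply: IH => x xs; rewrite sL// inE xs orbT.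
Qed.

End AllSeqs.

(** The orbit is finite: all its members have the length of [u] and entries in [u ++ map -%R u]. *)
Lemma signed_perm_argmax (R : realType) (V : zmodType) (f : seq V -> R) u :
  exists2 s, signed_perm u s & forall t, signed_perm u t -> f t <= f s.
Proof.
pose S := [seq s <- all_seqs (u ++ map -%R u) (size u) | `[< signed_perm u s >]].
have SP s : s \in S <-> signed_perm u s.
  rewrite mem_filter; split=> [/andP[/asboolP]//|us]; rewrite asboolT//=.
  by rewrite -(size_signed_perm us); apply: mem_all_seqs (mem_signed_perm us).
have S0 : S != [::].
  have : u \in S by apply/SP; exact: sp_refl.
  by case: S {SP}.
have [s /SP us sE] := lmax_in f S0; exists s => // t /SP tS.
by rewrite -sE lmax_ge.
Qed.

(** * Vertex lists of path simplices *)

Section PathSimplex.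
Variables (V : zmodType).
Implicit Types (p : V) (u : seq V).

Definition spath p u := p :: scanl +%R p u.

Lemma sum_rcons u a : \sum_(x <- rcons u a) x = \sum_(x <- u) x + a.
Proof. by rewrite -cats1 big_cat big_seq1. Qed.

Lemma foldl_sum p u : foldl +%R p u = p + \sum_(x <- u) x.
Proof.
elim: u p => [|a u IH] p /=; first by rewrite big_nil addr0.
by rewrite IH big_cons addrA.
Qed.

Lemma size_spath p u : size (spath p u) = (size u).+1.
Proof. by rewrite /= size_scanl. Qed.

Lemma spath_rcons p u a :
  spath p (rcons u a) = rcons (spath p u) (p + \sum_(x <- u) x + a).
Proof.
by rewrite /spath scanl_rcons /= foldl_sum sum_rcons addrA.
Qed.

Lemma spath_cons p a u : spath p (a :: u) = p :: spath (p + a) u.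
Proof. by []. Qed.

Lemma spath_translate p q u : spath (p + q) u = [seq x + q | x <- spath p u].
Proof.
rewrite /spath /=; congr (_ :: _).
by elim: u p => [|a u IH] p //=; rewrite addrAC IH.
Qed.

Lemma spath_pairmap p J : spath p (pairmap (fun x y => y - x) p J) = p :: J.
Proof. by rewrite /spath pairmapK// => x y; rewrite addrC subrK. Qed.

End PathSimplex.

Lemma spath_scale (R : realType) (V : lmodType R) (t : R) (p : V) u :
  [seq t *: x | x <- spath p u] = spath (t *: p) [seq t *: x | x <- u].
Proof.
rewrite /spath /=; congr (_ :: _).
by elim: u p => [|a u IH] p //=; rewrite scalerDr IH scalerDr.
Qed.

(** * Translation invariant valuations of polytopes that are homogeneous of degree [n] *)

Section HomogeneousValuation.
Variables (R : realType) (n : nat).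
Notation V := 'rV[R]_n.
Implicit Types (J u s g : seq V) (a b c p w z : V).
Variable Z : seq V -> R.
Hypothesis n_gt0 : (0 < n)%N.
Hypothesis Z_ext : forall J J', (forall z, hmax J z = hmax J' z) -> Z J = Z J'.
Hypothesis Z_translate : forall J v, Z [seq w + v | w <- J] = Z J.
Hypothesis Z_homog : forall J (t : R), 0 <= t ->
  Z [seq t *: w | w <- J] = t ^+ n * Z J.
(** Additivity for cutting the hull of [a :: b :: g] at a point [c] of the segment from [a] to [b]:
    the two pieces meet in the hull of [c :: g]. *)
Hypothesis Z_cut : forall a b g (t : R), 0 <= t <= 1 ->
  let c := (1 - t) *: a + t *: b in
  Z (a :: b :: g) + Z (c :: g) = Z (a :: c :: g) + Z (c :: b :: g).

Lemma Z_mem J J' : J =i J' -> Z J = Z J'.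
Proof.
move=> JJ'; apply: Z_ext => z.
case: J JJ' => [|a J] JJ'.
  by case: J' JJ' => // b J' /(_ b); rewrite mem_head.
case: J' JJ' => [/(_ a)|b J' JJ']; first by rewrite mem_head.
by apply: eq_lmax_dom => // x xJ; exists x => //; rewrite ?JJ' // -JJ'.
Qed.

Lemma Z_redundant a J : J != [::] -> (forall z, dotp a z <= hmax J z) ->
  Z (a :: J) = Z J.
Proof.
move=> J0 aJ; apply: Z_ext => z; apply: eq_lmax_dom => // x.
  rewrite inE => /orP[/eqP->|xJ]; last by exists x.
  by have [b bJ E] := lmax_in (fun w => dotp w z) J0; exists b; rewrite // -E.
by move=> xJ; exists x; rewrite // inE xJ orbT.
Qed.

Lemma Z_nil : Z [::] = 0.
Proof.
have := Z_homog [::] (lexx 0); rewrite /= expr0n.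
by rewrite (gtn_eqF n_gt0) mul0r.
Qed.

Section Bisection.
Variable m : nat.
Hypothesis Z_small : forall J, (size J <= m)%N -> Z J = 0.

Lemma Z_bisect k u (D : seq V) p : size u = k -> (size D + k = m)%N ->
  Z (spath p u ++ D) = \sum_(s <- shuffles k u)
    Z (spath (p + 2^-1 *: (\sum_(x <- u) x) - 2^-1 *: (\sum_(x <- s) x))
             [seq 2^-1 *: x | x <- s] ++ D).
Proof.
elim: k u D p => [|k IH] u D p.
  move=> /size0nil -> _; rewrite /= big_seq1 /= !big_nil !scaler0.
  by rewrite subr0 addr0.
case: u => // a u [uk] Dm.
set c := p + 2^-1 *: (\sum_(x <- a :: u) x).
have cE : c = (1 - 2^-1) *: p + 2^-1 *: (p + \sum_(x <- a :: u) x).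
  by rewrite /c scalerDr addrA -scalerDl subrK scale1r.
have [v [b [vb vk]]] : exists v b, a :: u = rcons v b /\ size v = k.
  case/lastP: u uk {cE c} => [|u b]; first by exists [::], a; split.
  by rewrite size_rcons => uk; exists (a :: u), b; split.
have half01 : 0 <= (2^-1 : R) <= 1 by apply/andP; split; lra.
have := Z_cut p (p + \sum_(x <- a :: u) x) (scanl +%R p v ++ D) half01.
cbv zeta; rewrite -cE (Z_small (J := c :: _)); last first.
  by rewrite /= size_cat size_scanl vk -Dm addnS addnC.
rewrite addr0 => cut.
have -> : Z (spath p (a :: u) ++ D) =
    Z (p :: p + \sum_(x <- a :: u) x :: (scanl +%R p v ++ D)).
  apply: Z_mem => x; rewrite vb spath_rcons sum_rcons addrA /= cat_rcons.
  by rewrite !(inE, mem_cat); do !case: (_ == _); do !case: (_ \in _).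
rewrite cut {cut} [shuffles _ _]/= big_cat !big_map; congr (_ + _).
  have -> : last a u = b by rewrite -[LHS]/(last a (a :: u)) vb last_rcons.
  have -> : take k (a :: u) = v by rewrite vb -cats1 take_size_cat.
  transitivity (Z (spath p v ++ (c :: D))).
    apply: Z_mem => x.
    by rewrite !(inE, mem_cat); do !case: (_ == _); do !case: (_ \in _).
  rewrite (IH v) ?vk//; last by rewrite /= addSnnS.
  apply: eq_bigr => s _; congr Z.
  rewrite map_rcons spath_rcons cat_rcons /c.
  rewrite vb !sum_rcons.
  rewrite big_map -scaler_sumr !scalerDr.
  have -> : p + (2^-1 *: (\sum_(x <- v) x) + 2^-1 *: b) -
      (2^-1 *: (\sum_(x <- s) x) + 2^-1 *: b) =
      p + 2^-1 *: (\sum_(x <- v) x) - 2^-1 *: (\sum_(x <- s) x).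
    by apply/rowP => i; rewrite !mxE; ring.
  congr (_ ++ _ :: _).
  by apply/rowP => i; rewrite !mxE; ring.
transitivity (Z (spath (p + a) u ++ (c :: D))).
  apply: Z_mem => x; rewrite -cat_cons.
  have -> : x \in spath (p + a) u ++ c :: D =
    (x \in c :: (scanl +%R p (a :: u) ++ D)).
    by rewrite /= !(inE, mem_cat); do !case: (_ == _); do !case: (_ \in _).
  rewrite vb scanl_rcons foldl_sum -vb -cats1.
  by rewrite !(inE, mem_cat); do !case: (_ == _); do !case: (_ \in _).
rewrite (IH u) ?uk//; last by rewrite /= addSnnS.
apply: eq_bigr => s _; congr Z.
rewrite map_rcons spath_rcons cat_rcons /c.
rewrite sum_rcons big_cons.
rewrite big_map -scaler_sumr !scalerDr scalerN.
have -> : p + (2^-1 *: a + 2^-1 *: (\sum_(x <- u) x)) -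
    (2^-1 *: (\sum_(x <- s) x) - 2^-1 *: a) =
    p + a + 2^-1 *: (\sum_(x <- u) x) - 2^-1 *: (\sum_(x <- s) x).
  by apply/rowP => i; rewrite !mxE; field.
congr (_ ++ _ :: _).
by apply/rowP => i; rewrite !mxE; field.
Qed.
End Bisection.

Definition path_val u := Z (spath 0 u).

Lemma Z_spath p u : Z (spath p u) = path_val u.
Proof. by rewrite -(add0r p) spath_translate Z_translate. Qed.

Lemma path_val_scale (t : R) u : 0 <= t ->
  path_val [seq t *: x | x <- u] = t ^+ n * path_val u.
Proof. by move=> t0; rewrite /path_val -Z_homog// spath_scale scaler0. Qed.

Lemma path_val_bisect u :
  (forall J, (size J <= size u)%N -> Z J = 0) ->
  path_val u = 2^-1 ^+ n * \sum_(s <- shuffles (size u) u) path_val s.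
Proof.
move=> Z_small; rewrite /path_val -[spath 0 u]cats0.
rewrite (@Z_bisect _ Z_small (size u))// mulr_sumr; apply: eq_bigr => s _.
rewrite cats0 Z_spath path_val_scale//.
Qed.

(** Bisecting the member [s] of the orbit with the largest [|path_val s|] bounds this number by
    [2 ^ m / 2 ^ n] times itself, since all [2 ^ m] pieces belong to the same orbit. The factor is
    below [1]. *)
Lemma Z_small_step m : (m < n)%N ->
  (forall J, (size J <= m)%N -> Z J = 0) ->
  forall J, (size J <= m.+1)%N -> Z J = 0.
Proof.
move=> mn Z_small J; rewrite leq_eqVlt ltnS => /orP[/eqP|/Z_small//].
case: J => // p J [Jm]; rewrite -(spath_pairmap p J) Z_spath.
set u := pairmap _ _ _; have um : size u = m by rewrite size_pairmap.
have [s us smax] := signed_perm_argmax (fun s => `|path_val s|) u.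
have sm : size s = m by rewrite (size_signed_perm us).
suff : `|path_val s| <= 0.
  move=> s0; apply/eqP; rewrite -normr_le0.
  by apply: le_trans s0; apply: smax; exact: sp_refl.
pose q : R := 2^-1 ^+ n * 2 ^+ m.
have q1 : q < 1.
  rewrite /q exprVn mulrC ltr_pdivrMr ?exprn_gt0// mul1r.
  by rewrite ltr_eXn2l// ltr1n.
have : `|path_val s| <= q * `|path_val s|.
  rewrite {1}path_val_bisect ?sm// normrM ger0_norm ?exprn_ge0 ?invr_ge0//.
  rewrite /q -mulrA; apply: ler_wpM2l; first by rewrite exprn_ge0 ?invr_ge0.
  apply: (le_trans (ler_norm_sum _ _ _)).
  have -> : 2 ^+ m * `|path_val s| = \sum_(t <- shuffles m s) `|path_val s|.
    by rewrite big_const_seq count_predT size_shuffles iter_addr_0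
      -(mulr_natl `|_|) natrX.
  rewrite big_seq [X in _ <= X]big_seq; apply: ler_sum => t ts.
  apply: smax; apply: (signed_perm_trans us).
  by apply: (@shuffles_signed_perm _ m).
by have := normr_ge0 (path_val s); nra.
Qed.

Lemma Z_small J : (size J <= n)%N -> Z J = 0.
Proof.
suff H m : (m <= n)%N -> forall J, (size J <= m)%N -> Z J = 0 by exact: (H n).
elim: m => [_ {}J|m IH mn]; last by apply: Z_small_step => //; exact/IH/ltnW.
by rewrite leqn0 => /nilP ->; exact: Z_nil.
Qed.

(** Maximum principle: with [n] edges, [path_val] at a sequence is the mean of its values at the
    [2 ^ n] shuffles. Where the maximum over the orbit is attained, it is attained at every shuffle
    as well, and shuffles generate the orbit. *)
Lemma path_val_signed_perm u s : size u = n -> signed_perm u s ->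
  path_val s = path_val u.
Proof.
move=> un us; have [s0 us0 s0max] := signed_perm_argmax path_val u.
pose Q t := signed_perm u t /\ path_val t = path_val s0.
have QS t : signed_perm s0 t -> Q t.
  move=> s0t; apply: (signed_perm_ind_shuffles _ s0t); last by split.
  move=> {s0t us s} {}t s [ut tE] st.
  have tn : size t = n by rewrite (size_signed_perm ut).
  have us : signed_perm u s.
    by apply: (signed_perm_trans ut); exact: shuffles_signed_perm st.
  split=> //; apply/eqP; rewrite eq_le s0max//= leNgt; apply/negP => lt_s.
  have : path_val s0 < path_val s0; last by rewrite ltxx.
  rewrite -{1}tE path_val_bisect ?tn; last exact: Z_small.
  have -> : path_val s0 =
      2^-1 ^+ n * \sum_(r <- shuffles n t) path_val s0.
    rewrite big_const_seq count_predT size_shuffles iter_addr_0.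
    by rewrite -(mulr_natl (path_val s0)) natrX mulrA -exprMn mulVf// expr1n mul1r.
  rewrite ltr_pM2l ?exprn_gt0 ?invr_gt0// -subr_gt0 -sumrB.
  rewrite tn in st.
  rewrite (perm_big _ (perm_to_rem st)) /= big_cons.
  apply: ltr_wpDr; last by rewrite subr_gt0.
  rewrite big_seq; apply: sumr_ge0 => r /mem_rem rt; rewrite subr_ge0.
  by apply: s0max; apply: (signed_perm_trans ut); exact: shuffles_signed_perm rt.
have [_ ->] := QS _ (signed_perm_trans (signed_perm_sym us0) us).
by have [_ ->] := QS _ (signed_perm_sym us0).
Qed.

(** * Path simplices with [n] edges under linear changes of the edges *)

Lemma path_val_perm u s : size u = n -> perm_eq u s -> path_val s = path_val u.
Proof. by move=> un /perm_signed_perm; exact: path_val_signed_perm. Qed.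

Lemma path_val_opp a u : (size u).+1 = n -> path_val (- a :: u) = path_val (a :: u).
Proof. by move=> un; apply: path_val_signed_perm => //; apply: sp_flip; exact: sp_refl. Qed.

Lemma path_val0 u : (size u).+1 = n -> path_val (0 :: u) = 0.
Proof.
move=> un; rewrite /path_val spath_cons addr0.
rewrite (@Z_mem _ (spath 0 u)); first by rewrite Z_small// size_spath un.
by move=> x; rewrite inE; case: eqP => // ->; rewrite mem_head.
Qed.

(** The edge from [0] to [a] is cut at [t *: a]; the common face has [n] vertices, so [Z_small]
    removes it. *)
Lemma path_val_cut (t : R) a b u : (size u).+2 = n -> 0 <= t <= 1 ->
  path_val (a :: b :: u) =
  path_val (t *: a :: b + (1 - t) *: a :: u) + path_val ((1 - t) *: a :: b :: u).
Proof.
move=> un t01; have := Z_cut 0 a (spath (a + b) u) t01.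
cbv zeta; rewrite scaler0 add0r (Z_small (J := t *: a :: _)); last first.
  by rewrite /= size_scanl un.
rewrite addr0.
have -> : Z [:: 0, a & spath (a + b) u] = path_val (a :: b :: u).
  by rewrite /path_val !spath_cons add0r.
have -> : Z [:: 0, t *: a & spath (a + b) u] =
    path_val (t *: a :: b + (1 - t) *: a :: u).
  rewrite /path_val !spath_cons add0r; congr (Z [:: _, _ & spath _ _]).
  by apply/rowP => i; rewrite !mxE; ring.
have -> // : Z [:: t *: a, a & spath (a + b) u] =
    path_val ((1 - t) *: a :: b :: u).
rewrite -(Z_spath (t *: a)) !spath_cons; congr (Z [:: _, _ & spath _ _]);
by apply/rowP => i; rewrite !mxE; ring.
Qed.

(** Cutting the edges [(1 + r) a] and [- (1 + r) a] produces the shears of [b] by [r a] and by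
    [- r a], together with terms that differ only in the sign of the first edge; hence these two
    shears have equal value. Replacing [b] by [b + (r / 2) a] turns this symmetry into
    invariance. *)
Lemma path_val_shear a b u (s : R) : (size u).+2 = n ->
  path_val (a :: b + s *: a :: u) = path_val (a :: b :: u).
Proof.
move=> un.
have sym (r : R) a1 b1 : 0 <= r ->
    path_val (a1 :: b1 + r *: a1 :: u) = path_val (a1 :: b1 - r *: a1 :: u).
  move=> r0; have r1 : 1 + r != 0 by rewrite gt_eqF// ltr_pwDl.
  pose t := (1 + r)^-1; pose a2 := (1 + r) *: a1.
  have t01 : 0 <= t <= 1.
    rewrite invr_ge0 addr_ge0//=; rewrite invf_le1 ?ltr_pwDl//; lra.
  have E1 : t *: a2 = a1 by rewrite scalerA mulVf// scale1r.
  have E2 : (1 - t) *: a2 = r *: a1.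
    by rewrite scalerA; congr (_ *: _); rewrite /t; field.
  have := path_val_cut a2 b1 un t01; rewrite E1 E2.
  have := path_val_cut (- a2) b1 un t01; rewrite !scalerN E1 E2.
  rewrite !path_val_opp// => -> ; rewrite addrC [RHS]addrC.
  by move=> /addrI.
have pos (r : R) a1 b1 : 0 <= r ->
    path_val (a1 :: b1 + r *: a1 :: u) = path_val (a1 :: b1 :: u).
  move=> r0; have := sym (r / 2) a1 (b1 + (r / 2) *: a1) (divr_ge0 r0 (ler0n _ 2)).
  by rewrite addrK -addrA -scalerDl -splitr.
have [s0|s0] := leP 0 s; first exact: pos.
have := pos (- s) a (b + s *: a); rewrite oppr_ge0 => /(_ (ltW s0)).
by rewrite scaleNr addrK.
Qed.

Lemma path_val_shear_mem a u x (s : R) : (size u).+1 = n -> x \in u ->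
  path_val (a + s *: x :: u) = path_val (a :: u).
Proof.
move=> un xu; have uE := perm_to_rem xu.
have rn : (size (rem x u)).+2 = n by apply: etrans un; rewrite (perm_size uE).
have swap b : path_val (b :: u) = path_val (x :: b :: rem x u).
  apply: path_val_perm; first by [].
  by rewrite (perm_catCA [:: x] [:: b]) /= perm_cons perm_sym.
by rewrite !swap path_val_shear.
Qed.

Lemma path_val_span a u (I : Type) (r : seq I) (P : pred I) (c : I -> R)
    (x : I -> V) : (size u).+1 = n -> (forall i, P i -> x i \in u) ->
  path_val (a + \sum_(i <- r | P i) c i *: x i :: u) = path_val (a :: u).
Proof.
move=> un xu; elim: r a => [|i r IH] a; first by rewrite big_nil addr0.
rewrite big_cons; case: ifP => Pi //; rewrite addrA IH path_val_shear_mem//.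
exact: xu.
Qed.

(** Three shears lead from the edges [s a, b] to [- s b, a]; a sign change and a transposition
    complete the exchange. *)
Lemma path_val_scale_swap a b u (s : R) : (size u).+2 = n -> s != 0 ->
  path_val (s *: a :: b :: u) = path_val (a :: s *: b :: u).
Proof.
move=> un s0.
have sw x y : path_val (x :: y :: u) = path_val (y :: x :: u).
  by apply: path_val_perm => //; rewrite (perm_catCA [:: y] [:: x]).
have sh2 x y (r : R) : path_val (x + r *: y :: y :: u) = path_val (x :: y :: u).
  by rewrite path_val_shear_mem// mem_head.
rewrite -(path_val_shear _ _ s^-1)// scalerA mulVf// scale1r.
rewrite -(sh2 _ _ (- s)).
have -> : s *: a + - s *: (b + a) = - (s *: b).
  by rewrite scaleNr scalerDr opprD addrCA subrr addr0.
rewrite -(path_val_shear _ _ s^-1)// scalerN scalerA mulVf// scale1r.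
by rewrite [b + a]addrC addrK path_val_opp// sw.
Qed.

(** In the induction, [k] counts the factors already collected on [a], and [u2] holds the edges
    already freed of theirs. *)
Lemma path_val_scale_prefix a u u2 (s : R) k :
  (size u + size u2).+1 = n -> s != 0 ->
  path_val (s ^+ k *: a :: [seq s *: x | x <- u] ++ u2) =
  path_val (s ^+ (k + size u) *: a :: u ++ u2).
Proof.
move=> un s0; elim: u u2 k un => [|b u IH] u2 k un /=; first by rewrite addn0.
rewrite -path_val_scale_swap//; last first.
  by apply: etrans un; rewrite size_cat size_map.
rewrite scalerA -exprS.
transitivity (path_val (s ^+ k.+1 *: a :: [seq s *: x | x <- u] ++ b :: u2)).
  apply: path_val_perm.
    by apply: etrans un; rewrite /= size_cat size_map /= addnS addSn.
  by rewrite perm_cons -(cat1s b u2) perm_catCA.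
rewrite IH; last by apply: etrans un; rewrite /= addnS addSn.
rewrite addSnnS; apply: path_val_perm.
  by apply: etrans un; rewrite /= size_cat.
by rewrite perm_cons perm_sym -(cat1s b u2) perm_catCA.
Qed.

Lemma path_val_scale_all a u (s : R) : (size u).+1 = n -> s != 0 ->
  path_val [seq s *: x | x <- a :: u] = path_val (s ^+ n *: a :: u).
Proof.
move=> un s0; have := @path_val_scale_prefix a u [::] s 1; rewrite addn0 !cats0.
by move=> /(_ un s0) /= ->; rewrite add1n; congr (path_val (s ^+ _ *: _ :: _)).
Qed.

(** For [c > 0], scaling all [n] edges by the [n]-th root of [c] multiplies the value by [c], and
    has the same effect as scaling a single edge by [c]. *)
Lemma path_val_scale1 a u (c : R) : (size u).+1 = n ->
  path_val (c *: a :: u) = `|c| * path_val (a :: u).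
Proof.
move=> un.
have pos (r : R) : 0 < r -> path_val (r *: a :: u) = r * path_val (a :: u).
  move=> r0; pose s := r `^ (n%:R^-1).
  have sn : s ^+ n = r.
    rewrite -powR_mulrn ?powR_ge0// -powRrM mulVf ?powRr1 ?ltW//.
    by rewrite pnatr_eq0 -lt0n.
  have s0 : 0 < s by rewrite powR_gt0.
  by rewrite -{1}sn -path_val_scale_all ?gt_eqF// path_val_scale ?sn// ltW.
have [c0|c0|->] := ltgtP c 0; [|by rewrite gtr0_norm ?pos|by rewrite normr0 mul0r scale0r path_val0].
by rewrite ltr0_norm// -pos ?oppr_gt0// scaleNr path_val_opp.
Qed.

Definition rows (M : 'M[R]_n) : seq V := [seq row i M | i <- enum 'I_n].

Lemma size_rows M : size (rows M) = n.
Proof. by rewrite size_map size_enum_ord. Qed.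

Lemma path_val_rows M j : path_val (rows M) =
  path_val (row j M :: [seq row i M | i <- enum 'I_n & i != j]).
Proof.
have E : perm_eq (rows M) (row j M :: [seq row i M | i <- enum 'I_n & i != j]).
  rewrite -[row j M :: _]/([seq row i M | i <- j :: _]); apply: perm_map.
  rewrite -rem_filter ?enum_uniq//; apply: perm_to_rem.
  by rewrite mem_enum.
by rewrite (path_val_perm _ E) ?size_rows.
Qed.

Lemma size_rows_rem j (M : 'M[R]_n) : (size [seq row i M | i <- enum 'I_n & i != j]).+1 = n.
Proof.
rewrite size_map -rem_filter ?enum_uniq// size_rem ?mem_enum//.
by rewrite size_enum_ord prednK.
Qed.

(** A linear relation between the rows shears one of them to [0]. *)
Lemma path_val_singular M : M \notin unitmx -> path_val (rows M) = 0.
Proof.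
rewrite -row_free_unit -kermx_eq0 => /rowV0Pn[v /sub_kermxP vM v0].
have [j vj] : exists j, v ord0 j != 0.
  apply/existsP; apply: contra_neqT v0 => /existsPn v0.
  by apply/rowP => j; rewrite mxE; apply/eqP/negPn/v0.
rewrite (path_val_rows M j).
rewrite -(@path_val_span _ _ _ (index_enum 'I_n) (fun i => i != j)
  (fun i => v ord0 i / v ord0 j) (fun i => row i M)); first last.
- by move=> i ij; apply: map_f; rewrite mem_filter ij mem_enum.
- exact: size_rows_rem.
set x := _ + _; suff -> : x = 0 by rewrite path_val0 ?size_rows_rem.
have : v ord0 j *: x = v *m M.
  rewrite /x scalerDr scaler_sumr mulmx_sum_row [RHS](bigD1 j)//=; congr (_ + _).
  by apply: eq_bigr => i _; rewrite scalerA mulrCA divff// mulr1.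
by rewrite vM => /eqP; rewrite scaler_eq0 (negPf vj) => /eqP.
Qed.

(** Steinitz exchange: rows of an invertible matrix are replaced one after another by vectors of the
    standard basis, each exchange changing the value by a nonzero factor. *)
Lemma path_val_basis : path_val (rows 1%:M) = 0 ->
  forall M, path_val (rows M) = 0.
Proof.
move=> e0 M.
(* Rows of index at least [k] are already basis vectors; for [k = n] this is no restriction. *)
suff H k : forall M : 'M[R]_n,
    (forall i : 'I_n, (k <= i)%N -> exists j, row i M = row j 1%:M) ->
    path_val (rows M) = 0.
  by apply: (H n) => i; rewrite leqNgt ltn_ord.
elim: k {M} => [|k IH] M HM.
  have [uM|/path_val_singular//] := boolP (M \in unitmx).
  rewrite -e0; apply: path_val_perm; first exact: size_rows.
  have MU : uniq (rows M).
    rewrite map_inj_in_uniq ?enum_uniq// => i j _ _ ij; apply/eqP/negPn/negP.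
    move=> /determinant_alternate => /(_ _ M) D; move: uM.
    rewrite unitmxE D ?unitr0// => l.
    by have /rowP/(_ l) := ij; rewrite !mxE.
  rewrite perm_sym; apply: uniq_perm => //.
    rewrite map_inj_in_uniq ?enum_uniq// => i j _ _ /rowP/(_ i).
    by rewrite !mxE eqxx; case: eqP => // _ /eqP; rewrite oner_eq0.
  have sub : {subset rows M <= rows 1%:M}.
    move=> x /mapP[i _ ->]; have [j ->] := HM i isT.
    by apply: map_f; rewrite mem_enum.
  by have [] := uniq_min_size MU sub; rewrite ?size_rows.
have [nk|kn] := leqP n k.
  by apply: IH => i ki; have := ltn_ord i; rewrite ltnNge (leq_trans nk).
have [uM|/path_val_singular//] := boolP (M \in unitmx).
pose K := Ordinal kn.
(* Row [i] of [invmx M] expands the basis vector [e_i] in the rows of [M]. A nonzero coefficient at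
   row [K] allows [e_i] to replace that row, with factor [|invmx M i K|]. *)
have [i iK] : exists i, invmx M i K != 0.
  apply/existsP; apply: contraT => /existsPn H.
  have : delta_mx 0 K *m (invmx M)^T = 0 :> V.
    by apply/rowP => j; rewrite -rowE !mxE; apply/eqP/negPn/H.
  move/(congr1 (mulmx^~ M^T)); rewrite -mulmxA -trmx_mul mulmxV// trmx1 mulmx1.
  rewrite mul0mx => /rowP/(_ K); rewrite !mxE !eqxx.
  by move/eqP; rewrite oner_eq0.
pose M' : 'M[R]_n := \matrix_r (if r == K then row i 1%:M else row r M).
have rM' r : row r M' = if r == K then row i 1%:M else row r M by rewrite rowK.
have : path_val (rows M') = 0.
  apply: IH => r kr; rewrite rM'; case: eqP => [_|/eqP rK]; first by exists i.
  apply: HM; rewrite ltn_neqAle kr andbT; apply: contra rK => /eqP kr'.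
  by apply/eqP/val_inj.
rewrite (path_val_rows M' K) (path_val_rows M K) rM' eqxx.
have -> : [seq row i0 M' | i0 <- enum 'I_n & i0 != K] =
          [seq row i0 M | i0 <- enum 'I_n & i0 != K].
  by apply/eq_in_map => r; rewrite mem_filter rM' => /andP[/negPf->].
have -> : row i 1%:M = invmx M i K *: row K M +
    \sum_(r <- index_enum 'I_n | r != K) invmx M i r *: row r M.
  rewrite -(mulVmx uM) row_mul mulmx_sum_row (bigD1 K)//= mxE; congr (_ + _).
  by apply: eq_bigr => r _; rewrite mxE.
rewrite path_val_span; [|exact: size_rows_rem|]; last first.
  by move=> r rK; apply: map_f; rewrite mem_filter rK mem_enum.
rewrite path_val_scale1 ?size_rows_rem// => /eqP.
by rewrite mulf_eq0 normr_eq0 (negPf iK) => /eqP.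
Qed.

(** * Reduction of polytopes to simplices by affine dependencies *)

Section Radon.
Variable H : V -> Prop.
Hypothesis H_convex : forall a b (t : R), H a -> H b -> 0 <= t <= 1 ->
  H ((1 - t) *: a + t *: b).

Lemma Z_radon N k (L : seq (R * V)) :
  (forall J, (size J <= N)%N -> (forall w, w \in J -> H w) -> Z J = 0) ->
  size L = N.+1 -> (forall x, x \in L -> H x.2) ->
  \sum_(x <- L) x.1 = 0 -> \sum_(x <- L) x.1 *: x.2 = 0 ->
  count (fun x => 0 < x.1) L = k.+1 -> Z [seq x.2 | x <- L] = 0.
Proof.
move=> ZN; elim: k L => [|k IH] L LN LH.
  move=> s1 s2 cL.
  have /hasP[x xL x0] : has (fun x => 0 < x.1) L by rewrite has_count cL.
  have LE := perm_to_rem xL; set L' := rem x L in LE.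
  have neg y : y \in L' -> y.1 <= 0.
    move=> yL; rewrite leNgt; apply/negP => y0.
    move: cL; rewrite (permP LE) /= x0 add1n => -[] /eqP; apply/negP.
    by rewrite -lt0n -has_count; apply/hasP; exists y.
  rewrite (@Z_mem _ [seq y.2 | y <- x :: L']); last exact/perm_mem/perm_map.
  have L'0 : [seq y.2 | y <- L'] != [::].
    rewrite -size_eq0 size_map size_eq0; apply/eqP => E.
    by move: s1; rewrite (perm_big _ LE) E big_seq1; move: x0 => /gt_eqF/eqP.
  rewrite /= Z_redundant//; first apply: ZN.
  - by rewrite size_map -ltnS -LN (perm_size LE).
  - by move=> w /mapP[y yL ->]; apply: LH; rewrite (perm_mem LE) inE yL orbT.
  move=> z; rewrite -(ler_pM2l x0).
  set h := lmax _ _.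
  have -> : x.1 * h = \sum_(y <- L') - y.1 * h.
    rewrite -mulr_suml sumrN; congr (_ * _); apply/eqP.
    by move: s1; rewrite (perm_big _ LE) big_cons => /eqP; rewrite addr_eq0.
  have -> : x.1 * dotp x.2 z = \sum_(y <- L') - y.1 * dotp y.2 z.
    move: s2; rewrite (perm_big _ LE) big_cons => /eqP; rewrite addr_eq0.
    move=> /eqP/(congr1 (fun w => dotp w z)); rewrite dotpZl dotpNl dotp_suml => ->.
    by rewrite -sumrN; apply: eq_bigr => y _; rewrite dotpZl mulNr.
  rewrite big_seq [X in _ <= X]big_seq; apply: ler_sum => y yL.
  apply: ler_wpM2l; first by rewrite oppr_ge0 neg.
  by apply: (@lmax_ge _ _ (fun w => dotp w z)); exact: map_f.
move=> s1 s2 cL.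
have /hasP[x xL x0] : has (fun x => 0 < x.1) L by rewrite has_count cL.
have LE := perm_to_rem xL; set L' := rem x L in LE.
have cL' : count (fun x => 0 < x.1) L' = k.+1.
  by move: cL; rewrite (permP LE) /= x0 add1n => -[].
have /hasP[y yL y0] : has (fun x => 0 < x.1) L' by rewrite has_count cL'.
have LE' := perm_to_rem yL; set L'' := rem y L' in LE'.
have {}LE : perm_eq L (x :: y :: L'').
  by apply: (perm_trans LE); rewrite perm_cons.
have cL'' : count (fun x => 0 < x.1) L'' = k.
  by move: cL'; rewrite (permP LE') /= y0 add1n => -[].
have xy0 : 0 < x.1 + y.1 by rewrite addr_gt0.
pose t := y.1 / (x.1 + y.1).
have t01 : 0 <= t <= 1.
  apply/andP; split; first by rewrite divr_ge0// ltW.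
  by rewrite ler_pdivrMr// mul1r lerDr ltW.
have := Z_cut x.2 y.2 [seq q.2 | q <- L''] t01.
cbv zeta; set c := (1 - t) *: x.2 + t *: y.2.
have cE : (x.1 + y.1) *: c = x.1 *: x.2 + y.1 *: y.2.
  rewrite /c scalerDr !scalerA; congr (_ *: _ + _ *: _); rewrite /t.
    by field; rewrite gt_eqF.
  by field; rewrite gt_eqF.
have Hx : H x.2 by apply: LH; rewrite (perm_mem LE) mem_head.
have Hy : H y.2 by apply: LH; rewrite (perm_mem LE) !inE eqxx orbT.
have Hc : H c by exact: H_convex.
have HL q : q \in L'' -> H q.2.
  by move=> qL; apply: LH; rewrite (perm_mem LE) !inE qL !orbT.
have sL : (size L'').+1 = N.
  by apply/eqP; rewrite -eqSS -LN (perm_size LE).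
rewrite (ZN (c :: _)); last 2 first.
- by rewrite /= size_map sL.
- by move=> w; rewrite inE => /orP[/eqP->//|/mapP[w' /HL ? ->]].
have -> : Z [:: x.2, y.2 & [seq q.2 | q <- L'']] = Z [seq x.2 | x <- L].
  by apply: Z_mem => w; rewrite (perm_mem (perm_map _ LE)).
rewrite addr0 => ->.
move: s1 s2; rewrite !(perm_big _ LE) /= !big_cons !addrA -cE => s1 s2.
have := IH ((0, x.2) :: (x.1 + y.1, c) :: L''); rewrite /= => ->; first last.
- by rewrite ltxx xy0 cL''.
- by rewrite !big_cons /= scale0r add0r.
- by rewrite !big_cons /= add0r.
- by move=> w; rewrite !inE => /orP[/eqP->//|/orP[/eqP->//|/HL]].
- by rewrite sL.
have := IH ((x.1 + y.1, c) :: (0, y.2) :: L''); rewrite /= => ->; first last.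
- by rewrite ltxx xy0 cL''.
- by rewrite !big_cons /= scale0r add0r.
- by rewrite !big_cons /= add0r.
- by move=> w; rewrite !inE => /orP[/eqP->//|/orP[/eqP->//|/HL]].
- by rewrite sL.
by rewrite addr0.
Qed.

(** More than [n + 1] points are affinely dependent: the matrix of the points with a column of ones
    appended has [n + 1] columns, hence a nonzero left kernel vector, and its entries are the
    weights. *)
Lemma Z_reduce :
  (forall J, (size J <= n.+1)%N -> (forall w, w \in J -> H w) -> Z J = 0) ->
  forall J, (forall w, w \in J -> H w) -> Z J = 0.
Proof.
move=> Zn1 J; suff H' N : (n < N)%N -> forall J, (size J <= N)%N ->
    (forall w, w \in J -> H w) -> Z J = 0.
  by apply: (H' (maxn n.+1 (size J))); rewrite ?leq_maxl ?leq_maxr.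
elim: N {J} => // N IH; rewrite ltnS leq_eqVlt => /orP[/eqP <-//|nN] J.
rewrite leq_eqVlt => /orP[/eqP JN JH|]; last by rewrite ltnS; exact: IH.
pose A : 'M[R]_(N.+1, n + 1) :=
  row_mx (\matrix_(i, j) (nth 0 J i) ord0 j) (const_mx 1).
have : kermx A != 0.
  rewrite kermx_eq0 /row_free neq_ltn (leq_ltn_trans (rank_leq_col _))//.
  by rewrite addn1.
move=> /rowV0Pn[l /sub_kermxP lA l0].
pose L := [seq (l ord0 i, nth 0 J i) | i <- enum 'I_N.+1].
have LJ : [seq x.2 | x <- L] = J.
  rewrite -map_comp /comp /= (map_comp (nth 0 J) val) val_enum_ord -JN.
  exact: mkseq_nth.
have s1 : \sum_(x <- L) x.1 = 0.
  move: lA; rewrite mul_mx_row => /(congr1 rsubmx); rewrite row_mxKr.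
  move=> /matrixP/(_ ord0 ord0); rewrite !mxE => lA.
  rewrite big_map big_enum /= -[RHS]lA; apply: eq_bigr => i _.
  by rewrite mxE mulr1.
have s2 : \sum_(x <- L) x.1 *: x.2 = 0.
  move: lA; rewrite mul_mx_row => /(congr1 lsubmx); rewrite row_mxKl => lA.
  apply/rowP => j; rewrite big_map big_enum /= summxE.
  move: lA => /matrixP/(_ ord0 j); rewrite !mxE => lA; rewrite -[RHS]lA.
  by apply: eq_bigr => i _; rewrite !mxE.
have : (0 < count (fun x => (0 < x.1)%R) L)%N.
  rewrite -has_count; apply/negPn/negP => /hasPn neg.
  move: l0; apply/negP/negPn/eqP/rowP => i; rewrite [RHS]mxE.
  have : \sum_(x <- L) - x.1 = 0 by rewrite sumrN s1 oppr0.
  rewrite big_map big_enum /= => /eqP; rewrite psumr_eq0.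
    by move=> /allP/(_ i); rewrite mem_index_enum oppr_eq0 => /(_ isT)/eqP.
  move=> j _; rewrite oppr_ge0 leNgt; apply: (neg (l ord0 j, nth 0 J j)).
  by apply: map_f; rewrite mem_enum.
case E : (count _ _) => [//|k] _; rewrite -LJ.
apply: (@Z_radon N k) => //; first exact: IH.
  by rewrite size_map size_enum_ord.
by move=> x xL; apply: JH; rewrite -LJ map_f.
Qed.

End Radon.

Lemma Z_rows J : size J = n.+1 -> exists M p, Z J = path_val (rows M) /\
  J = spath p (rows M).
Proof.
case: J => // p J [Jn]; pose u := pairmap (fun x y => y - x) p J.
have un : size u = n by rewrite size_pairmap.
exists (\matrix_(i < n) nth 0 u i), p.
have -> : rows (\matrix_(i < n) nth 0 u i) = u.
  rewrite /rows (eq_map (fun i => rowK _ i)) (map_comp (nth 0 u) val).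
  by rewrite val_enum_ord; have := mkseq_nth 0 u; rewrite un.
by rewrite -(Z_spath p) spath_pairmap.
Qed.

(** Taking the hyperplane for [H] leaves simplices with vertices in it; their edges are orthogonal
    to [v], so the edge matrix is singular. *)
Theorem Z_hyperplane v (k : R) J : v != 0 ->
  (forall w, w \in J -> dotp w v = k) -> Z J = 0.
Proof.
move=> v0; apply: (@Z_reduce (fun w => dotp w v = k)) => [a b t ak bk t01|{}J].
  by rewrite dotpDl !dotpZl ak bk; ring.
rewrite leq_eqVlt ltnS => /orP[/eqP Jn JH|/Z_small//].
have [M [p [-> E]]] := Z_rows Jn; apply: path_val_singular.
have uv x : x \in rows M -> dotp x v = 0.
  have : forall w, w \in spath p (rows M) -> dotp w v = k by rewrite -E.
  elim: (rows M) p {E} => // a u IH p; rewrite spath_cons => Hp.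
  have pk : dotp p v = k by apply: Hp; rewrite mem_head.
  have pa : dotp (p + a) v = k by apply: Hp; rewrite !inE eqxx orbT.
  rewrite inE => /orP[/eqP->|]; first by apply/eqP; move: pa; rewrite dotpDl pk;
    move=> /eqP; rewrite eq_sym -subr_eq0 opprD addNKr oppr_eq0.
  by apply: (IH (p + a)) => w wu; apply: Hp; rewrite inE wu orbT.
apply/negP => uM; move/negP: v0; apply; apply/eqP.
have : M *m v^T = 0.
  apply/matrixP => i j; rewrite ord1 [RHS]mxE -(uv (row i M)); last first.
    by apply: map_f; rewrite mem_enum.
  by rewrite dotpE -row_mul [RHS]mxE.
move=> /(congr1 (mulmx (invmx M))); rewrite mulKmx// mulmx0.
by move=> /(congr1 trmx); rewrite trmxK trmx0.
Qed.

(** The uniqueness of volume. It is applied to the difference between a valuation and a multiple of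
    volume, and also to volume itself, to see that the standard simplex is not a null set. *)
Theorem Z_eq0 J : Z (spath 0 (rows 1%:M)) = 0 -> Z J = 0.
Proof.
move=> e0; apply: (@Z_reduce (fun=> True)) => // {}J.
rewrite leq_eqVlt ltnS => /orP[/eqP Jn _|/Z_small//].
by have [M [p [-> E]]] := Z_rows Jn; exact: path_val_basis.
Qed.

End HomogeneousValuation.

(** * Metric facts about row vectors *)

Lemma eventually_natr_gt (R : realType) (x : R) :
  exists N, forall k, (N <= k)%N -> x < k%:R.
Proof.
exists (Num.truncn x).+1 => k Nk; apply: (lt_le_trans (truncnS_gt _)).
by rewrite ler_nat.
Qed.

Section Metric.
Variables (R : realType) (n : nat).
Notation V := 'rV[R]_n.
Implicit Types (x y z p : V) (A K U : set V).

Lemma normrV_coord x i : `|x ord0 i| <= `|x|.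
Proof.
rewrite [leRHS]/Num.norm /= mx_normrE.
exact: (le_bigmax_cond _ (fun ij => `|x ij.1 ij.2|) (j := (ord0, i))).
Qed.

Lemma normrV_le x (c : R) : 0 <= c -> (forall i, `|x ord0 i| <= c) -> `|x| <= c.
Proof.
move=> c0 xc; rewrite [leLHS]/Num.norm /= mx_normrE.
by apply/bigmax_leP; split=> // -[i j] _ /=; rewrite ord1.
Qed.

(** The norm of row vectors is the maximum norm, hence the factor [n]. *)
Lemma dotp_norm x y : `|dotp x y| <= n%:R * `|x| * `|y|.
Proof.
apply: (le_trans (ler_norm_sum _ _ _)).
have -> : n%:R * `|x| * `|y| = \sum_(i < n) `|x| * `|y|.
  by rewrite sumr_const card_ord -mulrA -(mulr_natl (_ * _)).
apply: ler_sum => i _; rewrite normrM.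
by apply: ler_pM => //; exact: normrV_coord.
Qed.

Lemma dotp_delta p i : dotp p (delta_mx 0 i) = p ord0 i.
Proof.
rewrite /dotp (bigD1 i)//= big1 ?addr0; last first.
  by move=> j ji; rewrite mxE (negPf ji) andbF mulr0.
by rewrite mxE !eqxx mulr1.
Qed.

Lemma open_normP U : open U <->
  forall x, U x -> exists2 d : R, 0 < d & forall y, `|y - x| <= d -> U y.
Proof.
rewrite openE; split=> UO x Ux.
  have /nbhs_ballP[d /= d0 dU] := UO _ Ux; exists (d / 2); first by rewrite divr_gt0.
  move=> y yd; apply: dU; rewrite mx_norm_ball /ball_ /= distrC.
  by apply: (le_lt_trans yd); rewrite ltr_pdivrMr// ltr_pMr// ltr1n.
have [d d0 dU] := UO _ Ux; apply/nbhs_ballP; exists d => //= y.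
by rewrite mx_norm_ball /ball_ /= distrC => /ltW/dU.
Qed.

Lemma nbhs_normrP x (P : V -> Prop) : (\forall y \near x, P y) <->
  exists2 d : R, 0 < d & forall y, `|y - x| < d -> P y.
Proof.
split=> [/nbhs_ballP[d d0 dP]|[d d0 dP]].
  exists d => // y yd; apply: dP.
  by rewrite mx_norm_ball /ball_ /= distrC.
by apply/nbhs_ballP; exists d => //= y; rewrite mx_norm_ball /ball_ /= distrC; exact: dP.
Qed.

Lemma continuous_normP x (f : V -> R) : {for x, continuous f} <->
  forall e : R, 0 < e -> exists2 d : R, 0 < d &
    forall y, `|y - x| < d -> `|f y - f x| < e.
Proof.
split=> [fc e e0|fc].
  have /cvgrPdist_lt/(_ _ e0)/nbhs_normrP[d d0 dP] := fc.
  by exists d => // y /dP; rewrite distrC.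
apply/(@cvgrPdist_lt _ _ _ (nbhs x)) => e e0; apply/nbhs_normrP.
by have [d d0 dP] := fc _ e0; exists d => // y /dP; rewrite distrC.
Qed.

Lemma closed_normP A : closed A <->
  forall x, (forall e : R, 0 < e -> exists2 y, A y & `|y - x| < e) -> A x.
Proof.
split=> [cA x xA|cA x xA].
  apply: cA => B /nbhs_normrP[d d0 dB].
  by have [y Ay yx] := xA _ d0; exists y; split=> //; exact: dB.
apply: cA => e e0; have [|y [Ay ye]] := xA [set y | `|y - x| < e].
  by apply/nbhs_normrP; exists e.
by exists y.
Qed.

Lemma compact_seq_cluster K (x_ : nat -> V) : compact K -> (forall k, K (x_ k)) ->
  exists2 x, K x & forall (e : R) N, 0 < e -> exists2 k, (N <= k)%N & `|x_ k - x| < e.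
Proof.
move=> cK xK; have [x [Kx clx]] : K `&` cluster (x_ @ \oo) !=set0.
  by apply: cK; exists 0%N => // k _; exact: xK.
exists x => // e N e0.
have [|| y [/= [k Nk <-] ye]] := clx [set x_ k | k in [set k | (N <= k)%N]] [set y | `|y - x| < e].
- by exists N => // k /= Nk; exists k.
- by apply/nbhs_normrP; exists e.
by exists k.
Qed.

Lemma compact_closed_rV K : compact K -> closed K.
Proof. by apply: compact_closed; exact: norm_hausdorff. Qed.

Lemma compact_normP K : compact K <-> closed K /\ exists M : R, forall x, K x -> `|x| <= M.
Proof.
split=> [cK|[cK [M KM]]].
  split; first exact: compact_closed_rV.
  have [M [_ MK]] := compact_bounded cK; exists (M + 1) => x Kx.
  by apply: (MK (M + 1)) => //; rewrite ltrDl.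
apply: bounded_closed_compact cK; exists M; split; first exact: num_real.
by move=> N MN x /KM/le_trans; apply; exact: ltW.
Qed.

Lemma closed_ball_compact x (d : R) : compact [set y | `|y - x| <= d].
Proof.
apply/compact_normP; split.
  apply/closed_normP => y yd /=; rewrite leNgt; apply/negP => dy.
  have [z /= zd zy] := yd (`|y - x| - d) ltac:(by rewrite subr_gt0).
  have := ler_distD z y x; rewrite (distrC y z); lra.
exists (d + `|x|) => y /= yx; have := ler_normD (y - x) x; rewrite subrK.
by move=> /le_trans; apply; rewrite lerD2r.
Qed.

Lemma compact_open_nbhs K U : compact K -> open U -> K `<=` U ->
  exists2 d : R, 0 < d & forall x y, K x -> `|y - x| <= d -> U y.
Proof.
move=> cK oU KU; apply: contrapT => H.
have {}H (k : nat) : exists xy : V * V, [/\ K xy.1, `|xy.2 - xy.1| <= k.+1%:R^-1 & ~ U xy.2].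
  apply: contrapT => Hk; apply: H; exists k.+1%:R^-1; first by rewrite invr_gt0.
  by move=> x y Kx yx; apply: contrapT => Uy; apply: Hk; exists (x, y).
have /choice[xy xyP] := H.
have [x Kx clx] := compact_seq_cluster (x_ := fun k => (xy k).1) cK (fun k => let: And3 a _ _ := xyP k in a).
have /open_normP/(_ _ (KU _ Kx))[d d0 dU] := oU.
have d2 : 0 < d / 2 by rewrite divr_gt0.
have [N NP] := eventually_natr_gt (d / 2)^-1.
have [k Nk xk] := clx _ N d2.
have [_ yk] := xyP k; apply; apply: dU.
have kd : k.+1%:R^-1 < d / 2.
  rewrite invf_plt ?posrE//; apply: NP.
  exact: leqW.
apply: (le_trans (ler_distD (xy k).1 _ _)); rewrite [leRHS]splitr.
by apply: lerD; [exact: (le_trans yk (ltW _))|exact: ltW].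
Qed.

Lemma compact_thickening K U : compact K -> open U -> K `<=` U ->
  exists2 d : R, 0 < d & exists K', [/\ compact K', K' `<=` U &
    forall x y, K x -> `|y - x| <= d -> K' y].
Proof.
move=> cK oU KU; have [d d0 dU] := compact_open_nbhs cK oU KU.
exists d => //; pose C := [set y : V | `|y - 0| <= d].
exists ((fun xy : V * V => xy.1 + xy.2) @` (K `*` C)); split.
- apply: continuous_compact; last by apply: compact_setX => //; exact: closed_ball_compact.
  by apply: continuous_subspaceT => -[a b]; exact: add_continuous.
- move=> _ [[x y] [/= Kx yd] <-]; apply: (dU x) => //.
  by rewrite addrC addKr -[y]subr0.
- move=> x y Kx yx; exists (x, y - x) => /=; last by rewrite addrC subrK.
  by split=> //; rewrite /C /= subr0.
Qed.

Lemma compact_bounded_fun K (f : V -> R) : compact K ->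
  (forall x, K x -> {for x, continuous f}) -> exists B : R, forall x, K x -> `|f x| <= B.
Proof.
move=> cK fK; apply: contrapT => H.
have {}H (k : nat) : exists x, K x /\ k%:R < `|f x|.
  apply: contrapT => Hk; apply: H; exists k%:R => x Kx.
  by rewrite leNgt; apply/negP => kx; apply: Hk; exists x.
have /choice[x_ xP] := H.
have [x Kx clx] := compact_seq_cluster cK (fun k => (xP k).1).
have [d d0 dP] := (continuous_normP x f).1 (fK _ Kx) 1 ltr01.
have [N NP] := eventually_natr_gt (`|f x| + 1).
have [k Nk /dP xk] := clx _ N d0.
have [_] := xP k; apply/negP; rewrite -leNgt.
have := NP _ Nk.
have := ler_distD (f x) (f (x_ k)) 0; rewrite !subr0; lra.
Qed.

End Metric.

(** * Convex functions *)

Section Convex.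
Variables (R : realType) (n : nat).
Notation V := 'rV[R]_n.
Implicit Types (x y z p : V) (f : V -> R) (J : seq V).
Hypothesis n_gt0 : (0 < n)%N.

Lemma convex_set_avg (P : set V) J : Defs.convex_set P -> J != [::] ->
  (forall x, x \in J -> P x) -> P ((size J)%:R^-1 *: \sum_(x <- J) x).
Proof.
move=> cP; elim: J => // a J IH _ JP.
have [->|J0] := eqVneq J [::].
  by rewrite big_seq1 invr1 scale1r; apply: JP; rewrite mem_head.
have Pa : P a by apply: JP; rewrite mem_head.
have {IH} PJ : P ((size J)%:R^-1 *: \sum_(x <- J) x).
  by apply: IH => // x xJ; apply: JP; rewrite inE xJ orbT.
have s0 : (0 : R) < (size J)%:R by rewrite ltr0n lt0n size_eq0.
pose t : R := (size J).+1%:R^-1.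
have s1 : (0 : R) < 1 + (size J)%:R by rewrite ltr_pwDl.
have t01 : 0 <= t <= 1.
  by rewrite invr_ge0 ler0n /= invf_le1 ?ltr0n// ler1n.
have := cP _ _ _ PJ Pa t01; congr P.
rewrite big_cons scalerA scalerDr addrC -/t; congr (_ + _ *: _).
rewrite /t -natr1 addrC; field.
by rewrite !gt_eqF.
Qed.

Lemma convex_sublevel U f (c : R) : Defs.convex_set U -> convex_on U f ->
  Defs.convex_set [set x | U x /\ f x <= c].
Proof.
move=> cU cf x y t [Ux fx] [Uy fy] t01; split; first exact: cU.
apply: (le_trans (cf _ _ _ Ux Uy t01)); nra.
Qed.

Variable U : set V.
Hypothesis U_open : open U.
Hypothesis U_convex : Defs.convex_set U.

Let e_ (i : 'I_n) : V := delta_mx 0 i.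

Lemma norm_basis_scale (i : 'I_n) (s : R) : `|s *: (delta_mx 0 i : V)| <= `|s|.
Proof.
apply: normrV_le => // j; rewrite !mxE /=.
by case: (j == i); rewrite ?mulr1 ?mulr0 ?normr0.
Qed.

(** A point [y] near [x] is the average of the [n] points obtained from [x] by moving along axis [i]
    by [n] times the [i]-th coordinate of [y - x]. Each of them lies between [x - r e_i] and
    [x + r e_i], where [f] is at most [c]; this is why the radius is [r / n]. *)
Lemma convex_bounded_above f x : convex_on U f -> U x ->
  exists2 d : R, 0 < d & exists c : R, forall y, `|y - x| <= d -> U y /\ f y <= c.
Proof.
move=> cf Ux; have /open_normP/(_ _ Ux)[r r0 rU] := U_open.
pose J := [seq x + r *: e_ i | i <- enum 'I_n] ++ [seq x - r *: e_ i | i <- enum 'I_n].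
pose c := lmax f J; pose P := [set y | U y /\ f y <= c].
have cP : Defs.convex_set P by exact: convex_sublevel.
have PJ y : y \in J -> P y.
  move=> yJ; split; last exact: lmax_ge.
  move: yJ; rewrite mem_cat => /orP[] /mapP[i _ ->]; apply: rU.
    by rewrite addrAC subrr add0r (le_trans (norm_basis_scale _ _))// gtr0_norm.
  by rewrite addrAC subrr add0r normrN (le_trans (norm_basis_scale _ _))// gtr0_norm.
have Pi i (s : R) : `|s| <= r -> P (x + s *: e_ i).
  move=> sr; pose t := (s / r + 1) / 2.
  have t01 : 0 <= t <= 1.
    move: sr; rewrite ler_norml => /andP[s1 s2].
    have : -1 <= s / r by rewrite ler_pdivlMr// mulN1r.
    have : s / r <= 1 by rewrite ler_pdivrMr// mul1r.
    by rewrite /t; move=> *; apply/andP; split; lra.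
  have P1 : P (x + r *: e_ i).
    by apply: PJ; rewrite mem_cat (map_f (fun i => x + r *: e_ i)) ?mem_enum.
  have P2 : P (x - r *: e_ i).
    by apply: PJ; rewrite mem_cat orbC (map_f (fun i => x - r *: e_ i)) ?mem_enum.
  have := cP _ _ _ P2 P1 t01; congr P.
  apply/rowP => j; rewrite !mxE /t; field.
  by rewrite gt_eqF.
have n0 : 0 < n%:R :> R by rewrite ltr0n.
exists (r / n%:R); first by rewrite divr_gt0.
exists c => y yx.
pose K := [seq x + (n%:R * (y - x) ord0 i) *: e_ i | i <- enum 'I_n].
have := @convex_set_avg P K cP; rewrite size_map size_enum_ord.
have -> : n%:R^-1 *: \sum_(z <- K) z = y.
  rewrite big_map big_enum /= big_split /= sumr_const card_ord.
  have -> : \sum_i (n%:R * (y - x) ord0 i) *: e_ i = n%:R *: (y - x).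
    rewrite [in RHS](row_sum_delta (y - x)) scaler_sumr.
    by apply: eq_bigr => i _; rewrite scalerA.
  rewrite -(scaler_nat n x) scalerDr !scalerA mulVf ?gt_eqF// !scale1r.
  by rewrite addrC subrK.
move=> H; suff : P y by [].
apply: H.
  by rewrite -size_eq0 size_map size_enum_ord -lt0n.
move=> z /mapP[i _ ->]; apply: Pi; rewrite normrM ger0_norm// mulrC -ler_pdivlMr//.
by apply: le_trans yx; exact: normrV_coord.
Qed.

(** The upper estimate follows the ray from [x] through [y] to distance [d]; the lower one uses the
    reflection of [y] in [x]. *)
Lemma convex_lipschitz_at f x : convex_on U f -> U x ->
  exists2 d : R, 0 < d & exists c : R, forall y, `|y - x| <= d ->
    `|f y - f x| <= c * `|y - x|.
Proof.
move=> cf Ux; have [d d0 [c dc]] := convex_bounded_above cf Ux.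
exists d => //; exists ((c - f x) / d).
have up y : `|y - x| <= d -> f y - f x <= (c - f x) / d * `|y - x|.
  move=> yd; have [->|yx] := eqVneq y x; first by rewrite !subrr normr0 mulr0.
  pose s := `|y - x|; have s0 : 0 < s by rewrite normr_gt0 subr_eq0.
  pose z := x + (d / s) *: (y - x).
  have zx : `|z - x| <= d.
    rewrite /z addrC addKr normrZ gtr0_norm ?divr_gt0//.
    by rewrite -/s divfK ?gt_eqF.
  have [Uz fz] := dc _ zx.
  have t01 : 0 <= s / d <= 1.
    apply/andP; split; first by rewrite divr_ge0// ltW.
    by rewrite ler_pdivrMr// mul1r.
  have := cf _ _ _ Ux Uz t01.
  have -> : (1 - s / d) *: x + (s / d) *: z = y.
    by apply/rowP => j; rewrite !mxE; field; rewrite !gt_eqF.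
  rewrite -/s => fy; have : f y <= (1 - s / d) * f x + s / d * c.
    by apply: (le_trans fy); rewrite lerD2l; apply: ler_wpM2l => //; case/andP: t01.
  have -> : (1 - s / d) * f x + s / d * c = (c - f x) / d * s + f x.
    by field; rewrite gt_eqF.
  by rewrite lerBlDr.
move=> y yd; rewrite ler_norml up// andbT lerNl opprB.
pose z := x + x - y; have zE : `|z - x| = `|y - x|.
  rewrite -[RHS]normrN; congr (`| _ |).
  by apply/rowP => j; rewrite !mxE; ring.
have zx : `|z - x| <= d by rewrite zE.
have [Uz _] := dc _ zx; have [Uy _] := dc _ yd.
have := up _ zx; rewrite zE => /(le_trans _); apply.
have h01 : 0 <= (2^-1 : R) <= 1 by apply/andP; split; lra.
have := cf _ _ _ Uy Uz h01.
have -> : (1 - 2^-1) *: y + 2^-1 *: z = x.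
  by apply/rowP => j; rewrite !mxE; field.
lra.
Qed.

Lemma convex_continuous f x : convex_on U f -> U x -> {for x, continuous f}.
Proof.
move=> cf Ux; have [d d0 [c dc]] := convex_lipschitz_at cf Ux.
apply/continuous_normP => e e0.
have c1 : 0 < `|c| + 1 by rewrite ltr_wpDl.
exists (Num.min d (e / (`|c| + 1))); first by rewrite lt_min d0 divr_gt0.
move=> y; rewrite lt_min => /andP[/ltW yd]; rewrite ltr_pdivlMr// => ye.
apply: (le_lt_trans (dc _ yd)); apply: le_lt_trans ye; rewrite mulrC.
by apply: ler_wpM2l => //; apply: (le_trans (ler_norm _)); rewrite lerDl.
Qed.

Lemma convex_bounded_compact f K : convex_on U f -> compact K -> K `<=` U ->
  exists B : R, forall x, K x -> `|f x| <= B.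
Proof.
move=> cf cK KU; apply: compact_bounded_fun => // x /KU.
exact: convex_continuous.
Qed.

Lemma subdiff_local f x p (d : R) : convex_on U f -> U x -> 0 < d ->
  (forall y, U y -> `|y - x| < d -> f x + dotp p (y - x) <= f y) -> subdiff U f x p.
Proof.
move=> cf Ux d0 H y Uy; have [->|yx] := eqVneq y x.
  by rewrite subrr dotp0r addr0.
have s0 : 0 < `|y - x| by rewrite normr_gt0 subr_eq0.
pose t := Num.min 1 (d / (2 * `|y - x|)).
have t0 : 0 < t by rewrite lt_min ltr01 divr_gt0// mulr_gt0.
have t1 : t <= 1 by rewrite ge_min lexx.
have t01 : 0 <= t <= 1 by rewrite t1 ltW.
pose z := (1 - t) *: x + t *: y.
have zx : z - x = t *: (y - x).
  by apply/rowP => j; rewrite !mxE; ring.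
have zd : `|z - x| < d.
  rewrite zx normrZ gtr0_norm//; have : t <= d / (2 * `|y - x|).
    by rewrite ge_min lexx orbT.
  rewrite ler_pdivlMr ?mulr_gt0// => tE.
  have : 0 < t * `|y - x| by rewrite mulr_gt0.
  nra.
have := H z (U_convex Ux Uy t01) zd; rewrite zx dotpZr.
have := cf _ _ _ Ux Uy t01; rewrite -/z => h1 h2.
rewrite -(ler_pM2l t0); nra.
Qed.

Lemma subdiff_bound f x p (d B : R) : 0 < d ->
  (forall y, `|y - x| <= d -> U y /\ `|f y| <= B) -> subdiff U f x p ->
  `|p| <= 2 * B / d.
Proof.
move=> d0 H px.
have [_ fx] : U x /\ `|f x| <= B by apply: H; rewrite subrr normr0 ltW.
have B0 : 0 <= B by exact: le_trans fx.
apply: normrV_le; first by rewrite divr_ge0 ?mulr_ge0// ltW.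
move=> i; rewrite ler_pdivlMr//.
(* Moving by [d] along axis [i], to the side where the linear form [p] does not decrease, isolates
   [|p_i| * d]. *)
pose s := Num.sg (p ord0 i) * d.
have yx : `|x + s *: e_ i - x| <= d.
  rewrite addrC addKr (le_trans (norm_basis_scale _ _))//.
  rewrite /s normrM (gtr0_norm d0) normr_sg.
  by case: eqP => _; rewrite ?mul1r ?mul0r// ltW.
have [Uy fy] := H _ yx.
have := px _ Uy; rewrite addrAC subrr add0r dotpZr.
rewrite dotp_delta.
have -> : s * p ord0 i = `|p ord0 i| * d by rewrite normrEsg /s mulrAC.
move: fx fy; rewrite !ler_norml => /andP[? ?] /andP[? ?]; lra.
Qed.

(* Hahn-Banach, one coordinate at a time. *)
Lemma subdiff_exists f x : convex_on U f -> U x -> exists p, subdiff U f x p.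
Proof.
move=> cf Ux.
suff H k : exists p, forall y, U y -> (forall i : 'I_n, (k <= i)%N -> (y - x) ord0 i = 0) ->
    f x + dotp p (y - x) <= f y.
  by have [p pP] := H n; exists p => y Uy; apply: pP => // i; rewrite leqNgt ltn_ord.
elim: k => [|k [p pP]].
  exists 0 => y Uy yx; have -> : y = x; last by rewrite dotp0l addr0.
  by apply/eqP; rewrite -subr_eq0; apply/eqP/rowP => i; rewrite yx// mxE.
have [nk|kn] := leqP n k.
  exists p => y Uy _; apply: pP => // i ki.
  by have := ltn_ord i; rewrite ltnNge (leq_trans nk).
pose K := Ordinal kn; pose c y := (y - x) ord0 K.
pose g y := f y - f x - dotp p (y - x).
pose flat y := forall i : 'I_n, (k < i)%N -> (y - x) ord0 i = 0.
(* For the coefficient of coordinate [K], a point with [c y > 0] imposes the upper bound [g y / c y]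
   and a point with [c y < 0] the lower bound [g y / c y]. They are compatible because a convex
   combination of the two points agrees with [x] in coordinate [K], where the inequality is
   known. *)
have key y1 y2 : U y1 -> U y2 -> flat y1 -> flat y2 -> 0 < c y1 -> c y2 < 0 ->
    g y2 / c y2 <= g y1 / c y1.
  move=> U1 U2 f1 f2 c1 c2.
  have c12 : 0 < c y1 - c y2 by lra.
  pose t := c y1 / (c y1 - c y2).
  have t01 : 0 <= t <= 1.
    apply/andP; split; first by rewrite divr_ge0 ?ltW.
    by rewrite ler_pdivrMr// mul1r; lra.
  have E : (1 - t) *: y1 + t *: y2 - x = (1 - t) *: (y1 - x) + t *: (y2 - x).
    by apply/rowP => j; rewrite !mxE; ring.
  have := pP ((1 - t) *: y1 + t *: y2) (U_convex U1 U2 t01).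
  rewrite E dotpDr !dotpZr => H.
  have {}H : f x + ((1 - t) * dotp p (y1 - x) + t * dotp p (y2 - x)) <=
      f ((1 - t) *: y1 + t *: y2).
    apply: H => i; rewrite leq_eqVlt => /orP[/eqP ki|ki].
      have -> : i = K by exact/val_inj.
      rewrite mxE [X in X + _]mxE [X in _ + X]mxE -!/(c _) /t.
      by field; rewrite gt_eqF.
    by rewrite mxE [X in X + _]mxE [X in _ + X]mxE f1// f2// !mulr0 addr0.
  have : 0 <= (1 - t) * g y1 + t * g y2.
    have := cf _ _ _ U1 U2 t01; rewrite /g; lra.
  have -> : (1 - t) * g y1 + t * g y2 = (c y1 * g y2 - c y2 * g y1) / (c y1 - c y2).
    by rewrite /t; field; rewrite gt_eqF.
  rewrite pmulr_lge0 ?invr_gt0// => h.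
  rewrite ler_ndivrMr// mulrAC ler_pdivrMr//; lra.
have /open_normP/(_ _ Ux)[d d0 dU] := U_open.
have dE (s : R) : x + s *: e_ K - x = s *: e_ K by rewrite addrC addKr.
have flatd (s : R) : flat (x + s *: e_ K).
  move=> i ki; rewrite dE !mxE (_ : (i == K) = false) ?andbF ?mulr0//.
  by apply/eqP => iK; rewrite iK ltnn in ki.
have cd (s : R) : c (x + s *: e_ K) = s by rewrite /c dE !mxE !eqxx mulr1.
have Ud (s : R) : `|s| <= d -> U (x + s *: e_ K).
  by move=> sd; apply: dU; rewrite dE (le_trans (norm_basis_scale _ _)).
pose A := [set a | exists y, [/\ U y, flat y, c y < 0 & a = g y / c y]].
have A0 : A !=set0.
  exists (g (x + (- d) *: e_ K) / c (x + (- d) *: e_ K)).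
  exists (x + (- d) *: e_ K); split=> //; first by apply: Ud; rewrite normrN gtr0_norm.
  by rewrite cd oppr_lt0.
have Aub y : U y -> flat y -> 0 < c y -> ubound A (g y / c y).
  by move=> Uy fy cy _ [z [Uz fz cz ->]]; exact: key.
have hA : has_ubound A.
  exists (g (x + d *: e_ K) / c (x + d *: e_ K)); apply: Aub => //.
    by apply: Ud; rewrite gtr0_norm.
  by rewrite cd.
pose a := sup A; exists (p + a *: e_ K) => y Uy fy.
rewrite dotpDl dotpZl (dotpC (e_ K)) dotp_delta -/(c y).
suff : a * c y <= g y by rewrite /g; lra.
have [cy|cy|cy] := ltgtP (c y) 0.
- rewrite -ler_ndivrMr//; apply: ub_le_sup => //; exists y; split=> //.
- rewrite -ler_pdivlMr//; apply: ge_sup => //; exact: Aub.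
- rewrite cy mulr0 /g; suff : f x + dotp p (y - x) <= f y by lra.
  apply: pP => // i; rewrite leq_eqVlt => /orP[/eqP ki|/fy//].
  by have -> : i = K by exact/val_inj.
Qed.

Lemma loc_unif_cvg_const f : loc_unif_cvg U (fun=> f) f.
Proof. by move=> K _ _ e e0; apply: nearW => j x _; rewrite subrr normr0. Qed.

(** Closedness of the graph of the subdifferential under locally uniform convergence. Base points in
    [K] are requested for infinitely many [j] only, which is what the negation of an eventual
    statement supplies. *)
Lemma subdiff_limit (f_ : nat -> V -> R) f K (p_ : nat -> V) p :
  convex_on U f -> loc_unif_cvg U f_ f -> compact K -> K `<=` U ->
  (forall e : R, 0 < e -> exists N, forall j, (N <= j)%N -> `|p_ j - p| < e) ->
  (forall N, exists j, (N <= j)%N /\ exists2 x, K x & subdiff U (f_ j) x (p_ j)) ->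
  exists2 x, K x & subdiff U f x p.
Proof.
move=> cf fcvg cK KU pcvg H.
have /choice[j_ jP] := H.
have {}jP N : exists x, [/\ (N <= j_ N)%N, K x & subdiff U (f_ (j_ N)) x (p_ (j_ N))].
  by have [? [x ? ?]] := jP N; exists x.
have /choice[x_ xP] := jP.
have [x Kx clx] := compact_seq_cluster (x_ := x_) cK (fun N => let: And3 _ a _ := xP N in a).
exists x => // y Uy; rewrite leNgt; apply/negP => lt_y.
(* Five errors of at most [e] occur below, so a defect of [8 * e] is impossible. *)
pose e := (f x + dotp p (y - x) - f y) / 8.
have e0 : 0 < e by rewrite divr_gt0// subr_gt0.
have [d1 d10 d1P] := (continuous_normP x f).1 (convex_continuous cf (KU _ Kx)) _ e0.
have [N1 _ N1P] := fcvg K cK KU _ e0.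
have [N2 _ N2P] := fcvg [set y] (@compact_set1 _ y) ltac:(by move=> _ ->) _ e0.
pose b := n%:R * (`|y - x| + 1); have b0 : 0 <= b by rewrite mulr_ge0// addr_ge0.
have [N3 N3P] := pcvg (e / (b + 1)) ltac:(by rewrite divr_gt0// ltr_wpDl).
pose b' := n%:R * `|p|; have b'0 : 0 <= b' by rewrite mulr_ge0.
pose d := Num.min (Num.min d1 1) (e / (b' + 1)).
have d0 : 0 < d by rewrite !lt_min d10 ltr01 divr_gt0// ltr_wpDl.
have [N Nk] := clx _ (maxn N1 (maxn N2 N3)) d0.
rewrite !lt_min -andbA => /and3P[/d1P xd1 xd2].
rewrite ltr_pdivlMr ?ltr_wpDl// => xd3.
have [Nj KN] := xP N; move=> /(_ _ Uy).
have {}Nj : (maxn N1 (maxn N2 N3) <= j_ N)%N by exact: leq_trans Nj.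
move: Nj; rewrite !geq_max => /and3P[/N1P J1 /N2P J2 /N3P J3].
have {J1} := J1 _ KN; have {J2} := J2 _ erefl.
move: J3; rewrite ltr_pdivlMr ?ltr_wpDl// => J3.
set j := j_ N in J3 *; set xN := x_ N in xd1 xd2 xd3 KN *.
have T1 : `|dotp (p_ j - p) (y - xN)| <= e.
  apply: (le_trans (dotp_norm _ _)); apply: le_trans (ltW J3).
  rewrite mulrAC mulrC; apply: ler_wpM2l => //.
  apply: (@le_trans _ _ b); last by rewrite lerDl.
  apply: ler_wpM2l => //; apply: (le_trans (ler_distD x _ _)).
  by rewrite lerD2l distrC ltW.
have T2 : `|dotp p (xN - x)| <= e.
  apply: (le_trans (dotp_norm _ _)); apply: le_trans (ltW xd3).
  by rewrite mulrC; apply: ler_wpM2l => //; rewrite lerDl.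
have E : dotp (p_ j) (y - xN) = dotp (p_ j - p) (y - xN) + dotp p (y - x) - dotp p (xN - x).
  by rewrite !dotpBl !dotpBr; ring.
rewrite E; move: T1 T2; rewrite !ler_norml !ltr_norml => /andP[? ?] /andP[? ?].
move=> /andP[? ?] /andP[? ?] ?; move: xd1; rewrite ltr_norml => /andP[? ?].
have : 8 * e = f x + dotp p (y - x) - f y by rewrite /e; field.
lra.
Qed.

Lemma subdiff_monotone f x y p q : U x -> U y -> subdiff U f x p ->
  subdiff U f y q -> 0 <= dotp (q - p) (y - x).
Proof.
move=> Ux Uy /(_ _ Uy) px /(_ _ Ux); rewrite -(opprB y x) dotpNr dotpBl; lra.
Qed.

Lemma subdiff_image_compact f K : convex_on U f -> compact K -> K `<=` U ->
  compact (subdiff_img U f K).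
Proof.
move=> cf cK KU; apply/compact_normP; split.
  apply/closed_normP => p pP.
  have /choice[p_ p_P] (k : nat) : exists q, subdiff_img U f K q /\ `|q - p| < k.+1%:R^-1.
    by have [q ? ?] := pP k.+1%:R^-1 ltac:(by rewrite invr_gt0); exists q.
  apply: (subdiff_limit (f_ := fun=> f) (p_ := p_)) => //.
  - exact: loc_unif_cvg_const.
  - move=> e e0; have [N NP] := eventually_natr_gt e^-1.
    exists N => j Nj; apply: (lt_trans (p_P j).2).
    by rewrite invf_plt ?posrE//; apply: NP; exact: leqW.
  - by move=> N; exists N; split=> //; have [[x Kx xp] _] := p_P N; exists x.
have [d d0 [K' [cK' K'U K'P]]] := compact_thickening cK U_open KU.
have [B BP] := convex_bounded_compact cf cK' K'U.
exists (2 * B / d) => p [x Kx px]; apply: (subdiff_bound _ _ px) => // y yx.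
by have K'y := K'P _ _ Kx yx; split; [exact: K'U|exact: BP].
Qed.

(* A strict minimum of [f - p] persists under small uniform perturbations. *)
Lemma subdiff_persist (f_ : nat -> V -> R) f x p (e : R) :
  (forall j, convex_on U (f_ j)) -> convex_on U f -> loc_unif_cvg U f_ f ->
  U x -> subdiff U f x p -> (forall y, U y -> subdiff U f y p -> y = x) -> 0 < e ->
  exists N, forall j, (N <= j)%N -> exists x', [/\ `|x' - x| < e, U x' & subdiff U (f_ j) x' p].
Proof.
move=> cf_ cf fcvg Ux px puniq e0.
have /open_normP/(_ _ Ux)[d d0 dU] := U_open.
pose r := Num.min d (e / 2); have r0 : 0 < r by rewrite lt_min d0 divr_gt0.
pose C := [set y | `|y - x| <= r].
have cC : compact C by exact: closed_ball_compact.
have CU : C `<=` U.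
  by move=> y /= yr; apply: dU; apply: (le_trans yr); rewrite ge_min lexx.
pose S := [set y | `|y - x| = r].
have cS : compact S.
  rewrite (_ : S = C `&` [set y | r <= `|y - x|]).
    apply: compact_closedI => //; apply/closed_normP => y yP /=.
    rewrite leNgt; apply/negP => yr.
    have [z /= zr zy] := yP (r - `|y - x|) ltac:(by rewrite subr_gt0).
    by have := ler_distD y z x; lra.
  apply/seteqP; split=> y; rewrite /S /C /=; first by move=> ->.
  by move=> [? ?]; apply/eqP; rewrite eq_le; apply/andP.
have SC : S `<=` C by move=> y; rewrite /S /C /= => ->.
have dc y : {for y, continuous (fun z : V => dotp p z)}.
  apply/continuous_normP => a a0; pose b := n%:R * `|p| + 1.
  have b0 : 0 < b by rewrite ltr_wpDl// mulr_ge0.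
  exists (a / b); first by rewrite divr_gt0.
  move=> z; rewrite ltr_pdivlMr// => za; rewrite -dotpBr.
  apply: (le_lt_trans (dotp_norm _ _)); apply: le_lt_trans za.
  by rewrite mulrC ler_wpM2l// lerDl.
have gc h y : convex_on U h -> U y -> {for y, continuous (fun z : V => h z - dotp p z)}.
  move=> ch Uy; apply: continuousB; last exact: dc.
  exact: convex_continuous.
have gw h A : convex_on U h -> A `<=` U -> {within A, continuous (fun z : V => h z - dotp p z)}.
  by move=> ch AU; apply: continuous_in_subspaceT => y /[!inE] /AU; exact: gc.
have S0 : S !=set0.
  pose i := Ordinal n_gt0; exists (x + r *: e_ i); rewrite /S /=.
  have -> : x + r *: e_ i - x = r *: e_ i by rewrite addrC addKr.
  apply/eqP; rewrite eq_le; apply/andP; split.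
    by rewrite (le_trans (norm_basis_scale _ _))// gtr0_norm.
  have := normrV_coord (r *: e_ i) i; rewrite !mxE !eqxx mulr1.
  by rewrite gtr0_norm.
have [c /[!inE] Sc cmin] := EVT_min_rV S0 cS (gw _ _ cf (subset_trans SC CU)).
have Uc := CU _ (SC _ Sc).
have gc0 : f x - dotp p x < f c - dotp p c.
  rewrite ltNge; apply/negP => le_c.
  have cx : c = x.
    apply: puniq => // y Uy; have := px _ Uy; rewrite !dotpBr; lra.
  by move: Sc; rewrite /S /= cx subrr normr0; move: r0 => /[swap] <-; rewrite ltxx.
(* Two perturbations smaller than [h] cannot close the gap [3 * h] between [x] and the sphere, so
   the minimiser of [f_ j - p] on the ball is an interior point. *)
pose h := (f c - dotp p c - (f x - dotp p x)) / 3.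
have h0 : 0 < h by rewrite divr_gt0// subr_gt0.
have [N _ NP] := fcvg C cC CU h h0.
exists N => j Nj; have {}NP y : C y -> `|f_ j y - f y| < h by exact: NP.
have Cx : C x by rewrite /C /= subrr normr0 ltW.
have [x' /[!inE] Cx' x'min] := EVT_min_rV (ex_intro _ x Cx) cC (gw _ _ (cf_ j) CU).
have x'r : `|x' - x| < r.
  rewrite lt_neqAle Cx' andbT; apply/eqP => Sx'.
  have := cmin x'; rewrite inE => /(_ Sx').
  have := x'min x; rewrite inE => /(_ Cx).
  have := NP _ Cx'; have := NP _ Cx; rewrite !ltr_norml => /andP[? ?] /andP[? ?].
  have : 3 * h = f c - dotp p c - (f x - dotp p x) by rewrite /h; field.
  lra.
have Ux' := CU _ Cx'.
exists x'; split=> //.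
  apply: (lt_le_trans x'r); rewrite ge_min; apply/orP; right; lra.
apply: (@subdiff_local _ x' p (r - `|x' - x|)) => //; first by rewrite subr_gt0.
move=> y Uy yx'; have := x'min y; rewrite inE => H.
have {}H : f_ j x' - dotp p x' <= f_ j y - dotp p y.
  by apply: H; rewrite /C /=; have := ler_distD x' y x; lra.
rewrite dotpBr; lra.
Qed.

End Convex.

(** * Polyhedral approximation *)

Definition pmax (R : realType) (n : nat) (L : seq ('rV[R]_n * R)) (x : 'rV[R]_n) : R :=
  lmax (fun a : 'rV[R]_n * R => dotp a.1 x + a.2) L.

Section Polyhedral.
Variables (R : realType) (n : nat).
Notation V := 'rV[R]_n.
Implicit Types (x y z p : V) (f : V -> R) (L : seq (V * R)).
Hypothesis n_gt0 : (0 < n)%N.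
Variable U : set V.
Hypothesis U_open : open U.
Hypothesis U_convex : Defs.convex_set U.

Lemma lmax_convex (T : eqType) (g : V -> T -> R) (J : seq T) :
  (forall a, a \in J -> convex_on U (fun x => g x a)) ->
  convex_on U (fun x => lmax (g x) J).
Proof.
move=> gc x y t Ux Uy t01; case/andP: (t01) => t0 t1.
have [->|J0] := eqVneq J [::]; first by rewrite !lmax_nil !mulr0 addr0.
apply: lmax_le => // a aJ; apply: (le_trans (gc _ aJ _ _ _ Ux Uy t01)).
by apply: lerD; apply: ler_wpM2l; rewrite ?subr_ge0//; exact: lmax_ge.
Qed.

Lemma affine_convex p (c : R) : convex_on U (fun x => dotp p x + c).
Proof. by move=> x y t _ _ _; rewrite dotpDr !dotpZr; lra. Qed.

Lemma pmax_convex L : convex_on U (pmax L).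
Proof. by apply: lmax_convex => a _; exact: affine_convex. Qed.

Lemma dense_sequence x0 : U x0 -> exists q_ : nat -> V, (forall i, U (q_ i)) /\
  forall x (e : R), U x -> 0 < e -> exists i, `|q_ i - x| < e.
Proof.
move=> U0.
pose q_ i := if (unpickle i : option 'rV[rat]_n) is Some r then
  let v : V := map_mx ratr r in if `[< U v >] then v else x0 else x0.
exists q_; split.
  by move=> i; rewrite /q_; case: unpickle => // r; case: asboolP.
move=> x e Ux e0; have /open_normP/(_ _ Ux)[d d0 dU] := U_open.
pose c := Num.min d (e / 2); have c0 : 0 < c by rewrite lt_min d0 divr_gt0.
have /choice[r rP] i : exists r : rat, `|ratr r - x ord0 i| < c.
  have [r] := @rat_in_itvoo R (x ord0 i - c) (x ord0 i + c) ltac:(lra).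
  rewrite in_itv /= => /andP[? ?]; exists r.
  by rewrite ltr_norml; apply/andP; split; lra.
pose q : 'rV[rat]_n := \row_i r i.
have qx : `|map_mx ratr q - x| <= c.
  by apply: normrV_le; [exact: ltW|move=> i; rewrite !mxE ltW].
exists (pickle q); rewrite /q_ pickleK asboolT; last first.
  by apply: dU; apply: (le_trans qx); rewrite ge_min lexx.
apply: (le_lt_trans qx); rewrite /c gt_min; apply/orP; right; lra.
Qed.

(** The approximants are maxima of the supporting affine functions at the first points of a dense
    sequence. If they stayed [e] below [f] at points [x_ N] of [K], then near a cluster point the
    affine function at some [q_ i], whose slope is bounded by [M], would already come closer than
    that: two oscillations of [f] and one linear term, each below [e / 4]. *)
Lemma polyhedral_approx f : convex_on U f -> exists L_ : nat -> seq (V * R),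
  loc_unif_cvg U (fun j => pmax (L_ j)) f.
Proof.
move=> cf; have [[x0 U0]|U0] := pselect (U !=set0); last first.
  exists (fun=> [::]) => K _ KU e e0; apply: nearW => j x /KU Ux.
  by exfalso; apply: U0; exists x.
have [q_ [qU qd]] := dense_sequence U0.
have /choice[p_ pP] i := subdiff_exists U_open U_convex cf (qU i).
pose a i : V * R := (p_ i, f (q_ i) - dotp (p_ i) (q_ i)).
pose L_ j := [seq a i | i <- iota 0 j.+1].
have aE i x : dotp (a i).1 x + (a i).2 = f (q_ i) + dotp (p_ i) (x - q_ i).
  by rewrite /a /= dotpBr; lra.
exists L_ => K cK KU e e0.
have Lf j x : U x -> pmax (L_ j) x <= f x.
  move=> Ux; apply: lmax_le => // _ /mapP[i _ ->]; rewrite aE.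
  exact: pP.
have La i j x : (i <= j)%N -> f (q_ i) + dotp (p_ i) (x - q_ i) <= pmax (L_ j) x.
  move=> ij; rewrite -aE.
  apply: (@lmax_ge _ _ (fun b : V * R => dotp b.1 x + b.2)); apply: map_f.
  by rewrite mem_iota.
apply: contrapT => H.
have {}H N : exists x, K x /\ forall i, (i <= N)%N ->
    f (q_ i) + dotp (p_ i) (x - q_ i) <= f x - e.
  apply: contrapT => HN; apply: H; exists N => // j /= Nj x Kx.
  rewrite distrC ger0_norm ?subr_ge0 ?Lf//; last exact: KU.
  rewrite ltNge; apply/negP => le_e; apply: HN; exists x; split=> // i iN.
  have := La i j x (leq_trans iN Nj); lra.
have /choice[x_ xP] := H.
have [x Kx clx] := compact_seq_cluster cK (fun N => (xP N).1).
have Ux := KU _ Kx.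
have [d1 d10 d1P] := (continuous_normP x f).1 (convex_continuous n_gt0 U_open U_convex cf Ux) (e / 4) ltac:(lra).
have /open_normP/(_ _ Ux)[d2 d20 d2U] := U_open.
have [B BP] := convex_bounded_compact n_gt0 U_open U_convex cf (@closed_ball_compact _ _ x d2) d2U.
have B0 : 0 <= B by apply: le_trans (BP x _); rewrite //= subrr normr0 ltW.
pose M := 2 * B / (d2 / 2).
have M0 : 0 <= M by rewrite divr_ge0// ?mulr_ge0//; lra.
have pM i : `|q_ i - x| <= d2 / 2 -> `|p_ i| <= M.
  move=> qx; apply: (subdiff_bound _ _ (pP i)); first lra.
  move=> y yq; have yx : `|y - x| <= d2.
    by have := ler_distD (q_ i) y x; lra.
  by split; [exact: d2U|exact: BP].
pose c := n%:R * M + 1.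
have c0 : 0 < c by rewrite ltr_wpDl// mulr_ge0.
pose d := Num.min d1 (Num.min (d2 / 2) (e / (8 * c))).
have d0 : 0 < d by rewrite !lt_min d10 !divr_gt0// mulr_gt0.
have [i qi] := qd _ _ Ux d0.
have [k ik xk] := clx _ i d0.
move: qi xk; rewrite !lt_min => /and3P[/d1P q1 /ltW q2 q3] /and3P[/d1P x1 _ x3].
have := (xP k).2 i ik; apply/negP; rewrite -ltNge.
have qx : `|x_ k - q_ i| * (4 * c) < e.
  have : `|x_ k - q_ i| < 2 * (e / (8 * c)).
    by have := ler_distD x (x_ k) (q_ i); rewrite (distrC x); lra.
  rewrite -ltr_pdivlMr ?mulr_gt0// => /lt_le_trans; apply.
  by rewrite le_eqVlt; apply/orP; left; apply/eqP; field; rewrite gt_eqF.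
have : `|dotp (p_ i) (x_ k - q_ i)| < e / 4.
  apply: (le_lt_trans (dotp_norm _ _)).
  rewrite ltr_pdivlMr//; apply: le_lt_trans qx.
  rewrite [leRHS]mulrCA [leLHS]mulrC ler_wpM2l// mulrC ler_wpM2l//.
  rewrite /c; apply: (@le_trans _ _ (n%:R * M)); last by rewrite lerDl.
  by rewrite ler_wpM2l// pM.
move: q1 x1; rewrite !ltr_norml => /andP[? ?] /andP[? ?] /andP[? ?]; lra.
Qed.

End Polyhedral.

(** * Lebesgue measure *)

Section UnitCubeCover.
Variable R : realType.
Local Open Scope ereal_scope.

(* Slicing along the last coordinate and integrating reduces a cover of the unit
   cube to covers of the unit cube of one dimension less. *)
Lemma unit_cube_cover n (P : pred nat) (a b : nat -> nat -> R) :
  (forall k i, (a k i <= b k i)%R) ->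
  (forall x : nat -> R, (forall i, (i < n)%N -> (0 <= x i <= 1)%R) ->
    exists2 k, P k & forall i, (i < n)%N -> (a k i <= x i <= b k i)%R) ->
  1 <= \sum_(0 <= k <oo | P k) (\prod_(i < n) (b k i - a k i))%:E.
Proof.
elim: n P => [|n IH] P ab cov.
  have [k Pk _] := cov (fun=> 0%R) ltac:(by []).
  apply: le_trans (nneseries_lim_ge k.+1 _) => [|j _ _]; last first.
    by rewrite lee_fin big_ord0.
  rewrite big_mkcond big_nat_recr//= Pk big_ord0.
  apply: leeDr; apply: sume_ge0 => i _; case: ifP => // _.
  by rewrite big_ord0 lee_fin.
pose v k := (\prod_(i < n) (b k i - a k i))%R.
have v0 k : (0 <= v k)%R by apply: prodr_ge0 => i _; rewrite subr_ge0.
pose D := (`[0%R, 1%R]%classic : set R).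
pose I k := (`[a k n, b k n]%classic : set R).
have muI k : lebesgue_measure (I k) = (b k n - a k n)%:E.
  rewrite /I lebesgue_measure_itv /= lte_fin; case: ltP => // ba.
  have -> : a k n = b k n by apply/eqP; rewrite eq_le ab.
  by rewrite subrr.
have muD : lebesgue_measure D = 1.
  by rewrite /D lebesgue_measure_itv /= lte_fin ltr01 -EFinD subr0.
(* The boxes whose last side contains [t] cover the slice at height [t]; the predicate [P] exists in
   order to select them. *)
have slice (t : R) : D t -> 1 <= \sum_(0 <= k <oo | P k) (v k * \1_(I k) t)%:E.
  rewrite /D /= in_itv /= => /andP[t0 t1].
  have := IH (fun k => P k && ((a k n <= t)%R && (t <= b k n)%R)) ab.
  move=> /(_ _)/le_trans; apply.
    move=> x x01; pose y i := if (i < n)%N then x i else t.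
    have [|k Pk kP] := cov y.
      by move=> i; rewrite /y ltnS; case: ltnP => [/x01//|]; rewrite t0 t1.
    exists k.
      by rewrite Pk; have := kP n (ltnSn n); rewrite /y ltnn.
    by move=> i iN; have := kP i (ltnW iN); rewrite /y iN.
  rewrite eseries_mkcondr; apply: lee_nneseries => k Pk.
    by move=> _; case: ifP => _ //; rewrite lee_fin v0.
  case: ifP => [h|_]; last by rewrite lee_fin mulr_ge0.
  by rewrite indicE mem_set ?mulr1// /I /= in_itv.
have mD : measurable D by exact: measurable_itv.
pose w k := if P k then v k else 0%R.
have w0 k : (0 <= w k)%R by rewrite /w; case: ifP.
have mI k : measurable_fun D (EFin \o (fun t => w k * \1_(I k) t)%R).
  apply/measurable_EFinP; apply: measurable_funM; first exact: measurable_cst.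
  by apply: measurable_indic; exact: measurable_itv.
have le1 : \int[lebesgue_measure]_(t in D) (cst 1 t) <=
    \int[lebesgue_measure]_(t in D) \sum_(0 <= k <oo) (w k * \1_(I k) t)%:E.
  apply: ge0_le_integral => //.
    apply: (ge0_emeasurable_sum (P := xpredT)) => [k t _ _|k _]; last exact: mI.
    by rewrite lee_fin mulr_ge0.
  move=> t /slice /le_trans; apply; rewrite eseries_mkcond.
  apply: lee_nneseries => k _; first by case: ifP => _; rewrite lee_fin ?mulr_ge0.
  by rewrite /w; case: ifP => _; rewrite ?mul0r.
move: le1; rewrite integral_cst//= muD mule1 => /le_trans; apply.
rewrite integral_nneseries//; last first.
  by move=> k t _; rewrite lee_fin mulr_ge0.
rewrite [leRHS]eseries_mkcond; apply: lee_nneseries => k _.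
  by move=> _; apply: integral_ge0 => t _; rewrite lee_fin mulr_ge0.
under eq_integral do rewrite EFinM.
rewrite ge0_integralZl_EFin//; last first.
  by apply/measurable_EFinP; apply: measurable_indic; exact: measurable_itv.
rewrite integral_indic//; last exact: measurable_itv.
rewrite /w; case: ifP => Pk; last by rewrite mul0e.
rewrite big_ord_recr /= -/(v k) EFinM -muI; apply: lee_wpmul2l; rewrite ?lee_fin//.
by apply: le_measure; rewrite ?inE; [apply: measurableI; exact: measurable_itv|exact: measurable_itv|].
Qed.

End UnitCubeCover.

(** * Lebesgue outer measure by countable box covers *)

Section LebesgueOuter.
Variables (R : realType) (n : nat).
Notation V := 'rV[R]_n.
Hypothesis n_gt0 : (0 < n)%N.
Implicit Types (A B : set V) (a b : nat -> V).
Local Open Scope ereal_scope.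

Definition box_cover A a b := (forall k i, (a k ord0 i <= b k ord0 i)%R) /\
  A `<=` \bigcup_k box (a k) (b k).

Lemma box_vol_ge0 (a b : V) : (forall i, (a ord0 i <= b ord0 i)%R) ->
  (0 <= box_vol a b)%R.
Proof. by move=> ab; apply: prodr_ge0 => i _; rewrite subr_ge0. Qed.

Lemma leb_outer_le A a b : box_cover A a b ->
  leb_outer A <= \sum_(0 <= k <oo) (box_vol (a k) (b k))%:E.
Proof. by move=> [ab AB]; apply: ereal_inf_lbound; exists a, b. Qed.

Lemma leb_outer_geP A (c : \bar R) : (forall a b, box_cover A a b ->
    c <= \sum_(0 <= k <oo) (box_vol (a k) (b k))%:E) -> c <= leb_outer A.
Proof.
by move=> H; apply/ereal_infP => _ [a [b [ab [AB ->]]]]; apply: H.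
Qed.

Lemma box_cover_ge0 A a b : box_cover A a b ->
  0 <= \sum_(0 <= k <oo) (box_vol (a k) (b k))%:E.
Proof.
by move=> [ab _]; apply: nneseries_ge0 => k _ _; rewrite lee_fin box_vol_ge0.
Qed.

Lemma leb_outer_ge0 A : 0 <= leb_outer A.
Proof. by apply: leb_outer_geP => a b; exact: box_cover_ge0. Qed.

Lemma le_leb_outer : {homo @leb_outer R n : A B / A `<=` B >-> A <= B}.
Proof.
move=> A B AB; apply: leb_outer_geP => a b [ab Bab]; apply: leb_outer_le.
by split=> //; exact: subset_trans Bab.
Qed.

Lemma box_vol_xx (x : V) : box_vol x x = 0%R.
Proof.
by rewrite /box_vol (bigD1 (Ordinal n_gt0))//= subrr mul0r.
Qed.

(** The single box is completed to a sequence by degenerate boxes at the origin, of volume [0]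
    because [0 < n]. *)
Lemma leb_outer_box (x y : V) : (forall i, (x ord0 i <= y ord0 i)%R) ->
  leb_outer (box x y) <= (box_vol x y)%:E.
Proof.
move=> xy; pose a k : V := if k is 0%N then x else 0%R.
pose b k : V := if k is 0%N then y else 0%R.
have := @leb_outer_le (box x y) a b; move=> /(_ _)/le_trans; apply.
  split; first by case=> [|k] i; rewrite //= !mxE.
  by move=> z zP; exists 0%N.
rewrite nneseries_recl//; last first.
  by case=> [|k]; rewrite lee_fin box_vol_ge0// => i; rewrite !mxE.
by rewrite [X in _ + X]eseries0 ?adde0// => -[|k] _ _ //=; rewrite box_vol_xx.
Qed.

Lemma leb_outer0 : leb_outer (set0 : set V) = 0.
Proof.
apply/eqP; rewrite eq_le leb_outer_ge0 andbT.
apply: le_trans (@le_leb_outer _ (box (0%R : V) 0%R) _) _ => //.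
by apply: (le_trans (leb_outer_box _)) => //; rewrite box_vol_xx.
Qed.

Lemma leb_outer_sigma_subadditive : sigma_subadditive (@leb_outer R n).
Proof.
move=> A; have [[i ioo]|] := pselect (exists i, leb_outer (A i) = +oo).
  rewrite (eseries_pinfty _ _ ioo) ?leey// => k _.
  by rewrite -ltNye (lt_le_trans _ (leb_outer_ge0 _)).
rewrite -forallNE => Aoo.
suff add2e (e : {posnum R}) :
    leb_outer (\bigcup_k A k) <= \sum_(0 <= i <oo) leb_outer (A i) + e%:num%:E.
  by apply/lee_addgt0Pr => _/posnumP[].
rewrite (le_trans _ (epsilon_trick _ _ _))//; last first.
  by move=> k; exact: leb_outer_ge0.
pose P k (ab : (nat -> V) * (nat -> V)) := box_cover (A k) ab.1 ab.2 /\
  \sum_(0 <= j <oo) (box_vol (ab.1 j) (ab.2 j))%:E <=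
    leb_outer (A k) + (e%:num / (2 ^ k.+1)%:R)%:E.
have [G PG] : {G : nat -> (nat -> V) * (nat -> V) & forall k, P k (G k)}.
  apply: (@choice _ _ P) => k.
  have en1 : (0 < e%:num / (2 ^ k.+1)%:R :> R)%R by [].
  have fA : leb_outer (A k) \is a fin_num.
    by rewrite ge0_fin_numE ?leb_outer_ge0// lt_neqAle leey andbT; exact/eqP/Aoo.
  have [x [a [b [ab [AB ->]]]] xS] := lb_ereal_inf_adherent en1 fA.
  by exists (a, b); split=> //; exact: ltW.
pose vol (ij : nat * nat) := (box_vol ((G ij.1).1 ij.2) ((G ij.1).2 ij.2))%:E.
have vol0 ij : 0 <= vol ij.
  by rewrite lee_fin box_vol_ge0// => i; apply: (PG ij.1).1.1.
apply: (@le_trans _ _ (\esum_(i in setT) vol i)).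
  have /card_esym/ppcard_eqP[f] := card_nat2.
  pose a k := (G (f k).1).1 (f k).2; pose b k := (G (f k).1).2 (f k).2.
  have := @leb_outer_le (\bigcup_k A k) a b; move=> /(_ _)/le_trans; apply.
    split; first by move=> k i; apply: (PG (f k).1).1.1.
    move=> t [i _ /(PG i).1.2[j _ tij]].
    by exists (f^-1%FUN (i, j)) => //=; rewrite /a /b invK ?inE.
  rewrite (nneseries_esumT (a := fun k => (box_vol (a k) (b k))%:E)); last first.
    by move=> k; exact: (vol0 (f k)).
  by rewrite (reindex_esum setT setT f).
pose J i : set (nat * nat) := [set (i, j) | j in setT].
rewrite (_ : setT = \bigcup_k J k); last first.
  by rewrite predeqE => -[i j]; split => // _; exists i => //; exists j.
rewrite nneseries_sum_bigcup//; last first.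
  apply/trivIsetP => i j _ _ ij; rewrite predeqE => -[k m]; split => //=.
  by move=> [[k1 _ [<- _]] [k2 _ [/esym/eqP]]]; rewrite (negbTE ij).
apply: lee_nneseries => k _; first by move=> _; exact: esum_ge0.
apply: le_trans (PG k).2; rewrite (nneseries_esumT (a := fun j => vol (k, j))); last first.
  by move=> j; exact: vol0.
rewrite (reindex_esum setT (J k) (pair k))//; split=> //.
  by move=> i _; exists i.
by move=> i j _ _ [].
Qed.

(* The hypothesis [0 < n] is part of the name because a point has positive
   volume when [n = 0]. *)
Definition lebo (_ : (0 < n)%N) : set V -> \bar R := @leb_outer R n.

End LebesgueOuter.

HB.instance Definition _ (R : realType) (n : nat) (h : (0 < n)%N) :=
  isOuterMeasure.Build R 'rV[R]_n (@lebo R n h) (leb_outer0 R h)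
    (@leb_outer_ge0 R n) (@le_leb_outer R n) (@leb_outer_sigma_subadditive R n).

(** * Caratheodory measurability of Borel sets, translations and dilations *)

Section LebesgueBorel.
Variables (R : realType) (n : nat).
Notation V := 'rV[R]_n.
Hypothesis n_gt0 : (0 < n)%N.
Implicit Types (A B : set V) (a b x y v : V).

Definition set_coord (x : V) (i : 'I_n) (c : R) : V :=
  \row_j (if j == i then c else x ord0 j).

Lemma box_volD1 (i : 'I_n) a b : box_vol a b =
  (b ord0 i - a ord0 i) * \prod_(j < n | j != i) (b ord0 j - a ord0 j).
Proof. by rewrite /box_vol (bigD1 i). Qed.

(** The hyperplane [x_i = c] cuts every covering box into two boxes of the same total volume; [d k]
    is [c] clamped to the [i]-th side of box [k]. *)
Lemma halfspace_caratheodory (i : 'I_n) (c : R) :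
  (lebo n_gt0).-caratheodory [set x | x ord0 i <= c].
Proof.
apply: le_caratheodory_measurable => X; apply: leb_outer_geP => a b [ab Xab].
pose d k := Num.max (a k ord0 i) (Num.min c (b k ord0 i)).
have ad k : a k ord0 i <= d k by rewrite /d le_max lexx.
have db k : d k <= b k ord0 i by rewrite /d ge_max ab ge_min lexx orbT.
pose b' k := set_coord (b k) i (d k); pose a' k := set_coord (a k) i (d k).
have ab' k j : a k ord0 j <= b' k ord0 j by rewrite mxE; case: eqP => // ->.
have a'b k j : a' k ord0 j <= b k ord0 j by rewrite mxE; case: eqP => // ->.
have volE k : ((box_vol (a k) (b k))%:E =
    (box_vol (a k) (b' k))%:E + (box_vol (a' k) (b k))%:E)%E.
  rewrite -EFinD; congr (_%:E); rewrite !(box_volD1 i) !mxE eqxx.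
  rewrite [X in _ = _ * X + _](eq_bigr (fun j => b k ord0 j - a k ord0 j)); last first.
    by move=> j ji; rewrite mxE (negPf ji).
  rewrite [X in _ = _ + _ * X](eq_bigr (fun j => b k ord0 j - a k ord0 j)); last first.
    by move=> j ji; rewrite mxE (negPf ji).
  by rewrite -mulrDl; congr (_ * _); ring.
rewrite (@eq_eseriesr _ _ (fun k => (box_vol (a k) (b' k))%:E + (box_vol (a' k) (b k))%:E)%E); last first.
  by move=> k _; exact: volE.
rewrite nneseriesD; try by move=> k _ _; rewrite lee_fin box_vol_ge0.
apply: leeD; apply: leb_outer_le; split=> // x [Xx /= xc].
  have [k _ kx] := Xab _ Xx; exists k => // j; have /andP[h1 h2] := kx j.
  rewrite h1 mxE; case: eqP => // ji; rewrite /d -ji le_max le_min h2 ji xc orbT.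
  by [].
have [k _ kx] := Xab _ Xx; exists k => // j; have /andP[h1 h2] := kx j.
rewrite h2 andbT mxE; case: eqP => // ji; rewrite /d -ji ge_max h1 ge_min.
by move/negP: xc; rewrite -ltNge ji => /ltW ->.
Qed.

Lemma open_bigcup_box (O : set V) : open O ->
  exists a_ b_ : nat -> V, O = \bigcup_k box (a_ k) (b_ k).
Proof.
move=> oO; pose ab (k : nat) : 'rV[rat]_n * 'rV[rat]_n := odflt (0, 0) (unpickle k).
pose x k : V := map_mx ratr (ab k).1; pose y k : V := map_mx ratr (ab k).2.
pose i0 := Ordinal n_gt0.
have neg1 (z : V) : ~ box (0 : V) (const_mx (-1)) z.
  by move=> /(_ i0); rewrite !mxE => /andP[h1 h2]; have := le_trans h1 h2; lra.
(* A rational box not contained in [O] is replaced by the box from [0] to [-1], which is empty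
   because there is at least one coordinate. *)
exists (fun k => if `[< box (x k) (y k) `<=` O >] then x k else 0).
exists (fun k => if `[< box (x k) (y k) `<=` O >] then y k else const_mx (-1)).
apply/seteqP; split=> [z Oz|z [k _]]; last first.
  by case: asboolP => [kO /kO//|_ /neg1].
have /open_normP/(_ _ Oz)[d d0 dO] := oO.
have /choice[q qP] i : exists q : rat, z ord0 i - d < ratr q < z ord0 i.
  by have [q] := @rat_in_itvoo R (z ord0 i - d) (z ord0 i) ltac:(lra);
    rewrite in_itv /=; exists q.
have /choice[r rP] i : exists r : rat, z ord0 i < ratr r < z ord0 i + d.
  by have [r] := @rat_in_itvoo R (z ord0 i) (z ord0 i + d) ltac:(lra);
    rewrite in_itv /=; exists r.
exists (pickle (\row_i q i : 'rV[rat]_n, \row_i r i : 'rV[rat]_n)) => //=.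
rewrite /x /y /ab pickleK /= asboolT.
  move=> i; rewrite !mxE; have /andP[_ ?] := qP i; have /andP[? _] := rP i.
  by rewrite !ltW.
move=> w wP; apply: dO; apply: normrV_le; first exact: ltW.
move=> i; have := wP i; rewrite !mxE => /andP[? ?].
have /andP[? ?] := qP i; have /andP[? ?] := rP i.
by rewrite ler_norml; apply/andP; split; lra.
Qed.

Lemma caratheodory_bigcapI (T : Type) (mu : {outer_measure set T -> \bar R})
    (I : Type) (r : seq I) (F : I -> set T) :
  (forall i, mu.-caratheodory (F i)) ->
  mu.-caratheodory (\big[setI/setT]_(i <- r) F i).
Proof.
move=> mF; elim: r => [|i r IH].
  rewrite big_nil -setC0; apply: caratheodory_measurable_setC.
  exact: caratheodory_measurable_set0.
by rewrite big_cons; exact: caratheodory_measurable_setI.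
Qed.

(** Half-spaces [x_i <= c] are what is available, so a lower bound on [x_i] is written as the
    complement of a countable union of them. *)
Lemma box_caratheodory a b : (lebo n_gt0).-caratheodory (box a b).
Proof.
rewrite (_ : box a b = \big[setI/setT]_(i <- enum 'I_n)
    ([set x : V | x ord0 i <= b ord0 i] `&`
     ~` \bigcup_k [set x : V | x ord0 i <= a ord0 i - k.+1%:R^-1])).
  apply: caratheodory_bigcapI => i; apply: caratheodory_measurable_setI.
    exact: halfspace_caratheodory.
  apply: caratheodory_measurable_setC; apply: caratheodory_measurable_bigcup => k.
  exact: halfspace_caratheodory.
rewrite -bigcap_seq; apply/seteqP; split=> [x xab i _|x xab i].
  have /andP[h1 h2] := xab i; split=> //= -[k _ /=].
  by apply/negP; rewrite -ltNge; apply: lt_le_trans h1; rewrite ltrBlDr ltrDl invr_gt0.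
have [] := xab i; first by rewrite /= mem_enum.
move=> /= h2 h1; rewrite h2 andbT leNgt; apply/negP => xa.
have [N NP] := eventually_natr_gt (a ord0 i - x ord0 i)^-1.
apply: h1; exists N => //=; rewrite lerBrDl -lerBrDr; apply: ltW.
by rewrite invf_plt ?posrE ?subr_gt0//; apply: NP.
Qed.

Lemma borel_caratheodory B : borel B -> (lebo n_gt0).-caratheodory B.
Proof.
move=> mB; suff : <<s @open V >> `<=` (lebo n_gt0).-caratheodory by exact.
apply: smallest_sub.
  split.
  - exact: caratheodory_measurable_set0.
  - by move=> A mA; rewrite setTD; exact: caratheodory_measurable_setC.
  - by move=> F mF; exact: caratheodory_measurable_bigcup.
move=> O oO; have [a [b ->]] := open_bigcup_box oO.
by apply: caratheodory_measurable_bigcup => k; exact: box_caratheodory.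
Qed.

Definition leb (_ : (0 < n)%N) : set (Vb R n) -> \bar R := @leb_outer R n.

Lemma leb0 : leb n_gt0 set0 = 0%E. Proof. exact: leb_outer0. Qed.

Lemma leb_ge0 B : (0 <= leb n_gt0 B)%E. Proof. exact: leb_outer_ge0. Qed.

Lemma leb_sigma_additive : semi_sigma_additive (leb n_gt0).
Proof.
move=> F mF tF _.
apply: (@caratheodory_measure_sigma_additive _ _ (lebo n_gt0)) => //.
  by move=> k; exact: (borel_caratheodory (mF k)).
by apply: caratheodory_measurable_bigcup => k; exact: (borel_caratheodory (mF k)).
Qed.

Lemma leb_outer_translate A v : leb_outer [set x + v | x in A] = leb_outer A.
Proof.
have le B w : (leb_outer [set (x + w)%R | x in B] <= leb_outer B)%E.
  apply: leb_outer_geP => a b [ab Bab].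
  rewrite (@eq_eseriesr _ _ (fun k => (box_vol (a k + w)%R (b k + w)%R)%:E)); last first.
    move=> k _; congr (_%:E); apply: eq_bigr => i _; rewrite !mxE; ring.
  apply: leb_outer_le; split; first by move=> k i; rewrite !mxE lerD2r.
  move=> _ [x /Bab[k _ kx] <-]; exists k => // i.
  by rewrite !mxE !lerD2r; exact: kx.
apply/eqP; rewrite eq_le le /=.
have := le [set x + v | x in A] (- v); apply: le_trans.
apply: le_leb_outer => x Ax; exists (x + v); last by rewrite addrK.
by exists x.
Qed.

Lemma leb_outer_scale A (t : R) : 0 < t ->
  leb_outer [set t *: x | x in A] = ((t ^+ n)%:E * leb_outer A)%E.
Proof.
have le (s : R) B : 0 < s ->
    (leb_outer [set (s *: x)%R | x in B] <= (s ^+ n)%:E * leb_outer B)%E.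
  move=> s0; have sn0 : 0 < s ^+ n by rewrite exprn_gt0.
  rewrite -lee_pdivrMl//; apply: leb_outer_geP => a b [ab Bab].
  rewrite lee_pdivrMl// -nneseriesZl; last first.
    by move=> k _; rewrite lee_fin box_vol_ge0.
  rewrite (@eq_eseriesr _ _ (fun k => (box_vol (s *: a k)%R (s *: b k)%R)%:E)); last first.
    move=> k _; rewrite -EFinM; congr (_%:E); rewrite /box_vol.
    rewrite [RHS](eq_bigr (fun i => s * (b k ord0 i - a k ord0 i))).
      by rewrite big_split /= prodr_const card_ord.
    by move=> i _; rewrite !mxE mulrBr.
  apply: leb_outer_le; split; first by move=> k i; rewrite !mxE ler_pM2l.
  move=> _ [x /Bab[k _ kx] <-]; exists k => // i.
  by rewrite !mxE !ler_pM2l//; exact: kx.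
move=> t0; apply/eqP; rewrite eq_le le//=.
have tn0 : 0 < t ^+ n by rewrite exprn_gt0.
rewrite -lee_pdivlMl//.
have ti0 : 0 < t^-1 by rewrite invr_gt0.
have := le t^-1 [set t *: x | x in A] ti0; rewrite exprVn; apply: le_trans.
apply: le_leb_outer => x Ax; exists (t *: x); first by exists x.
by rewrite scalerA mulVf ?gt_eqF// scale1r.
Qed.

(** Source of the lower bounds that keep the volumes of the standard simplex and of the unit ball,
    by which densities are normalised, away from [0]. *)
Lemma leb_outer_unit_cube : (1 <= leb_outer (box (0%R : V) (const_mx 1%R)))%E.
Proof.
apply: leb_outer_geP => a b [ab cov].
pose c (z : V) (i : nat) : R := if insub i is Some j then z ord0 j else 0.
have cE z (i : 'I_n) : c z i = z ord0 i by rewrite /c valK.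
rewrite (@eq_eseriesr _ _ (fun k => (\prod_(i < n) (c (b k) i - c (a k) i))%:E)); last first.
  by move=> k _; congr (_%:E); apply: eq_bigr => i _; rewrite !cE.
apply: (@unit_cube_cover R n xpredT (fun k i => c (a k) i) (fun k i => c (b k) i)).
  by move=> k i; rewrite /c; case: insub.
move=> x x01; have [|k _ kx] := cov (\row_i x i).
  by move=> i; rewrite !mxE; exact: x01.
exists k => // i iN; have := kx (Ordinal iN).
by rewrite mxE -!cE.
Qed.

End LebesgueBorel.

HB.instance Definition _ (R : realType) (n : nat) (h : (0 < n)%N) :=
  isMeasure.Build _ (Vb R n) R (@leb R n h) (leb0 R h) (@leb_ge0 R n h)
    (@leb_sigma_additive R n h).

(** * The Monge-Ampere measure *)

Section Borel.
Variables (R : realType) (n : nat).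
Notation V := 'rV[R]_n.
Implicit Types (A B K U : set V).
Hypothesis n_gt0 : (0 < n)%N.

Lemma open_borel A : open A -> borel A.
Proof. by move=> oA; exact: sub_sigma_algebra. Qed.

Lemma closed_borel A : closed A -> borel A.
Proof.
by move=> cA; rewrite -[A]setCK; apply: measurableC; apply: open_borel; exact: closed_openC.
Qed.

Lemma compact_borel A : compact A -> borel A.
Proof. by move=> /compact_closed_rV; exact: closed_borel. Qed.

Lemma set1_borel (x : V) : borel [set x].
Proof. by apply: compact_borel; exact: compact_set1. Qed.

Lemma box_compact (a b : V) : compact (box a b).
Proof.
have := @rV_compact R n (fun i => `[a ord0 i, b ord0 i]%classic).
by apply=> i; exact: segment_compact.
Qed.

Lemma sigma_compact U : open U -> exists K_ : nat -> set V,
  (forall k, compact (K_ k)) /\ U = \bigcup_k K_ k.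
Proof.
move=> /(open_bigcup_box n_gt0)[a [b ->]]; exists (fun k => box (a k) (b k)).
by split=> // k; exact: box_compact.
Qed.

Lemma continuous_borel_fun U (f : V -> R) : open U ->
  (forall x, U x -> {for x, continuous f}) ->
  measurable_fun (U : set (Vb R n)) (f : Vb R n -> R).
Proof.
move=> oU fc; apply: (measurability _ (RGenOpens.measurableE R)).
move=> _ [_ [a [b ->] <-]]; apply: open_borel.
apply/open_normP => x [Ux fx].
have /open_normP/(_ _ Ux)[d d0 dU] := oU.
move: fx; rewrite /= in_itv /= => /andP[afx fxb].
pose e := Num.min (f x - a) (b - f x).
have e0 : 0 < e by rewrite lt_min !subr_gt0 afx.
have [d' d'0 d'P] := (continuous_normP x f).1 (fc x Ux) e e0.
exists (Num.min d (d' / 2)); first by rewrite lt_min d0 divr_gt0.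
move=> y; rewrite le_min => /andP[/dU Uy yd']; split=> //=.
have := d'P y; rewrite in_itv /= ltr_norml => H.
have {H} /andP[] : - e < f y - f x < e by apply: H; lra.
have : e <= f x - a by rewrite ge_min lexx.
have : e <= b - f x by rewrite ge_min lexx orbT.
by move=> ? ? ? ?; apply/andP; split; lra.
Qed.

Lemma leb_outer_compact K : compact K -> (leb_outer K < +oo)%E.
Proof.
move=> /compact_normP[_ [M KM]].
apply: (@le_lt_trans _ _ (leb_outer (box (const_mx (- `|M|) : V) (const_mx `|M|)))).
  apply: le_leb_outer => x /KM xM i; rewrite !mxE -ler_norml.
  by rewrite (le_trans (normrV_coord _ _))// (le_trans xM)// ler_norm.
apply: le_lt_trans (leb_outer_box n_gt0 _) (ltry _) => i.
by rewrite !mxE ge0_cp.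
Qed.

Lemma leb_outerU A B : (leb_outer (A `|` B) <= leb_outer A + leb_outer B)%E.
Proof. exact: (outer_measureU2 (lebo n_gt0)). Qed.

(* Pairwise disjoint translates inside a bounded set. *)
Lemma leb_outer_graph K (i : 'I_n) : compact K ->
  (forall (p : V) (t : R), 0 < t -> K p -> K (p + t *: delta_mx 0 i) -> False) ->
  leb_outer K = 0%E.
Proof.
move=> cK Kt; pose s (j : nat) : R := j.+1%:R^-1.
pose F j := [set p + s j *: delta_mx 0 i | p in K].
have s_inj j k : s j = s k -> j = k.
  by move=> /invr_inj /eqP; rewrite eqr_nat => /eqP [].
have cF j : compact (F j).
  rewrite (_ : F j = (fun xy : V * V => xy.1 + xy.2) @`
      (K `*` [set s j *: (delta_mx 0 i : V)])).
    apply: continuous_compact; last by apply: compact_setX => //; exact: compact_set1.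
    by apply: continuous_subspaceT => -[a b]; exact: add_continuous.
  apply/seteqP; split=> [_ [p Kp <-]|_ [[p q] [/= Kp ->] <-]].
    by exists (p, s j *: delta_mx 0 i).
  by exists p.
have tF : trivIset setT F.
  apply/trivIsetP => j k _ _ jk; apply/seteqP; split=> // x [[p Kp pE] [q Kq qE]].
  wlog sjk : j k p q jk Kp Kq pE qE / s j < s k.
    move=> W; have [|sjk|sjk] := ltgtP (s j) (s k).
    - exact: (W j k p q).
    - by apply: (W k j q p) => //; rewrite eq_sym.
    - by move: jk; rewrite (s_inj _ _ sjk) eqxx.
  apply: (Kt q (s k - s j)); rewrite ?subr_gt0//.
  rewrite (_ : q + _ = p)//; have : p + s j *: delta_mx 0 i = q + s k *: delta_mx 0 i.
    by rewrite pE qE.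
  by move=> /(canRL (addrK _)) ->; rewrite scalerBl addrA.
have KM : exists M : R, forall x, (\bigcup_j F j) x -> `|x| <= M.
  move: cK => /compact_normP[_ [M KM]]; exists (M + 1) => _ [j _ [p Kp <-]].
  apply: (le_trans (ler_normD _ _)); apply: lerD; first exact: KM.
  rewrite (le_trans (norm_basis_scale _ _))// ger0_norm ?invr_ge0//.
  by rewrite invf_le1 ?ltr0n// ler1n.
have fin : (leb n_gt0 (\bigcup_j F j) < +oo)%E.
  have [M MP] := KM.
  apply: le_lt_trans (@leb_outer_compact [set x | `|x - 0| <= M] (@closed_ball_compact _ _ _ _)).
  by apply: le_leb_outer => x /MP; rewrite /= subr0.
move: fin; rewrite measure_bigcup//; last by move=> j _; exact: compact_borel.
have lF j : leb n_gt0 (F j) = leb_outer K by rewrite /leb leb_outer_translate.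
rewrite (@eq_eseriesl _ _ xpredT); last by move=> j; rewrite in_setT.
rewrite (@eq_eseriesr _ _ (fun=> leb_outer K)); last by move=> j _; exact: lF.
have := leb_outer_ge0 K; rewrite le_eqVlt => /orP[/eqP//|K0].
set S := (\sum_(_ <= _ <oo) _)%E => Soo.
have S0 : (0 <= S)%E by apply: nneseries_ge0 => j _ _; exact: leb_outer_ge0.
have Koo := leb_outer_compact cK.
have SE : (fine S)%:E = S by rewrite fineK// ge0_fin_numE.
have KE : (fine (leb_outer K))%:E = leb_outer K by rewrite fineK// ge0_fin_numE// ltW.
have r0 : 0 < fine (leb_outer K) by rewrite -lte_fin KE.
have [N NP] := eventually_natr_gt (fine S / fine (leb_outer K)).
have := NP N (leqnn N); rewrite ltr_pdivrMr// ltNge => /negP; case.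
rewrite -lee_fin SE.
apply: le_trans (nneseries_lim_ge (P := xpredT) N _); last by move=> *; exact: leb_outer_ge0.
by rewrite -KE sumEFin lee_fin big_mkord sumr_const card_ord mulr_natl.
Qed.

End Borel.

(** * Monge-Ampere measures as images of Lebesgue measure on the space of slopes *)

Section MongeAmpere.
Variables (R : realType) (n : nat).
Notation V := 'rV[R]_n.
Hypothesis n_gt0 : (0 < n)%N.
Variable U : set V.
Hypothesis U_open : open U.
Hypothesis U_convex : Defs.convex_set U.
Implicit Types (f : V -> R) (x y p : V) (B K : set V).

(* Rational strips separating two points in one coordinate. *)
Lemma overlap_null f : convex_on U f -> exists N : set V,
  [/\ borel N, leb_outer N = 0%E & forall x y p, U x -> U y ->
    subdiff U f x p -> subdiff U f y p -> ~ N p -> x = y].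
Proof.
move=> cf; have [K_ [cK UK]] := sigma_compact n_gt0 U_open.
pose lo k i (q : rat) := K_ k `&` [set x | x ord0 i <= ratr q].
pose hi k i (q : rat) := K_ k `&` [set x | ratr q <= x ord0 i].
have clo k i q : compact (lo k i q).
  apply: compact_closedI => //; apply/closed_normP => x xP /=.
  rewrite leNgt; apply/negP => qx.
  have [y /= yq yx] := xP (x ord0 i - ratr q) ltac:(by rewrite subr_gt0).
  have := normrV_coord (y - x) i; rewrite !mxE distrC => h.
  by have := ler_norm (x ord0 i - y ord0 i); lra.
have chi k i q : compact (hi k i q).
  apply: compact_closedI => //; apply/closed_normP => x xP /=.
  rewrite leNgt; apply/negP => qx.
  have [y /= yq yx] := xP (ratr q - x ord0 i) ltac:(by rewrite subr_gt0).
  have := normrV_coord (y - x) i; rewrite !mxE => h.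
  by have := ler_norm (y ord0 i - x ord0 i); lra.
have KU k : K_ k `<=` U by rewrite UK => x Kx; exists k.
pose G (t : 'I_n * (rat * rat) * (nat * nat)) : set V :=
  let: (i, (q, r), (k, l)) := t in
  if q < r then subdiff_img U f (lo k i q) `&` subdiff_img U f (hi l i r) else set0.
have GP t : compact (G t) /\ leb_outer (G t) = 0%E.
  case: t => [[i [q r]] [k l]] /=; case: ifP => qr; last first.
    by split; [exact: compact0|exact: leb_outer0].
  have c1 : compact (subdiff_img U f (lo k i q)).
    by apply: subdiff_image_compact => // x [/KU].
  have c2 : compact (subdiff_img U f (hi l i r)).
    by apply: subdiff_image_compact => // x [/KU].
  have cI : compact (subdiff_img U f (lo k i q) `&` subdiff_img U f (hi l i r)).
    by apply: compact_closedI => //; exact: compact_closed_rV.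
  (* Let [p] be a slope at a point beyond [r] and [p + t e_i] a slope at a point before [q]: the
     slope has moved up along [e_i] and the point down, against monotonicity. *)
  split=> //; apply: (leb_outer_graph n_gt0 (i := i) cI) => p t t0.
  move=> [_ [y [Ky /= yr] py]] [[x [Kx /= xq] px] _].
  have := subdiff_monotone (KU _ _ Ky) (KU _ _ Kx) py px.
  rewrite addrC addKr dotpZl dotpC dotp_delta !mxE.
  rewrite pmulr_rge0// => h; have : ratr q < ratr r :> R by rewrite ltr_rat.
  lra.
pose F j := if unpickle j is Some t then G t else set0.
have FP j : compact (F j) /\ leb_outer (F j) = 0%E.
  by rewrite /F; case: unpickle => //; split; [exact: compact0|exact: leb_outer0].
exists (\bigcup_j F j); split.
- by apply: bigcup_measurable => j _; apply: compact_borel; exact: (FP j).1.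
- apply/eqP; rewrite eq_le leb_outer_ge0 andbT.
  apply: (le_trans (leb_outer_sigma_subadditive F)).
  by rewrite eseries0// => j _ _; exact: (FP j).2.
have sep x y p i : U x -> U y -> subdiff U f x p -> subdiff U f y p ->
    x ord0 i < y ord0 i -> (\bigcup_j F j) p.
  rewrite {1 2}UK => -[k _ Kx] [l _ Ky] px py xy.
  have [q] := rat_in_itvoo xy; rewrite in_itv /= => /andP[xq qy].
  have [r] := rat_in_itvoo qy; rewrite in_itv /= => /andP[qr ry].
  exists (pickle (i, (q, r), (k, l))) => //; rewrite /F pickleK /=.
  rewrite -(ltr_rat R) qr; split; [exists x|exists y] => //.
    by split=> //=; exact: ltW.
  by split=> //=; exact: ltW.
move=> x y p Ux Uy px py pN; apply/rowP => i.
have [xy|xy|//] := ltgtP (x ord0 i) (y ord0 i).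
  by exfalso; apply: pN; exact: (sep x y p i).
by exfalso; apply: pN; exact: (sep y x p i).
Qed.

(* [T] inverts the subdifferential off a null set. *)
Lemma legendre_map f : convex_on U f -> exists (E N : set V) (T : V -> V),
  [/\ borel E, borel N, leb_outer N = 0%E,
      measurable_fun (setT : set (Vb R n)) (T : Vb R n -> Vb R n) &
      (forall p, E p <-> ~ N p /\ subdiff_img U f U p) /\
      forall p, E p -> forall x, U x /\ subdiff U f x p <-> x = T p].
Proof.
move=> cf; have [N [bN N0 NP]] := overlap_null cf.
pose E := subdiff_img U f U `\` N.
pose T p := if `[< E p >] then xget 0 [set x | U x /\ subdiff U f x p] else 0.
have img O : open O -> O `<=` U -> borel (subdiff_img U f O).
  move=> oO OU; have [K_ [cK OK]] := sigma_compact n_gt0 oO.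
  rewrite (_ : subdiff_img U f O = \bigcup_k subdiff_img U f (K_ k)).
    apply: bigcup_measurable => k _; apply: compact_borel.
    by apply: subdiff_image_compact => // x Kx; apply: OU; rewrite OK; exists k.
  rewrite OK; apply/seteqP; split=> p.
    by move=> [x [k _ Kx] px]; exists k => //; exists x.
  by move=> [k _ [x Kx px]]; exists x => //; exists k.
have bE : borel E by apply: measurableD => //; exact: img.
have TP p : E p -> forall x, U x /\ subdiff U f x p <-> x = T p.
  move=> Ep; rewrite /T asboolT//; have [[x Ux px] pN] := Ep.
  have [Ut pt] : [set x | U x /\ subdiff U f x p] (xget 0 [set x | U x /\ subdiff U f x p]).
    by apply: xgetPex; exists x.
  by move=> y; split=> [[Uy py]|->//]; exact: NP pN.
exists E, N, T; split=> //; last first.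
  by split=> // p; split=> [[? ?]|[? ?]].
apply: (@measurability _ _ (Vb R n) (Vb R n) setT T (@open V)); first by [].
move=> _ [W oW <-]; rewrite setTI.
(* Outside [E] the map [T] is constantly [0], whence the second set. *)
rewrite (_ : _ @^-1` _ = (E `&` subdiff_img U f (W `&` U)) `|`
    (if `[< W 0 >] then ~` E else set0)); last first.
  apply/seteqP; split=> p /=.
    have [Ep|nEp] := pselect (E p).
      move=> Wp; left; split=> //; have [Ut pt] := (TP p Ep (T p)).2 erefl.
      by exists (T p).
    by rewrite /T asboolF// => W0; right; rewrite asboolT.
  move=> [[Ep [x [Wx Ux] px]]|]; first by rewrite -(TP p Ep x).1.
  by case: asboolP => // W0 nEp; rewrite /T asboolF.
apply: measurableU.
  apply: measurableI => //; apply: img; last by move=> x [].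
  exact: openI.
by case: asboolP => _; [exact: measurableC|exact: measurable0].
Qed.

(** Up to the null set [N], the slopes at points of [B] form the preimage of [B] under [T] inside
    [E]. The outer measure of [subdiff_img U f B] is therefore an image measure, which explains its
    sigma-additivity. *)
Lemma MA_exists_pushforward f (E N : set V) (T : V -> V)
    (bE : @measurable _ (Vb R n) E)
    (mT : measurable_fun (setT : set (Vb R n)) (T : Vb R n -> Vb R n)) :
  convex_on U f -> leb_outer N = 0%E ->
  (forall p, E p <-> ~ N p /\ subdiff_img U f U p) ->
  (forall p, E p -> forall x, U x /\ subdiff U f x p <-> x = T p) ->
  forall B, borel B -> B `<=` U ->
    pushforward (mrestr (leb n_gt0) bE) (T : Vb R n -> Vb R n) B =
    leb_outer (subdiff_img U f B).
Proof.
move=> cf N0 EP TP B bB BU; rewrite /pushforward /mrestr /leb.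
have EB : T @^-1` B `&` E `<=` subdiff_img U f B.
  move=> p [/= Bp Ep]; exists (T p) => //.
  by have [_] := (TP p Ep (T p)).2 erefl.
apply/eqP; rewrite eq_le le_leb_outer//=.
apply: (@le_trans _ _ (leb_outer ((T @^-1` B `&` E) `|` N))).
  apply: le_leb_outer => p [x Bx px].
  have [Np|nNp] := pselect (N p); [by right|left].
  have Ep : E p by apply/EP; split=> //; exists x => //; exact: BU.
  by split=> //=; rewrite -(TP p Ep x).1//; split=> //; exact: BU.
by apply: (le_trans (leb_outerU n_gt0 _ _)); rewrite N0 adde0.
Qed.

Lemma MA_exists f : convex_on U f -> exists m, is_MA U f m.
Proof.
move=> cf; have [E [N [T [bE bN N0 mT [EP TP]]]]] := legendre_map cf.
exists (measure_function_pushforward__canonical__measure_function_Measure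
  (mrestr (leb n_gt0) bE) mT) => B bB BU.
exact: MA_exists_pushforward EP TP _ bB BU.
Qed.

Definition legendre_data f (E N : set V) (T : V -> V) :=
  [/\ borel E, borel N, leb_outer N = 0%E,
      measurable_fun (setT : set (Vb R n)) (T : Vb R n -> Vb R n) &
      (forall p, E p <-> ~ N p /\ subdiff_img U f U p) /\
      forall p, E p -> forall x, U x /\ subdiff U f x p <-> x = T p].

Lemma continuous_borel_funT (phi : V -> R) : continuous phi ->
  measurable_fun (setT : set (Vb R n)) (phi : Vb R n -> R).
Proof.
move=> cphi; apply: (@continuous_borel_fun _ _ setT phi); first exact: (@openT V).
by move=> x _; exact: cphi.
Qed.

Lemma legendre_measurable f E N T (phi : V -> R) : legendre_data f E N T ->
  continuous phi ->
  measurable_fun (setT : set (Vb R n)) ((fun p => phi (T p) * \1_E p) : Vb R n -> R).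
Proof.
move=> [bE bN N0 mT _] cphi; apply: measurable_funM.
  by apply: measurableT_comp mT; exact: continuous_borel_funT.
exact: measurable_indic.
Qed.

(** The change of variables [x = T p]. Since [is_MA] determines [m] on Borel subsets of [U] only,
    the integral is restricted to [K] before [m] is exchanged for the image measure. *)
Lemma MA_integral f m E N T (phi : V -> R) K : convex_on U f -> is_MA U f m ->
  legendre_data f E N T -> compact K -> K `<=` U -> continuous phi ->
  (forall x, ~ K x -> phi x = 0) ->
  (\int[m]_x (phi x)%:E = \int[leb n_gt0]_p (phi (T p) * \1_E p)%:E)%E.
Proof.
move=> cf mMA [bE bN N0 mT [EP TP]] cK KU cphi phi0.
have bK : @measurable _ (Vb R n) K by exact: compact_borel.
have mphi : measurable_fun (setT : set (Vb R n)) (phi : Vb R n -> R).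
  exact: continuous_borel_funT.
pose nu := mrestr (leb n_gt0) bE.
pose mu' := measure_function_pushforward__canonical__measure_function_Measure
  (mrestr (leb n_gt0) bE) mT.
have mu'E B : borel B -> B `<=` U -> mu' B = leb_outer (subdiff_img U f B).
  by move=> bB BU; exact: MA_exists_pushforward EP TP _ bB BU.
have mTK : @measurable _ (Vb R n) (T @^-1` K).
  by have := mT measurableT K bK; rewrite setTI.
have [M MP] := compact_bounded_fun cK (fun x _ => cphi x).
have M0 x : `|phi x| <= `|M|.
  have [Kx|nKx] := pselect (K x); first exact: le_trans (MP _ Kx) (ler_norm _).
  by rewrite phi0// normr0.
have int : nu.-integrable (T @^-1` K) (EFin \o (phi \o T)).
  apply: measurable_bounded_integrable => //.
  - rewrite -[X in (X < _)%E]/(mu' K) mu'E//; apply: leb_outer_compact => //.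
    exact: subdiff_image_compact.
  - by apply: measurable_funTS; exact: (measurableT_comp mphi mT).
  - exists `|M|; split; first exact: num_real.
    by move=> x Mx p _ /=; apply: (le_trans (M0 _)); exact: ltW.
transitivity (\int[m]_(x in K) (phi x)%:E)%E.
  rewrite [RHS]integral_mkcond; apply: eq_integral => x _.
  by rewrite patchE; case: ifPn => //; rewrite notin_setE => /phi0 ->.
rewrite (eq_measure_integral mu'); last first.
  move=> A bA AK; rewrite mu'E//; last exact: subset_trans KU.
  by apply: mMA => //; exact: subset_trans KU.
rewrite (integral_pushforward mT (f := EFin \o phi))//; last first.
  exact/measurable_EFinP.
rewrite (@negligible_integral _ (Vb R n) _ _ _ (~` E))//; last 2 first.
- exact: measurableC.
- by rewrite /= /mrestr setICl measure0.
rewrite setDE setCK (eq_measure_integral (leb n_gt0)); last first.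
  by move=> A bA AE; rewrite /= /mrestr setIidl//; exact: subset_trans AE (@subIsetr _ _ _).
rewrite integral_mkcond; apply: eq_integral => p _; rewrite patchE indicE.
have [Ep|nEp] := pselect (E p); last first.
  rewrite ifN ?(memNset nEp) ?mulr0// notin_setE => -[_]; exact: nEp.
have -> : (p \in E) = true by exact: mem_set.
rewrite mulr1; have [Kp|nKp] := pselect (K (T p)).
  by rewrite mem_set.
by rewrite memNset ?phi0// => -[].
Qed.

Lemma subdiff_unif_bound (f_ : nat -> V -> R) f K :
  convex_on U f -> loc_unif_cvg U f_ f -> compact K -> K `<=` U ->
  exists (M : R) (N : nat), forall j x p, (N <= j)%N -> K x ->
    subdiff U (f_ j) x p -> `|p| <= M.
Proof.
move=> cf fcvg cK KU; have [d d0 [K' [cK' K'U K'P]]] := compact_thickening cK U_open KU.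
have [B BP] := convex_bounded_compact n_gt0 U_open U_convex cf cK' K'U.
have [N _ NP] := fcvg K' cK' K'U 1 ltr01.
exists (2 * (B + 1) / d), N => j x p Nj Kx; apply: subdiff_bound => // y yx.
have K'y := K'P _ _ Kx yx; split; first exact: K'U.
have := NP j Nj y K'y; have := BP y K'y.
have := ler_normD (f_ j y - f y) (f y); rewrite subrK; lra.
Qed.

(** For [p] in [E], the function [f - p] has a unique minimiser [T p], so minimisers of [f_ j - p]
    exist nearby and converge to it. For [p] outside [E] and [N], no point of [U] has slope [p]; by
    [subdiff_limit] the points [T_ j p] with [p] in [E_ j] eventually leave [K], where [phi]
    vanishes. *)
Lemma legendre_pointwise (f_ : nat -> V -> R) f E_ N_ T_ E N T (phi : V -> R) K p :
  (forall j, convex_on U (f_ j)) -> convex_on U f -> loc_unif_cvg U f_ f ->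
  (forall j, legendre_data (f_ j) (E_ j) (N_ j) (T_ j)) -> legendre_data f E N T ->
  compact K -> K `<=` U -> continuous phi -> (forall x, ~ K x -> phi x = 0) ->
  ~ N p -> (forall j, ~ N_ j p) ->
  (fun j => phi (T_ j p) * \1_(E_ j) p) @ \oo --> phi (T p) * \1_E p.
Proof.
move=> cf_ cf fcvg dE_ [_ _ _ _ [EP TP]] cK KU cphi phi0 nN nN_.
have [Ep|nEp] := pselect (E p).
  have [UT pT] := (TP p Ep (T p)).2 erefl.
  have uniq y : U y -> subdiff U f y p -> y = T p by move=> Uy py; apply/(TP p Ep).
  rewrite indicE mem_set// mulr1; apply/cvgrPdist_lt => e e0.
  have [d d0 dP] := (continuous_normP (T p) phi).1 (cphi _) e e0.
  have [J JP] := subdiff_persist n_gt0 U_open U_convex cf_ cf fcvg UT pT uniq d0.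
  exists J => // j /= Jj; have [x' [x'd Ux' px']] := JP j Jj.
  have [_ _ _ _ [EPj TPj]] := dE_ j.
  have Ej : E_ j p by apply/EPj; split=> //; exists x'.
  rewrite indicE mem_set// mulr1 -((TPj p Ej x').1 (conj Ux' px')) distrC.
  exact: dP.
rewrite indicE memNset// mulr0.
have [J JP] : exists J, forall j, (J <= j)%N -> phi (T_ j p) * \1_(E_ j) p = 0.
  apply: contrapT => H; apply: nEp; apply/EP; split=> //.
  have H1 (e : R) : 0 < e -> exists N0 : nat, forall j : nat, (N0 <= j)%N -> `|p - p| < e.
    by move=> e0; exists 0%N => j _; rewrite subrr normr0.
  have H2 J : exists j, (J <= j)%N /\ exists2 x, K x & subdiff U (f_ j) x p.
    apply: contrapT => HJ; apply: H; exists J => j Jj.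
    have [_ _ _ _ [EPj TPj]] := dE_ j.
    have [Ej|nEj] := pselect (E_ j p); last by rewrite indicE memNset// mulr0.
    rewrite indicE mem_set// mulr1; apply: phi0 => KT; apply: HJ; exists j.
    by split=> //; exists (T_ j p) => //; have [] := (TPj p Ej (T_ j p)).2 erefl.
  have [x Kx px] := subdiff_limit n_gt0 U_open U_convex cf fcvg cK KU H1 H2.
  by exists x => //; exact: KU.
apply/cvgrPdist_lt => e e0; exists J => // j /= Jj.
by rewrite JP// subrr normr0.
Qed.

(** Dominated convergence after the change of variables. The slopes occurring over [K] stay in a
    fixed ball [C], but only from the index [J] on, hence the shift of the sequences. *)
Lemma MA_weak_continuity (f_ : nat -> V -> R) f m_ m (phi : V -> R) :
  (forall j, convex_on U (f_ j)) -> convex_on U f -> loc_unif_cvg U f_ f ->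
  (forall j, is_MA U (f_ j) (m_ j)) -> is_MA U f m -> Cc U phi ->
  (fun j => Rintegral (m_ j) setT phi) @ \oo --> Rintegral m setT phi.
Proof.
move=> cf_ cf fcvg mf_ mf [cphi [cK KU]]; set K := closure _ in cK KU.
have phi0 x : ~ K x -> phi x = 0.
  move=> nKx; apply/eqP/negPn/negP => phix; apply: nKx.
  by apply: subset_closure => /=.
have [E [N [T dE]]] := legendre_map cf.
have /choice[D_ D_P] j : exists D : set V * set V * (V -> V),
    legendre_data (f_ j) D.1.1 D.1.2 D.2.
  by have [E' [N' [T' d']]] := legendre_map (cf_ j); exists (E', N', T').
pose E_ j := (D_ j).1.1; pose N_ j := (D_ j).1.2; pose T_ j := (D_ j).2.
have [M [J MP]] := subdiff_unif_bound cf fcvg cK KU.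
have [B BP] := compact_bounded_fun cK (fun x _ => cphi x).
pose h_ j p := phi (T_ j p) * \1_(E_ j) p; pose h p := phi (T p) * \1_E p.
pose C := [set p : V | `|p - 0| <= M].
have cC : compact C by exact: closed_ball_compact.
have bC : @measurable _ (Vb R n) C by exact: compact_borel.
pose g p := `|B| * \1_C p.
have h_g j p : (J <= j)%N -> `|h_ j p| <= g p.
  move=> Jj; rewrite /h_ /g; have [_ _ _ _ [EPj TPj]] := D_P j.
  have [Ej|nEj] := pselect (E_ j p); last first.
    by rewrite indicE (memNset nEj) mulr0 normr0 mulr_ge0.
  have [Utj pj] := (TPj p Ej (T_ j p)).2 erefl.
  rewrite [\1_(E_ j) _]indicE mem_set// mulr1.
  have [KT|nKT] := pselect (K (T_ j p)); last by rewrite phi0// normr0 mulr_ge0.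
  rewrite indicE mem_set ?mulr1; last by rewrite /C /= subr0; exact: MP Jj KT pj.
  exact: le_trans (BP _ KT) (ler_norm _).
have ig : (leb n_gt0).-integrable setT (EFin \o (g : Vb R n -> R)).
  rewrite (_ : EFin \o g = (fun p : Vb R n => (`|B|)%:E * (\1_C p)%:E)%E)//.
  apply: integrableZl => //; apply/integrableP; split.
    by apply/measurable_EFinP; exact: measurable_indic.
  rewrite (_ : (\int[_]_(_ in _) _)%E = leb n_gt0 C); first exact: leb_outer_compact.
  rewrite -[in RHS](setIT C) -integral_indic//; apply: eq_integral => p _ /=.
  by rewrite ger0_norm.
pose NN := N `|` \bigcup_j N_ j.
have NN0 : leb_outer NN = 0%E.
  apply/eqP; rewrite eq_le leb_outer_ge0 andbT.
  have [_ _ N0 _ _] := dE.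
  apply: (le_trans (leb_outerU n_gt0 _ _)); rewrite N0 add0e.
  apply: (le_trans (leb_outer_sigma_subadditive N_)).
  by rewrite eseries0// => j _ _; have [_ _ + _ _] := D_P j.
have bNN : @measurable _ (Vb R n) NN.
  have [_ bN _ _ _] := dE; apply: measurableU => //.
  by apply: bigcup_measurable => j _; have [_ + _ _ _] := D_P j.
have mh_ j : measurable_fun (setT : set (Vb R n)) (EFin \o h_ j : Vb R n -> \bar R).
  by apply/measurable_EFinP; exact: legendre_measurable (D_P _) cphi.
have mh : measurable_fun (setT : set (Vb R n)) (EFin \o h : Vb R n -> \bar R).
  by apply/measurable_EFinP; exact: legendre_measurable dE cphi.
have ae1 : {ae leb n_gt0, forall p, setT p ->
    (EFin \o h_ (j + J)%N) p @[j --> \oo] --> (EFin \o h) p}.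
  exists NN; split=> // p /= pP; apply: contrapT => npNN; apply: pP => _.
  apply: cvg_EFin; first exact: nearW.
  have : (fun j => h_ (j + J)%N p) @ \oo --> h p; last by [].
  apply: (cvg_trans _ (_ : h_ j p @[j --> \oo] --> h p)).
    by rewrite (cvg_shiftn J (fun j => h_ j p)).
  apply: (legendre_pointwise cf_ cf fcvg D_P dE cK KU cphi phi0).
    by move=> Np; apply: npNN; left.
  by move=> j Np; apply: npNN; right; exists j.
have ae2 : {ae leb n_gt0, forall p (j : nat), setT p ->
    (`|(EFin \o h_ (j + J)%N) p| <= (EFin \o g) p)%E}.
  by apply: aeW => p j _ /=; rewrite lee_fin; apply: h_g; rewrite leq_addl.
have [ih _ ihcvg] := @dominated_convergence _ (Vb R n) R (leb n_gt0) setT measurableT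
  (fun j => EFin \o h_ (j + J)%N) (EFin \o h) (EFin \o g)
  (fun j => mh_ (j + J)%N) mh ae1 ig ae2.
rewrite -(cvg_shiftn J (fun j => Rintegral (m_ j) setT phi)).
have E1 j : Rintegral (m_ j) setT phi = fine (\int[leb n_gt0]_p (EFin \o h_ j) p)%E.
  by rewrite /Rintegral (MA_integral (cf_ j) (mf_ j) (D_P j) cK KU cphi phi0).
have -> : Rintegral m setT phi = fine (\int[leb n_gt0]_p (EFin \o h) p)%E.
  by rewrite /Rintegral (MA_integral cf mf dE cK KU cphi phi0).
under eq_fun do rewrite E1.
apply: fine_cvg; rewrite fineK//; exact: integrable_fin_num.
Qed.

End MongeAmpere.

(** * Radon measures tested against continuous functions *)

Section RadonTest.
Variables (R : realType) (n : nat).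
Notation V := 'rV[R]_n.
Hypothesis n_gt0 : (0 < n)%N.
Variable U : set V.
Hypothesis U_open : open U.
Implicit Types (A B C K : set V) (mu : {measure set (Vb R n) -> \bar R}).

Definition loc_finite mu := forall K, compact K -> K `<=` U -> (mu K < +oo)%E.

Lemma borelI A B : borel A -> borel B -> borel (A `&` B).
Proof. exact: measurableI. Qed.

Lemma borelC A : borel A -> borel (~` A).
Proof. exact: measurableC. Qed.

Lemma borelD A B : borel A -> borel B -> borel (A `\` B).
Proof. exact: measurableD. Qed.

Lemma measure_sub_lty mu A K : (mu K < +oo)%E -> borel A -> borel K -> A `<=` K ->
  (mu A < +oo)%E.
Proof.
by move=> Koo bA bK AK; apply: le_lt_trans Koo; apply: le_measure; rewrite ?inE.
Qed.

Lemma continuous_integrable mu K (g : V -> R) : loc_finite mu -> compact K ->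
  K `<=` U -> (forall x, U x -> {for x, continuous g}) ->
  mu.-integrable (K : set (Vb R n)) (EFin \o (g : Vb R n -> R)).
Proof.
move=> lmu cK KU gc; have [M MP] := compact_bounded_fun cK (fun x Kx => gc x (KU x Kx)).
apply: measurable_bounded_integrable.
- exact: compact_borel.
- exact: lmu.
- apply: (@measurable_funS _ _ (Vb R n) _ (U : set (Vb R n))) => //.
    exact: open_borel.
  exact: continuous_borel_fun.
- exists M; split; first exact: num_real.
  by move=> x Mx p /MP pM; apply: (le_trans pM); exact: ltW.
Qed.

Lemma integrable_sub mu A K (g : V -> R) : borel A -> borel K -> A `<=` K ->
  mu.-integrable (K : set (Vb R n)) (EFin \o (g : Vb R n -> R)) ->
  mu.-integrable (A : set (Vb R n)) (EFin \o (g : Vb R n -> R)).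
Proof. by move=> bA bK AK; apply: integrableS. Qed.

Lemma Rintegral_bound mu A (g : V -> R) (c : R) : borel A -> (mu A < +oo)%E ->
  mu.-integrable (A : set (Vb R n)) (EFin \o (g : Vb R n -> R)) ->
  (forall x, A x -> `|g x| <= c) ->
  `|Rintegral mu (A : set (Vb R n)) g| <= c * fine (mu A).
Proof.
move=> bA Aoo ig gc; apply: (le_trans (le_normr_Rintegral _ ig)) => //.
rewrite -(Rintegral_cst mu (D := A))//; apply: le_Rintegral => //.
- by have := integrable_norm ig.
- by apply/integrableP; split; [exact: measurable_cst|]; rewrite integral_cst//= lte_mul_pinfty.
Qed.

Lemma measure_cvg0 mu (F : nat -> set V) : (mu (F 0%N) < +oo)%E ->
  (forall k, borel (F k)) -> (forall j k, (j <= k)%N -> F k `<=` F j) ->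
  \bigcap_k F k = set0 -> (fun k => fine (mu (F k))) @ \oo --> 0.
Proof.
move=> F0 bF dF cap0.
have := @nonincreasing_cvg_mu _ (Vb R n) R mu F F0 bF.
rewrite cap0 measure0 => /(_ measurable0) H.
apply: (@fine_cvg R _ _ _ (mu \o F) 0); apply: H.
by move=> j k jk; apply/subsetPset; exact: dF.
Qed.

(** Formulated for a real set function, because a difference of locally finite measures is
    meaningful only inside a compact set. Continuity at the empty set plays the part of
    sigma-additivity, and complements in [K] lead from compact to open sets. *)
Lemma dynkin_zero (Phi : set V -> R) K : compact K ->
  (forall A B, borel A -> borel B -> A `<=` K -> B `<=` K -> A `&` B = set0 ->
    Phi (A `|` B) = Phi A + Phi B) ->
  (forall F : nat -> set V, (forall k, borel (F k)) -> F 0%N `<=` K ->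
    (forall j k, (j <= k)%N -> F k `<=` F j) -> \bigcap_k F k = set0 ->
    (fun k => Phi (F k)) @ \oo --> 0) ->
  (forall C, compact C -> C `<=` K -> Phi C = 0) ->
  forall A, borel A -> A `<=` K -> Phi A = 0.
Proof.
move=> cK add cont comp A bA AK.
have bK := compact_borel cK; have clK := compact_closed_rV cK.
pose Q (S : set (Vb R n)) := Phi (S `&` K) = 0.
have QC S : borel S -> Q S -> Q (~` S).
  move=> bS QS; have : Phi K = 0 by exact: comp.
  have -> : K = (S `&` K) `|` (~` S `&` K) by rewrite -setIUl setUCr setTI.
  rewrite add ?QS ?add0r//.
  - exact: borelI.
  - by apply: borelI => //; exact: borelC.
  - by rewrite setIACA setICr set0I.
suff : Q A by rewrite /Q setIidl.
apply: (@dynkin_induction _ (Vb R n) (@open V) Q) => //.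
- by move=> S S' oS oS'; exact: openI.
- by rewrite /Q setTI; exact: comp.
- move=> S oS; rewrite -[S]setCK; apply: QC.
    by apply: closed_borel; exact: open_closedC.
  apply: comp; last by move=> x [].
  by rewrite setIC; apply: compact_closedI => //; exact: open_closedC.
- move=> F mF tF QF.
  pose G k := \bigcup_(j in `I_k) F j; pose H k := (\bigcup_j F j `\` G k) `&` K.
  have bU : borel (\bigcup_j F j) by apply: bigcup_measurable => j _; exact: mF.
  have bG k : borel (G k) by apply: bigcup_measurable => j _; exact: mF.
  have G0 k : Phi (G k `&` K) = 0.
    elim: k => [|k IH].
      have -> : G 0%N = set0 by apply/seteqP; split=> // x [].
      by rewrite set0I; apply: comp => //; exact: compact0.
    have -> : G k.+1 `&` K = (G k `&` K) `|` (F k `&` K).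
      rewrite -setIUl; congr (_ `&` _); apply/seteqP; split=> x.
        move=> [j /=]; rewrite ltnS leq_eqVlt => /orP[/eqP ->|jk] Fx; first by right.
        by left; exists j.
      move=> [[j /= jk] Fx|Fx]; last by exists k => /=.
      by exists j => //=; rewrite (leq_trans jk).
    rewrite add ?IH ?QF ?addr0//.
    - exact: borelI.
    - by apply: borelI => //; exact: mF.
    - apply/seteqP; split=> // x [[[j /= jk Fj] _] [Fk _]].
      have jk' : j != k by rewrite neq_ltn jk.
      have /trivIsetP/(_ j k I I jk') := tF.
      by move=> /seteqP[/(_ x)+ _]; apply.
  have HE k : Phi (\bigcup_j F j `&` K) = Phi (H k).
    have -> : \bigcup_j F j `&` K = (G k `&` K) `|` H k.
      rewrite /H -setIUl; congr (_ `&` _); rewrite setDUK//.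
      by move=> x [j _ Fx]; exists j.
    rewrite add ?G0 ?add0r//.
    - exact: borelI.
    - by apply: borelI => //; exact: borelD.
    - by move=> x [].
    - by apply/seteqP; split=> // x [[Gx _] [[_ nGx] _]].
  have := cont H; move=> /(_ _ _ _ _).
  have -> : (fun k => Phi (H k)) = (fun=> Phi (\bigcup_j F j `&` K)).
    by apply/funext => k; rewrite -HE.
  move=> cH; have {}cH : (fun=> Phi (\bigcup_j F j `&` K)) @ \oo --> (0 : R).
    apply: cH.
    - by move=> k; apply: borelI => //; exact: borelD.
    - by move=> x [].
    - move=> j k jk x [[Ux nGx] Kx]; split=> //; split=> // -[i /= ij Fx].
      by apply: nGx; exists i => //=; exact: leq_trans jk.
    - apply/seteqP; split=> // x Hx; have [[[j _ Fx] _] _] := Hx 0%N I.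
      have [[_ nG] _] := Hx j.+1 I; apply: nG; exists j => //=.
  by rewrite /Q; exact: (cvg_unique (@Rhausdorff R) (@cvg_cst _ _ _ _ _) cH).
Qed.

Lemma compact_distance C : compact C -> C !=set0 -> exists d : V -> R,
  [/\ forall x, 0 <= d x, forall x y, `|d x - d y| <= `|x - y|,
      forall x, d x = 0 <-> C x & forall x, exists2 y, C y & `|x - y| <= d x].
Proof.
move=> cC C0.
have /choice[y_ yP] x : exists y, C y /\ forall z, C z -> `|x - y| <= `|x - z|.
  have cx : {within C, continuous (fun y : V => `|x - y|)}.
    apply: continuous_in_subspaceT => y _; apply/continuous_normP => e e0.
    exists e => // z zy; apply: le_lt_trans zy; rewrite distrC.
    apply: (le_trans (ler_dist_dist _ _)).
    by rewrite opprB addrC addrA subrK.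
  have [y /[!inE] Cy ymin] := EVT_min_rV C0 cC cx.
  by exists y; split=> // z Cz; apply: ymin; rewrite inE.
pose d x := `|x - y_ x|.
have dle x z : d x <= `|x - z| + d z.
  by apply: (le_trans ((yP x).2 _ (yP z).1)); exact: ler_distD.
exists d; split.
- by move=> x; exact: normr_ge0.
- move=> x z; rewrite ler_norml lerBrDr lerBlDr.
  have := dle x z; have := dle z x; rewrite (distrC z x) => *.
  by apply/andP; split; lra.
- move=> x; split=> [/eqP|Cx].
    by rewrite normr_eq0 subr_eq0 => /eqP ->; exact: (yP x).1.
  apply/eqP; rewrite -normr_le0 normr_id.
  by have := (yP x).2 _ Cx; rewrite subrr normr0.
- by move=> x; exists (y_ x) => //; exact: (yP x).1.
Qed.

Lemma Cc_support (phi : V -> R) : Cc U phi -> exists K, [/\ compact K, K `<=` U &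
  forall x, ~ K x -> phi x = 0].
Proof.
move=> [_ [cK KU]]; exists (closure [set x | phi x != 0]); split=> // x nKx.
by apply/eqP/negPn/negP => phix; apply: nKx; apply: subset_closure.
Qed.

Lemma Cc_intro (phi : V -> R) K : continuous phi -> compact K -> K `<=` U ->
  (forall x, ~ K x -> phi x = 0) -> Cc U phi.
Proof.
move=> cphi cK KU phi0.
have sK : closure [set x | phi x != 0] `<=` K.
  rewrite closureE; apply: smallest_sub; first exact: compact_closed_rV.
  by move=> x /= phix; apply: contrapT => /phi0 phi0x; rewrite phi0x eqxx in phix.
split=> //; split; last exact: subset_trans KU.
by apply: subclosed_compact cK sK; exact: closed_closure.
Qed.

Lemma Rintegral_support mu (phi : V -> R) K : (forall x, ~ K x -> phi x = 0) ->
  Rintegral mu (setT : set (Vb R n)) phi = Rintegral mu (K : set (Vb R n)) phi.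
Proof.
move=> phi0; rewrite [RHS]Rintegral_mkcond; apply: eq_Rintegral => x _.
by rewrite patchE; case: ifPn => //; rewrite notin_setE => /phi0 ->.
Qed.

Lemma Rintegral_split mu A B K (g : V -> R) : loc_finite mu -> compact K -> K `<=` U ->
  (forall x, U x -> {for x, continuous g}) -> borel A -> borel B ->
  A `<=` K -> B `<=` K -> A `&` B = set0 ->
  Rintegral mu ((A `|` B) : set (Vb R n)) g =
  Rintegral mu (A : set (Vb R n)) g + Rintegral mu (B : set (Vb R n)) g.
Proof.
move=> lmu cK KU gc bA bB AK BK AB0; apply: Rintegral_setU => //; last first.
  by apply/disj_setPS; rewrite AB0.
apply: (@integrable_sub _ _ K); first exact: measurableU.
- exact: compact_borel.
- by move=> x [/AK|/BK].
- exact: continuous_integrable.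
Qed.

Lemma measure_split mu A B K : loc_finite mu -> compact K -> K `<=` U ->
  borel A -> borel B -> A `<=` K -> B `<=` K -> A `&` B = set0 ->
  fine (mu (A `|` B)) = fine (mu A) + fine (mu B).
Proof.
move=> lmu cK KU bA bB AK BK AB0; have bK := compact_borel cK.
rewrite measureU// fineD// ge0_fin_numE//.
  exact: (measure_sub_lty (lmu K cK KU)).
exact: (measure_sub_lty (lmu K cK KU)).
Qed.

Section RadonEq.
Variables (P M m : {measure set (Vb R n) -> \bar R}) (rho : V -> R).
Hypotheses (lP : loc_finite P) (lM : loc_finite M) (lm : loc_finite m).
Hypothesis rho_cont : forall x, U x -> {for x, continuous rho}.

Definition radon_gap (A : set V) : R :=
  fine (P A) - fine (M A) - Rintegral m (A : set (Vb R n)) rho.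

Lemma radon_gap_cvg0 K F : compact K -> K `<=` U -> (forall k, borel (F k)) ->
  F 0%N `<=` K -> (forall j k, (j <= k)%N -> F k `<=` F j) -> \bigcap_k F k = set0 ->
  (fun k => radon_gap (F k)) @ \oo --> 0.
Proof.
move=> cK KU bF F0 dF cap0; have bK := compact_borel cK.
have FK k : F k `<=` K by apply: subset_trans F0; exact: dF.
have c0 mu : loc_finite mu -> (fun k => fine (mu (F k))) @ \oo --> 0.
  move=> lmu; apply: measure_cvg0 => //.
  exact: (measure_sub_lty (lmu K cK KU)).
have [c cP] := compact_bounded_fun cK (fun x Kx => rho_cont (KU x Kx)).
have cI : (fun k => Rintegral m (F k : set (Vb R n)) rho) @ \oo --> 0.
  apply/norm_cvg0P; apply: (@squeeze_cvgr _ _ _ _ (fun=> 0) (fun k => c * fine (m (F k)))).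
  - near=> k; rewrite normr_ge0 /=; apply: Rintegral_bound => //.
    + exact: (measure_sub_lty (lm cK KU)).
    + by apply: (@integrable_sub _ _ K) => //; exact: continuous_integrable.
    + by move=> x /FK; exact: cP.
  - exact: cvg_cst.
  - by rewrite -(mulr0 c); apply: cvgMr; exact: c0.
rewrite /radon_gap (_ : 0 = 0 - 0 - 0 :> R); last by rewrite !subr0.
by apply: cvgB => //; apply: cvgB; exact: c0.
Unshelve. all: by end_near.
Qed.

Hypothesis test : forall phi, Cc U phi ->
  Rintegral P (setT : set (Vb R n)) phi - Rintegral M (setT : set (Vb R n)) phi =
  Rintegral m (setT : set (Vb R n)) (fun x => phi x * rho x).

(** The test functions [max(0, 1 - s_k d)], with [d] the distance to [C], are [1] on [C] and vanish
    outside the thickening [C_ k]. What they see besides [C] lives on [C_ k] minus [C], and these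
    sets decrease to the empty set. *)
Lemma radon_gap_compact C : compact C -> C `<=` U -> radon_gap C = 0.
Proof.
move=> cC CU; have [->|/set0P C0] := eqVneq C set0.
  by rewrite /radon_gap !measure0 Rintegral_set0 /= !subr0.
have [d [d0 dlip dC dnear]] := compact_distance cC C0.
have [e e0 eU] := compact_open_nbhs cC U_open CU.
have [N NP] := eventually_natr_gt e^-1.
(* The offset [N] puts already the first thickening inside [U]. *)
pose s k : R := (k + N).+1%:R.
have s0 k : 0 < s k by rewrite ltr0n.
pose C_ k := [set x | d x <= (s k)^-1].
have dcont x : {for x, continuous d}.
  apply/continuous_normP => a a0; exists a => // y ya.
  exact: le_lt_trans (dlip _ _) ya.
have C_U k : C_ k `<=` U.
  move=> x /= xk; have [y Cy xy] := dnear x; apply: (eU y) => //.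
  apply: (le_trans xy); apply: (le_trans xk); apply: ltW.
  rewrite invf_plt ?posrE//; apply: NP; rewrite /s -addnS.
  by rewrite (leq_trans (leqnSn N))// leq_addl.
have cC_ k : compact (C_ k).
  apply/compact_normP; split.
    apply/closed_normP => x xP; rewrite /C_ /= leNgt; apply/negP => xk.
    have [y yk yx] := xP (d x - (s k)^-1) ltac:(by rewrite subr_gt0).
    move: yk; rewrite /C_ /= => yk; have := dlip x y; rewrite (distrC x) ler_norml => /andP[_].
    move: (s k)^-1 yk yx => r yk yx; lra.
  have [_ [B BP]] := (compact_normP C).1 cC; exists (B + (s k)^-1) => x xk.
  have [y Cy xy] := dnear x; have := ler_normD (x - y) y; rewrite subrK.
  by have := BP _ Cy; move: xk; rewrite /C_ /=; move: (s k)^-1 => r; lra.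
have CC_ k : C `<=` C_ k by move=> x /dC; rewrite /C_ /= => ->; rewrite invr_ge0 ltW.
pose phi k x := Num.max 0 (1 - s k * d x).
have phi01 k x : 0 <= phi k x <= 1.
  rewrite /phi le_max lexx /= ge_max ler01 /= lerBlDr lerDl mulr_ge0// ltW//.
have phiC k x : C x -> phi k x = 1.
  by move=> /dC dx; rewrite /phi dx mulr0 subr0 max_r.
have phi0 k x : ~ C_ k x -> phi k x = 0.
  rewrite /C_ /= => /negP; rewrite -ltNge => xk; rewrite /phi max_l//.
  by rewrite subr_le0 -ler_pdivrMl// mulr1 ltW.
have phic k : continuous (phi k).
  move=> x; apply/continuous_normP => a a0; exists (a / s k); first by rewrite divr_gt0.
  move=> y; rewrite ltr_pdivlMr// => ya.
  apply: (@le_lt_trans _ _ (s k * `|d y - d x|)); last first.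
    apply: le_lt_trans ya; rewrite mulrC; apply: ler_wpM2r; first exact: ltW.
    exact: dlip.
  have -> : s k * `|d y - d x| = `|s k * d y - s k * d x|.
    by rewrite -mulrBr normrM gtr0_norm.
  rewrite /phi.
  move: (s k * d y) (s k * d x) => u v.
  case: (leP 0 (1 - u)) => ?; case: (leP 0 (1 - v)) => ?; rewrite ?subrr ?normr0//.
  - by rewrite (_ : 1 - u - (1 - v) = - (u - v)) ?normrN//; ring.
  - by rewrite subr0 ger0_norm// distrC; apply: le_trans (ler_norm _); lra.
  - by rewrite sub0r normrN ger0_norm//; apply: le_trans (ler_norm _); lra.
have Ccphi k : Cc U (phi k) by exact: Cc_intro (phic k) (cC_ k) (C_U k) (phi0 k).
pose R_ k := C_ k `\` C.
have bC := compact_borel cC; have bC_ k := compact_borel (cC_ k).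
have bR k : borel (R_ k) by exact: borelD.
have RC k : R_ k `<=` C_ k by move=> x [].
have C_dec j k : (j <= k)%N -> C_ k `<=` C_ j.
  move=> jk x /=; rewrite /C_ /= => /le_trans; apply.
  by rewrite lef_pV2 ?posrE// ler_nat ltnS leq_add2r.
have R0 : \bigcap_k R_ k = set0.
  apply/seteqP; split=> // x xR; have [_ nCx] := xR 0%N I; apply: nCx; apply/dC.
  apply/eqP; rewrite eq_le d0 andbT leNgt; apply/negP => dx.
  have [J JP] := eventually_natr_gt (d x)^-1.
  have [] := xR J I; rewrite /C_ /= => /le_lt_trans => /(_ (d x)).
  rewrite ltxx => H _; suff : false by []; apply: H.
  by rewrite invf_plt ?posrE//; apply: JP; rewrite /s -addnS leq_addr.
have est mu (g : V -> R) : loc_finite mu -> (forall x, U x -> {for x, continuous g}) ->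
    (fun k => Rintegral mu (setT : set (Vb R n)) (fun x => phi k x * g x)) @ \oo -->
    Rintegral mu (C : set (Vb R n)) g.
  move=> lmu gc; have [c cP] := compact_bounded_fun (cC_ 0%N) (fun x Cx => gc x (C_U _ x Cx)).
  have pgc k x : U x -> {for x, continuous (fun x => phi k x * g x)}.
    by move=> Ux; apply: continuousM; [exact: phic|exact: gc].
  have E k : Rintegral mu (setT : set (Vb R n)) (fun x => phi k x * g x) =
      Rintegral mu (C : set (Vb R n)) g +
      Rintegral mu (R_ k : set (Vb R n)) (fun x => phi k x * g x).
    rewrite (@Rintegral_support _ _ (C_ k)); last by move=> x /phi0 ->; rewrite mul0r.
    have -> : C_ k = C `|` R_ k by rewrite setDUK.
    rewrite (@Rintegral_split _ _ _ (C_ k))//; last 2 first.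
    - exact: pgc.
    - by apply/seteqP; split=> // x [Cx [_ nCx]].
    congr (_ + _); apply: eq_Rintegral => x /[!inE] Cx.
    by rewrite phiC// mul1r.
  rewrite (funext E) -[X in _ --> X]addr0; apply: cvgD; first exact: cvg_cst.
  apply/norm_cvg0P; apply: (@squeeze_cvgr _ _ _ _ (fun=> 0) (fun k => c * fine (mu (R_ k)))).
  - near=> k; rewrite normr_ge0 /=; apply: Rintegral_bound => //.
    + exact: (measure_sub_lty (lmu _ (cC_ k) (C_U k))).
    + apply: (@integrable_sub _ _ (C_ k)) => //; apply: continuous_integrable => //.
      exact: pgc.
    + move=> x [/(C_dec _ _ (leq0n k))/cP gx _]; rewrite normrM.
      have /andP[p0 p1] := phi01 k x; rewrite ger0_norm//.
      by rewrite -[leRHS]mul1r; apply: ler_pM.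
  - exact: cvg_cst.
  - rewrite -(mulr0 c); apply: cvgMr; apply: measure_cvg0 => //.
      exact: (measure_sub_lty (lmu _ (cC_ 0%N) (C_U 0%N))).
    by move=> j k jk x [/(C_dec _ _ jk) ? ?]; split.
have oneC mu : Rintegral mu (C : set (Vb R n)) (fun=> 1) = fine (mu C).
  by rewrite Rintegral_cst// mul1r.
have limP mu : loc_finite mu ->
    (fun k => Rintegral mu (setT : set (Vb R n)) (phi k)) @ \oo --> fine (mu C).
  move=> lmu; rewrite -oneC.
  have -> : (fun k => Rintegral mu (setT : set (Vb R n)) (phi k)) =
    (fun k => Rintegral mu (setT : set (Vb R n)) (fun x => phi k x * 1)).
    by apply/funext => k; apply: eq_Rintegral => x _; rewrite mulr1.
  by apply: (est mu (fun=> 1) lmu) => x _; exact: cst_continuous.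
have L1 := cvgB (limP P lP) (limP M lM).
have L2 := est m rho lm rho_cont.
have L3 : (fun k => Rintegral P (setT : set (Vb R n)) (phi k) -
    Rintegral M (setT : set (Vb R n)) (phi k)) @ \oo --> Rintegral m (C : set (Vb R n)) rho.
  by rewrite (funext (fun k => test (Ccphi k))).
rewrite /radon_gap (cvg_unique (@Rhausdorff R) (L1 _) L3); first exact: subrr.
Unshelve. all: by end_near.
Qed.

Lemma radon_eq B : borel B -> rel_compact U B ->
  fine (P B) - fine (M B) = Rintegral m (B : set (Vb R n)) rho.
Proof.
move=> bB [cB BU]; apply/eqP; rewrite -subr_eq0; apply/eqP.
apply: (@dynkin_zero radon_gap (closure B)) => //.
- move=> A A' bA bA' AB A'B AA'; rewrite /radon_gap.
  rewrite !(measure_split (K := closure B))//.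
  by rewrite (Rintegral_split (K := closure B))//; ring.
- by move=> F bF F0 dF cap0; exact: (radon_gap_cvg0 cB BU).
- by move=> C cC CB; apply: radon_gap_compact => //; exact: subset_trans BU.
- exact: subset_closure.
Qed.

End RadonEq.

End RadonTest.

(** * The volume of the convex hull of a finite set *)

Section MaxShift.
Variables (R : realType) (T : eqType).
Implicit Types (g : T -> R) (J : seq T).

Lemma lmaxZ g J (t : R) : 0 <= t -> lmax (fun a => t * g a) J = t * lmax g J.
Proof.
move=> t0; have [->|J0] := eqVneq J [::]; first by rewrite !lmax_nil mulr0.
have [a aJ aE] := lmax_in g J0; apply: (lmax_eq aJ); first by rewrite aE.
by move=> b bJ; apply: ler_wpM2l => //; exact: lmax_ge.
Qed.

Lemma lmaxD g J (k : R) : J != [::] -> lmax (fun a => g a + k) J = lmax g J + k.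
Proof.
move=> J0; have [a aJ aE] := lmax_in g J0; apply: (lmax_eq aJ); first by rewrite aE.
by move=> b bJ; rewrite lerD2r; exact: lmax_ge.
Qed.

Lemma lmax_close g g' J (e : R) : 0 <= e -> (forall a, a \in J -> `|g a - g' a| <= e) ->
  `|lmax g J - lmax g' J| <= e.
Proof.
move=> e0 gg'; have [->|J0] := eqVneq J [::]; first by rewrite !lmax_nil subrr normr0.
have [a aJ aE] := lmax_in g J0; have [b bJ bE] := lmax_in g' J0.
have := gg' a aJ; have := gg' b bJ; have := lmax_ge g' aJ; have := lmax_ge g bJ.
rewrite aE bE !ler_norml => h1 h2 /andP[h3 h4] /andP[h5 h6].
by apply/andP; split; lra.
Qed.

End MaxShift.

(** * Convex hulls described by support functions *)

Section Body.
Variables (R : realType) (n : nat).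
Notation V := 'rV[R]_n.
Implicit Types (J g : seq V) (p x y z v w : V).

(** The convex hull of [J] in its dual description by half-spaces; for empty [J] it is the origin
    alone, as the maximum is then [0]. *)
Definition body J : set V := [set p | forall z, dotp p z <= hmax J z].

Definition bodyvol J : R := fine (leb_outer (body J)).

Lemma hmax0 J : hmax J 0 = 0.
Proof.
have [->|J0] := eqVneq J [::]; first by rewrite lmax_nil.
by have [a _ ->] := lmax_in (fun w => dotp w 0) J0; rewrite dotp0r.
Qed.

Lemma hmaxZ J z (t : R) : 0 <= t -> hmax J (t *: z) = t * hmax J z.
Proof. by move=> t0; rewrite -lmaxZ//; apply: eq_lmax => w _; rewrite dotpZr. Qed.

Lemma hmax_scale J z (t : R) : 0 <= t -> hmax [seq t *: w | w <- J] z = t * hmax J z.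
Proof. by move=> t0; rewrite lmax_map -lmaxZ//; apply: eq_lmax => w _ /=; rewrite dotpZl. Qed.

Lemma hmax_translate J z v : J != [::] ->
  hmax [seq w + v | w <- J] z = hmax J z + dotp v z.
Proof. by move=> J0; rewrite lmax_map -lmaxD//; apply: eq_lmax => w _ /=; rewrite dotpDl. Qed.

Lemma hmax_lip J : exists2 c : R, 0 < c & forall z z', `|hmax J z - hmax J z'| <= c * `|z - z'|.
Proof.
pose c := \sum_(w <- J) n%:R * `|w|.
have c0 : 0 <= c by apply: sumr_ge0 => w _; rewrite mulr_ge0.
exists (c + 1); first by rewrite ltr_wpDl.
move=> z z'; apply: lmax_close; first by rewrite mulr_ge0// addr_ge0.
move=> w wJ; rewrite -dotpBr; apply: (le_trans (dotp_norm _ _)); apply: ler_wpM2r => //.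
rewrite /c (perm_big _ (perm_to_rem wJ)) big_cons /= -addrA lerDl addr_ge0//.
by apply: sumr_ge0 => u _; rewrite mulr_ge0.
Qed.

Lemma hmax_convex (U : set V) J x : convex_on U (fun y => hmax J (y - x)).
Proof.
apply: (@lmax_convex _ _ _ _ (fun y w => dotp w (y - x))) => w _ y z t _ _ _.
by rewrite !(dotpBr, dotpDr, dotpZr) -subr_ge0 le_eqVlt; apply/orP; left; apply/eqP; ring.
Qed.

Lemma bodyP J p : J != [::] -> body J p <-> forall z, exists2 w, w \in J & dotp p z <= dotp w z.
Proof.
move=> J0; split=> [pJ z|pJ z]; last first.
  by have [w wJ pw] := pJ z; apply: (le_trans pw); exact: (lmax_ge (fun w => dotp w z)).
by have [w wJ wE] := lmax_in (fun w => dotp w z) J0; exists w => //; rewrite -wE; exact: pJ.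
Qed.

Lemma subdiff_hmax (U : set V) J x : open U -> U x ->
  subdiff U (fun y => hmax J (y - x)) x = body J.
Proof.
move=> Uo Ux; apply/seteqP; split=> [p pJ z|p pJ y _]; last first.
  by rewrite subrr hmax0 add0r; exact: pJ.
have [d d0 dU] := (open_normP U).1 Uo x Ux.
pose t := d / (`|z| + 1); have z1 : 0 < `|z| + 1 by rewrite ltr_wpDl.
have t0 : 0 < t by rewrite divr_gt0.
have : U (x + t *: z).
  apply: dU; rewrite [_ - x]addrC addKr normrZ gtr0_norm// /t mulrAC ler_pdivrMr//.
  by rewrite ler_wpM2l ?lerDl ?ltW.
by move=> /pJ; rewrite [_ + _ - x]addrC addKr subrr hmax0 add0r hmaxZ ?(ltW t0)// dotpZr ler_pM2l.
Qed.

Lemma body_translate J v : J != [::] -> body [seq w + v | w <- J] = [set p + v | p in body J].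
Proof.
move=> J0; apply/seteqP; split=> [p pJ|_ [p pJ <-] z]; last first.
  by rewrite hmax_translate// dotpDl lerD2r; exact: pJ.
exists (p - v); last by rewrite subrK.
by move=> z; have := pJ z; rewrite hmax_translate// dotpBl lerBlDr.
Qed.

Lemma body_scale J (t : R) : 0 < t -> body [seq t *: w | w <- J] = [set t *: p | p in body J].
Proof.
move=> t0; apply/seteqP; split=> [p pJ|_ [p pJ <-] z]; last first.
  by rewrite hmax_scale ?(ltW t0)// dotpZl ler_pM2l//; exact: pJ.
exists (t^-1 *: p); last by rewrite scalerA mulfV ?gt_eqF// scale1r.
move=> z; rewrite dotpZl mulrC ler_pdivrMr// mulrC.
by have := pJ z; rewrite hmax_scale ?(ltW t0).
Qed.

Lemma body_cut_sub a b c g (t : R) : 0 <= t <= 1 -> c = (1 - t) *: a + t *: b ->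
  body (a :: c :: g) `<=` body (a :: b :: g) /\ body (c :: b :: g) `<=` body (a :: b :: g).
Proof.
move=> t01 cE.
have cab z : dotp c z <= dotp a z \/ dotp c z <= dotp b z.
  rewrite cE dotpDl !dotpZl; move: t01 => /andP[t0 t1].
  by case: (leP (dotp a z) (dotp b z)) => ab; [right|left]; nra.
split=> p /bodyP pJ; apply/bodyP => // z; have [w] := pJ isT z.
  rewrite !inE => /or3P[/eqP->|/eqP->|wg] pw.
  - by exists a; rewrite ?mem_head.
  - by case: (cab z) => h; [exists a|exists b]; rewrite ?inE ?eqxx ?orbT//;
      exact: le_trans h.
  - by exists w; rewrite ?inE ?wg ?orbT.
rewrite !inE => /or3P[/eqP->|/eqP->|wg] pw.
- by case: (cab z) => h; [exists a|exists b]; rewrite ?inE ?eqxx ?orbT//;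
    exact: le_trans h.
- by exists b; rewrite ?inE ?eqxx ?orbT.
- by exists w; rewrite ?inE ?wg ?orbT.
Qed.

(** The critical directions are those in which the witnesses above [p] are [a] for one piece and [b]
    for the other; there [c] lies above [p] too. *)
Lemma body_cutI a b c g (t : R) : 0 <= t <= 1 -> c = (1 - t) *: a + t *: b ->
  body (a :: c :: g) `&` body (c :: b :: g) = body (c :: g).
Proof.
move=> /andP[t0 t1] cE; apply/seteqP; split=> [p [/bodyP p1 /bodyP p2]|p /bodyP pJ].
  apply/bodyP => // z; have [w1] := p1 isT z; have [w2] := p2 isT z.
  rewrite !inE => /or3P[/eqP->|/eqP->|w2g] pw2.
  - by exists c; rewrite ?mem_head.
  - move=> /or3P[/eqP->|/eqP->|w1g] pw1.
    + by exists c; rewrite ?mem_head// cE dotpDl !dotpZl; nra.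
    + by exists c; rewrite ?mem_head.
    + by exists w1; rewrite ?inE ?w1g ?orbT.
  - by exists w2; rewrite ?inE ?w2g ?orbT.
split; apply/bodyP => // z; have [w] := pJ isT z; rewrite inE => wJ pw; exists w => //.
  by rewrite !inE wJ orbT.
by rewrite !inE; move: wJ => /orP[->|->]; rewrite ?orbT.
Qed.

(* If [p] is separated from both pieces, then it is separated from the whole by the
   combination of the two directions on which [a] and [b] agree. *)
Lemma body_cutU a b c g (t : R) : 0 <= t <= 1 -> c = (1 - t) *: a + t *: b ->
  body (a :: c :: g) `|` body (c :: b :: g) = body (a :: b :: g).
Proof.
move=> t01 cE; have [s1 s2] := body_cut_sub g t01 cE.
apply/seteqP; split=> [p [/s1|/s2]//|p /bodyP pJ0]; have {pJ0}pJ := pJ0 isT.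
have [p1|/bodyP p1] := pselect (body (a :: c :: g) p); first by left.
have [p2|/bodyP p2] := pselect (body (c :: b :: g) p); first by right.
have /existsNP[z zP] : ~ forall z, exists2 w, w \in a :: c :: g & dotp p z <= dotp w z.
  by move=> h; apply: p1 => //; apply: h.
have /existsNP[z' zP'] : ~ forall z, exists2 w, w \in c :: b :: g & dotp p z <= dotp w z.
  by move=> h; apply: p2 => //; apply: h.
have lz w : w \in a :: c :: g -> dotp w z < dotp p z.
  by move=> wJ; rewrite ltNge; apply/negP => pw; apply: zP; exists w.
have lz' w : w \in c :: b :: g -> dotp w z' < dotp p z'.
  by move=> wJ; rewrite ltNge; apply/negP => pw; apply: zP'; exists w.
have az := lz a (mem_head _ _); have cz := lz c ltac:(by rewrite !inE eqxx orbT).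
have bz' := lz' b ltac:(by rewrite !inE eqxx orbT); have cz' := lz' c (mem_head _ _).
have bz : dotp p z <= dotp b z.
  have [w] := pJ z; rewrite !inE => /or3P[/eqP->|/eqP->//|wg] pw.
    by move: az; rewrite ltNge pw.
  by have := lz w ltac:(by rewrite !inE wg !orbT); rewrite ltNge pw.
have az' : dotp p z' <= dotp a z'.
  have [w] := pJ z'; rewrite !inE => /or3P[/eqP->//|/eqP->|wg] pw.
    by move: bz'; rewrite ltNge pw.
  by have := lz' w ltac:(by rewrite !inE wg !orbT); rewrite ltNge pw.
exfalso; pose al := dotp a z' - dotp b z'; pose be := dotp b z - dotp a z.
have al0 : 0 < al by rewrite subr_gt0; exact: lt_le_trans az'.
have be0 : 0 < be by rewrite subr_gt0; exact: lt_le_trans bz.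
have sep w : dotp w z < dotp p z -> dotp w z' < dotp p z' ->
    dotp w (al *: z + be *: z') < dotp p (al *: z + be *: z').
  by move=> h h'; rewrite !dotpDr !dotpZr ltrD// ltr_pM2l.
have abE : dotp a (al *: z + be *: z') = dotp b (al *: z + be *: z').
  by rewrite !dotpDr !dotpZr /al /be; ring.
have acE : dotp c (al *: z + be *: z') = dotp a (al *: z + be *: z').
  by rewrite cE dotpDl !dotpZl -abE; ring.
have cl := sep c cz cz'.
have [w] := pJ (al *: z + be *: z'); move=> wJ; rewrite leNgt => /negP; apply.
move: wJ; rewrite !inE => /or3P[/eqP->|/eqP->|wg]; first by rewrite -acE.
  by rewrite -abE -acE.
by apply: sep; [apply: lz|apply: lz']; rewrite !inE wg !orbT.
Qed.

Hypothesis n_gt0 : (0 < n)%N.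

Lemma body_compact J : compact (body J).
Proof.
have -> : body J = subdiff_img setT (fun y => hmax J (y - 0)) [set 0].
  by rewrite /subdiff_img bigcup_set1 subdiff_hmax//; exact: openT.
apply: subdiff_image_compact => //; [exact: openT|exact: hmax_convex|exact: compact_set1].
Qed.

Lemma leb_loc_finite (U : set V) : loc_finite U (leb n_gt0).
Proof. by move=> K cK _; exact: leb_outer_compact. Qed.

Lemma leb_outer_set1 x : leb_outer [set x] = 0%E.
Proof.
apply/eqP; rewrite eq_le leb_outer_ge0 andbT.
have -> : [set x] = box x x.
  apply/seteqP; split=> [_ ->|y yx] /=; first by move=> i; rewrite !lexx.
  by apply/rowP => i; apply/le_anti; rewrite andbC; exact: yx.
by have := @leb_outer_box _ _ n_gt0 x x (fun=> lexx _); rewrite box_vol_xx.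
Qed.

Lemma bodyvol_ext J J' : (forall z, hmax J z = hmax J' z) -> bodyvol J = bodyvol J'.
Proof.
move=> JJ'; rewrite /bodyvol (_ : body J = body J')//.
by apply/seteqP; split=> p pJ z; [rewrite -JJ'|rewrite JJ']; exact: pJ.
Qed.

Lemma bodyvol_translate J v : bodyvol [seq w + v | w <- J] = bodyvol J.
Proof.
have [->//|J0] := eqVneq J [::].
by rewrite /bodyvol body_translate// leb_outer_translate.
Qed.

Lemma bodyvol_homog J (t : R) : 0 <= t -> bodyvol [seq t *: w | w <- J] = t ^+ n * bodyvol J.
Proof.
rewrite le_eqVlt => /orP[/eqP<-|t0].
  rewrite expr0n gtn_eqF// mul0r /bodyvol (_ : body _ = [set 0]) ?leb_outer_set1//.
  apply/seteqP; split=> [p pJ|_ -> z]; last by rewrite hmax_scale// mul0r dotp0l.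
  apply/rowP => i; rewrite mxE; apply/le_anti.
  have := pJ (delta_mx 0 i); have := pJ (- delta_mx 0 i).
  by rewrite !hmax_scale// !mul0r dotpNr dotp_delta oppr_le0 => -> ->.
by rewrite /bodyvol body_scale// leb_outer_scale// fineM// ge0_fin_numE ?leb_outer_ge0//
  leb_outer_compact//; exact: body_compact.
Qed.

Lemma bodyvol_cut a b g (t : R) : 0 <= t <= 1 ->
  let c := (1 - t) *: a + t *: b in
  bodyvol (a :: b :: g) + bodyvol (c :: g) = bodyvol (a :: c :: g) + bodyvol (c :: b :: g).
Proof.
move=> t01 c; rewrite /bodyvol -(body_cutU g t01 erefl) -(body_cutI g t01 erefl) -/c.
set A := body (a :: c :: g); set B := body (c :: b :: g).
have cA : compact A by exact: body_compact.
have cB : compact B by exact: body_compact.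
have bA := compact_borel cA; have bB := compact_borel cB.
have bBA : borel (B `\` A) by exact: borelD.
have bAB : borel (A `&` B) by exact: borelI.
pose K := body (a :: b :: g); have cK : compact K by exact: body_compact.
have [AK BK] : A `<=` K /\ B `<=` K by apply: body_cut_sub t01 _.
have splitE X Y : borel X -> borel Y -> X `<=` K -> Y `<=` K -> X `&` Y = set0 ->
    fine (leb_outer (X `|` Y)) = fine (leb_outer X) + fine (leb_outer Y).
  exact: (measure_split (leb_loc_finite (U := setT)) cK).
have -> : A `|` B = A `|` (B `\` A) by rewrite setUDr setDv setD0.
rewrite splitE//; last 2 first.
- by move=> p [/BK].
- by apply/seteqP; split=> // p [? []].
have {3}-> : B = (B `\` A) `|` (A `&` B) by rewrite setIC setUC setUIDK.
rewrite [in RHS]splitE//; last 3 first.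
- by move=> p [/BK].
- by move=> p [/AK].
- by apply/seteqP; split=> // p [[? ?] []].
by rewrite addrA.
Qed.

Definition std_simplex : seq V := spath 0 (rows 1%:M).

Lemma cube_vol (s : R) : 0 < s -> ((s ^+ n)%:E <= leb_outer (box (0 : V) (const_mx s)))%E.
Proof.
move=> s0; have -> : box (0 : V) (const_mx s) = [set s *: x | x in box (0 : V) (const_mx 1)].
  apply/seteqP; split=> [x xs|_ [x x1 <-] i].
    exists (s^-1 *: x); last by rewrite scalerA mulfV ?gt_eqF// scale1r.
    move=> i; have := xs i; rewrite !mxE => /andP[x0 xi].
    by rewrite mulr_ge0 ?invr_ge0 ?(ltW s0)//= mulrC ler_pdivrMr// mul1r.
  by have := x1 i; rewrite !mxE => /andP[x0 xi]; rewrite mulr_ge0 ?(ltW s0)//= ler_piMr// ltW.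
rewrite leb_outer_scale// -[leLHS]mule1; apply: lee_wpmul2l.
  by rewrite lee_fin exprn_ge0// ltW.
exact: leb_outer_unit_cube.
Qed.

Lemma cube_norm (s : R) x : 0 <= s -> box 0 (const_mx s) x -> `|x| <= s.
Proof.
move=> s0 xs; apply: normrV_le => // i; have := xs i; rewrite !mxE => /andP[x0 xi].
by rewrite ger0_norm.
Qed.

(** No simplex volume is computed: if the standard simplex were null, [Z_eq0] applied to [bodyvol]
    itself would make the cross-polytope null, yet that contains a cube of side [1 / n]. *)
Lemma bodyvol_std_neq0 : bodyvol std_simplex != 0.
Proof.
apply/eqP => std0.
pose J : seq V := [seq delta_mx 0 i | i <- enum 'I_n] ++ [seq - delta_mx 0 i | i <- enum 'I_n].
have := Z_eq0 n_gt0 bodyvol_ext bodyvol_translate bodyvol_homog bodyvol_cut J std0.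
have s0 : 0 < n%:R^-1 :> R by rewrite invr_gt0 ltr0n.
have sub : box 0 (const_mx n%:R^-1) `<=` body J.
  move=> p pc z; apply: (le_trans (ler_norm _)); apply: (le_trans (dotp_norm _ _)).
  apply: (@le_trans _ _ `|z|).
    rewrite -[leRHS]mul1r; apply: ler_wpM2r => //.
    by rewrite -ler_pdivlMl ?ltr0n// mulr1; apply: cube_norm pc; exact: ltW.
  have zi i : `|z ord0 i| <= hmax J z.
    rewrite ler_norml lerNl -[z ord0 i]dotp_delta (dotpC z) -dotpNl.
    by apply/andP; split; apply: (lmax_ge (fun w => dotp w z)); rewrite mem_cat;
      apply/orP; [right|left]; apply/mapP; exists i; rewrite ?mem_enum.
  by apply: normrV_le => //; apply: le_trans (zi (Ordinal n_gt0)).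
move=> J0; have := le_leb_outer sub; rewrite leNgt => /negP; apply.
apply: lt_le_trans (cube_vol s0).
rewrite -(@fineK _ (leb_outer (body J))); last first.
  by rewrite ge0_fin_numE ?leb_outer_ge0// leb_outer_compact//; exact: body_compact.
by rewrite -/(bodyvol J) J0 lte_fin exprn_gt0.
Qed.

(** The body lies in a hyperplane orthogonal to [v], so it meets each line parallel to an axis [i]
    with [v_i != 0] at most once. *)
Lemma body_flat J v (k : R) : v != 0 -> (forall w, w \in J -> dotp w v = k) ->
  leb_outer (body J) = 0%E.
Proof.
move=> v0 Jk.
have pv p : body J p -> dotp p v = hmax J v.
  have [->|J0] := eqVneq J [::].
    move=> pJ; apply/le_anti; rewrite pJ lmax_nil /= -oppr_le0 -dotpNr.
    by have := pJ (- v); rewrite lmax_nil.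
  move=> /bodyP pJ0; have {pJ0}pJ := pJ0 J0.
  have -> : hmax J v = k.
    by have [w wJ ->] := lmax_in (fun w => dotp w v) J0; exact: Jk.
  have [w wJ] := pJ v; rewrite (Jk w wJ) => le1.
  have [w' wJ'] := pJ (- v); rewrite !dotpNr lerN2 (Jk w' wJ') => le2.
  by apply/le_anti; rewrite le1.
have /existsP[i vi] : [exists i, v ord0 i != 0].
  apply: contra_neqT v0 => /existsPn v0; apply/rowP => i; rewrite mxE.
  by apply/eqP; have := v0 i; rewrite negbK.
apply: (@leb_outer_graph _ _ n_gt0 _ i); first exact: body_compact.
move=> p t t0 /pv p1 /pv; rewrite dotpDl dotpZl p1 [dotp (delta_mx _ _) _]dotpC dotp_delta.
by move=> /eqP; rewrite -subr_eq0 addrAC subrr add0r mulf_eq0 gt_eqF//= (negPf vi).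
Qed.

End Body.

(** * The Euclidean norm *)

Section Euclid.
Variables (R : realType) (n : nat).
Notation V := 'rV[R]_n.
Implicit Types (x y z p : V).

Lemma dotpxx_ge0 x : 0 <= dotp x x.
Proof. by apply: sumr_ge0 => i _; rewrite -expr2 sqr_ge0. Qed.

Lemma enorm_ge0 x : 0 <= enorm x.
Proof. exact: sqrtr_ge0. Qed.

Lemma sqr_enorm x : enorm x ^+ 2 = dotp x x.
Proof. by rewrite sqr_sqrtr// dotpxx_ge0. Qed.

Lemma enorm_eq0 x : enorm x = 0 -> x = 0.
Proof.
move=> x0; have := sqr_enorm x; rewrite x0 expr0n /= => /esym/eqP.
rewrite psumr_eq0 => [/allP xx|i _]; last by rewrite -expr2 sqr_ge0.
apply/rowP => i; rewrite mxE; have := xx i (mem_index_enum _).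
by rewrite implyTb mulf_eq0 orbb => /eqP.
Qed.

Lemma cauchy_schwarz x y : dotp x y <= enorm x * enorm y.
Proof.
have q0 := dotpxx_ge0 (enorm y *: x - enorm x *: y).
have := enorm_ge0 x; have := enorm_ge0 y; move: q0.
rewrite !(dotpBl, dotpBr, dotpZl, dotpZr) -!sqr_enorm (dotpC y x).
set a := enorm x; set b := enorm y; set c := dotp x y => q0 b0 a0.
have [a0'|an0] := eqVneq a 0; first by rewrite a0' mul0r /c (enorm_eq0 a0') dotp0l.
have [b0'|bn0] := eqVneq b 0; first by rewrite b0' mulr0 /c (enorm_eq0 b0') dotp0r.
have ab : 0 < a * b by rewrite mulr_gt0// lt_def ?an0 ?bn0.
by rewrite -(ler_pM2l ab); nra.
Qed.

Lemma enormZ (t : R) x : 0 <= t -> enorm (t *: x) = t * enorm x.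
Proof.
move=> t0; rewrite /enorm dotpZl dotpZr mulrA -expr2 sqrtrM ?sqr_ge0//.
by rewrite sqrtr_sqr ger0_norm.
Qed.

Lemma enormD x y : enorm (x + y) <= enorm x + enorm y.
Proof.
rewrite -(@ler_pXn2r _ 2)// ?nnegrE ?addr_ge0 ?enorm_ge0//.
rewrite sqr_enorm !(dotpDl, dotpDr) sqrrD !sqr_enorm (dotpC y x).
by have := cauchy_schwarz x y; lra.
Qed.

Lemma enorm_convex (U : set V) x : convex_on U (fun y => enorm (y - x)).
Proof.
move=> y z t _ _ /andP[t0 t1].
have -> : (1 - t) *: y + t *: z - x = (1 - t) *: (y - x) + t *: (z - x).
  by apply/rowP => j; rewrite !mxE; ring.
by apply: (le_trans (enormD _ _)); rewrite !enormZ// subr_ge0.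
Qed.

Lemma subdiff_enorm (U : set V) x : open U -> U x ->
  subdiff U (fun y => enorm (y - x)) x = [set p | enorm p <= 1].
Proof.
move=> Uo Ux.
have e0 : enorm (0 : V) = 0 by rewrite /enorm dotp0l sqrtr0.
apply/seteqP; split=> [p pJ|p /= p1 y _] /=; last first.
  rewrite subrr e0 add0r; apply: (le_trans (cauchy_schwarz _ _)).
  by rewrite ler_piMl// enorm_ge0.
have [d d0 dU] := (open_normP U).1 Uo x Ux.
pose t := d / (`|p| + 1); have z1 : 0 < `|p| + 1 by rewrite ltr_wpDl.
have t0 : 0 < t by rewrite divr_gt0.
have : U (x + t *: p).
  apply: dU; rewrite [_ - x]addrC addKr normrZ gtr0_norm// /t mulrAC ler_pdivrMr//.
  by rewrite ler_wpM2l ?lerDl ?ltW.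
move=> /pJ; rewrite [_ + _ - x]addrC addKr subrr e0 add0r enormZ ?(ltW t0)// dotpZr ler_pM2l//.
by rewrite -sqr_enorm; have := enorm_ge0 p; nra.
Qed.

Lemma omega_neq0 : (0 < n)%N -> omega R n != 0.
Proof.
move=> n_gt0; have s0 : 0 < n%:R^-1 :> R by rewrite invr_gt0 ltr0n.
have c1 : compact [set x : V | enorm x <= 1].
  rewrite -(@subdiff_enorm setT 0) => //; last exact: openT.
  rewrite -[X in compact X](bigcup_set1 (subdiff setT (fun y : V => enorm (y - 0)))).
  apply: (subdiff_image_compact n_gt0 (U := setT)) => //; first exact: openT.
  - exact: enorm_convex.
  - exact: compact_set1.
have sub : box 0 (const_mx n%:R^-1) `<=` [set x : V | enorm x <= 1].
  move=> x xc /=; have xn : `|x| <= n%:R^-1 by apply: cube_norm xc; exact: ltW.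
  rewrite -(@ler_pXn2r _ 2)// ?nnegrE ?enorm_ge0// sqr_enorm expr1n.
  apply: (le_trans (ler_norm _)); apply: (le_trans (dotp_norm _ _)).
  have n1 : (n%:R^-1 : R) <= 1 by rewrite invf_le1 ?ltr0n// ler1n.
  have nx : n%:R * `|x| <= 1 by rewrite -ler_pdivlMl ?ltr0n// mulr1.
  by rewrite -[leRHS]mul1r; apply: ler_pM => //; exact: le_trans n1.
rewrite gt_eqF// -lte_fin fineK; last first.
  by rewrite ge0_fin_numE ?leb_outer_ge0// leb_outer_compact.
apply: lt_le_trans (le_leb_outer sub); apply: (lt_le_trans _ (cube_vol n s0)).
by rewrite lte_fin exprn_gt0.
Qed.

End Euclid.

(** * Polyhedral functions *)

Section Strata.
Variables (R : realType) (n : nat).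
Notation V := 'rV[R]_n.
Hypothesis n_gt0 : (0 < n)%N.
Implicit Types (x y z v : V) (L : seq (V * R)) (A K : set V) (f : V -> R).

Lemma rel_compact_sub (U : set V) A K : compact K -> K `<=` U -> A `<=` K -> rel_compact U A.
Proof.
move=> cK KU AK; have clA : closure A `<=` K.
  by rewrite [X in _ `<=` X](closure_id K).1; [exact: closureS|exact: compact_closed_rV].
split; last exact: subset_trans KU.
exact: (subclosed_compact (@closed_closure _ A) cK clA).
Qed.

Lemma convex_setT : Defs.convex_set (setT : set V).
Proof. by []. Qed.

Lemma convexT_continuous f : convex_on setT f -> continuous f.
Proof. by move=> cf x; apply: (convex_continuous n_gt0 openT convex_setT cf). Qed.

Lemma open_lt_fun (f g : V -> R) : continuous f -> continuous g -> open [set x | f x < g x].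
Proof.
move=> cf cg; apply/open_normP => x /= fg; pose e := (g x - f x) / 2.
have e0 : 0 < e by rewrite divr_gt0// subr_gt0.
have [d1 d10 d1P] := (continuous_normP x f).1 (cf x) e e0.
have [d2 d20 d2P] := (continuous_normP x g).1 (cg x) e e0.
exists (Num.min d1 d2 / 2); first by rewrite divr_gt0// lt_min d10.
move=> y yd; have {}yd : `|y - x| < Num.min d1 d2.
  apply: (le_lt_trans yd); rewrite ltr_pdivrMr// ltr_pMr ?ltr1n//.
  by rewrite lt_min d10.
move: yd; rewrite lt_min => /andP[/d1P + /d2P].
by rewrite !ltr_norml /e => /andP[? ?] /andP[? ?]; lra.
Qed.

Lemma forall_closed (Q : set V -> Prop) (I : eqType) (s : seq I) (F : I -> set V) :
  Q setT -> (forall A B, Q A -> Q B -> Q (A `&` B)) -> (forall i, Q (F i)) ->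
  Q [set x | forall i, i \in s -> F i x].
Proof.
move=> QT QI QF; elim: s => [|i s IH].
  by rewrite (_ : mkset _ = setT)//; apply/seteqP; split.
rewrite (_ : mkset _ = F i `&` [set x | forall i, i \in s -> F i x]); first exact: QI.
apply/seteqP; split=> [x xF|x [Fi xF] j].
  by split; [exact/xF/mem_head|move=> j js; apply: xF; rewrite inE js orbT].
by rewrite inE => /orP[/eqP->|/xF].
Qed.

Lemma finite_strata (T : finType) (c : V -> T) (Phi : set V -> R) K :
  borel K -> Phi set0 = 0 ->
  (forall A B, borel A -> borel B -> A `<=` K -> B `<=` K -> A `&` B = set0 ->
    Phi (A `|` B) = Phi A + Phi B) ->
  (forall s, borel [set x | c x = s]) ->
  (forall s, Phi (K `&` [set x | c x = s]) = 0) -> Phi K = 0.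
Proof.
move=> bK Phi0 add bc Phic.
suff H (r : seq T) : uniq r ->
    borel (K `&` [set x | c x \in r]) /\ Phi (K `&` [set x | c x \in r]) = 0.
  have [_] := H (enum T) (enum_uniq T).
  by rewrite (_ : mkset _ = setT) ?setIT//; apply/seteqP; split=> // x _ /=; rewrite mem_enum.
elim: r => [_|s r IH /= /andP[sr /IH[br r0]]].
  have -> : K `&` [set x | c x \in [::]] = set0 by apply/seteqP; split=> // x [].
  by split=> //; exact: measurable0.
have -> : K `&` [set x | c x \in s :: r] =
    (K `&` [set x | c x = s]) `|` (K `&` [set x | c x \in r]).
  rewrite -setIUr; congr (_ `&` _); apply/seteqP; split=> x /=; rewrite inE.
    by move=> /orP[/eqP|]; [left|right].
  by move=> [->|->]; rewrite ?eqxx ?orbT.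
have bs : borel (K `&` [set x | c x = s]) by exact: borelI.
split; first exact: measurableU.
rewrite add ?Phic ?r0 ?addr0//.
by apply/seteqP; split=> // x /= [[_ xs] [_]]; rewrite xs (negPf sr).
Qed.

Definition active L x := [seq a <- L | dotp a.1 x + a.2 == pmax L x].

(** The set of active pieces, encoded in a finite type so that there are finitely many strata. *)
Definition active_class L x : (size L).-tuple bool :=
  map_tuple (fun a : V * R => dotp a.1 x + a.2 == pmax L x) (in_tuple L).

Definition slopes L x := [seq a.1 | a <- active L x].

Definition flat (J : seq V) := exists v (k : R), v != 0 /\ forall w, w \in J -> dotp w v = k.

Lemma active_classP L x y : active_class L x = active_class L y -> active L x = active L y.
Proof.
by move=> /(congr1 val) /= cE; rewrite /active !filter_mask cE.
Qed.

Lemma mem_active L x a : a \in active L x = (dotp a.1 x + a.2 == pmax L x) && (a \in L).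
Proof. exact: mem_filter. Qed.

Lemma pmax_ge L x a : a \in L -> dotp a.1 x + a.2 <= pmax L x.
Proof. exact: (lmax_ge (fun a => dotp a.1 x + a.2)). Qed.

Lemma pmax_continuous L : continuous (pmax L).
Proof. by apply: convexT_continuous; exact: pmax_convex. Qed.

Lemma affine_continuous v (c : R) : continuous (fun x => dotp v x + c).
Proof. by apply: convexT_continuous; exact: affine_convex. Qed.

Lemma borel_active_class L s : borel [set x | active_class L x = s].
Proof.
pose F (i : 'I_(size L)) := [set x | dotp (tnth (in_tuple L) i).1 x + (tnth (in_tuple L) i).2
   < pmax L x].
have bF i : borel (F i).
  apply: open_borel; apply: open_lt_fun; [exact: affine_continuous|exact: pmax_continuous].
pose G i := if tnth s i then ~` F i else F i.
have -> : [set x | active_class L x = s] = [set x | forall i, i \in enum 'I_(size L) -> G i x].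
  have FE i x : (dotp (tnth (in_tuple L) i).1 x + (tnth (in_tuple L) i).2 == pmax L x) = false <->
      F i x.
    rewrite /F /= lt_neqAle pmax_ge ?mem_tnth// andbT.
    by split=> [->|/negPf].
  apply/seteqP; split=> [x /= xs i _|x xG].
    rewrite /G -xs tnth_map; case: ifPn => [h|/negPf/FE//]; rewrite /setC /= => /FE.
    by rewrite h.
  apply: eq_from_tnth => i; rewrite tnth_map; have := xG i (mem_enum _ _).
  rewrite /G; case: (tnth s i); last by move=> /FE.
  by move=> h; apply/negPn/negP => /negPf/FE.
apply: (forall_closed (Q := @borel R n)); [exact: measurableT|exact: borelI|move=> i].
rewrite /G; case: ifP => _; last exact: bF.
by apply: borelC; exact: bF.
Qed.

Lemma active_neq_nil L x : L != [::] -> active L x != [::].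
Proof.
move=> L0; have [a aL aE] := lmax_in (fun a : V * R => dotp a.1 x + a.2) L0.
have : a \in active L x by rewrite mem_active aL andbT /pmax aE.
by case: (active L x).
Qed.

Lemma hmax_slopes L x z : hmax (slopes L x) z = lmax (fun a => dotp a.1 z) (active L x).
Proof. exact: lmax_map. Qed.

Lemma pmax_slopes_le L x y : L != [::] -> hmax (slopes L x) (y - x) + pmax L x <= pmax L y.
Proof.
move=> L0; rewrite hmax_slopes.
have [a] := lmax_in (fun a : V * R => dotp a.1 (y - x)) (active_neq_nil x L0).
rewrite mem_active => /andP[/eqP<- aL] ->; apply: le_trans (pmax_ge y aL).
by rewrite dotpBr addrA subrK.
Qed.

Lemma pmax_slopes L x y : L != [::] -> active L y = active L x ->
  pmax L y = hmax (slopes L x) (y - x) + pmax L x.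
Proof.
move=> L0 yx; rewrite hmax_slopes.
have [a aA ->] := lmax_in (fun a : V * R => dotp a.1 (y - x)) (active_neq_nil x L0).
have := aA; rewrite mem_active => /andP[/eqP<- _].
have := aA; rewrite -yx mem_active => /andP[/eqP<- _].
by rewrite dotpBr addrA subrK.
Qed.

(** An open set on which [pmax L] is the cone over the slopes at [x], up to a constant. It contains
    the whole stratum of [x], so local determination applies to a stratum at once. *)
Definition cell L x := [set y | forall a, a \in [seq a <- L | a \notin active L x] ->
  dotp a.1 y + a.2 < hmax (slopes L x) (y - x) + pmax L x].

Lemma cell_open L x : open (cell L x).
Proof.
apply: (forall_closed (Q := @open V)); [exact: openT|exact: openI|move=> a].
apply: open_lt_fun; first exact: affine_continuous.
apply: convexT_continuous => y z t Uy Uz t01.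
have := @hmax_convex _ _ setT (slopes L x) x y z t Uy Uz t01; lra.
Qed.

Lemma active_cell L x y : L != [::] -> active L y = active L x -> cell L x y.
Proof.
move=> L0 yx a; rewrite mem_filter -yx mem_active => /andP[+ aL].
by rewrite aL andbT -pmax_slopes// lt_neqAle pmax_ge// andbT.
Qed.

Lemma pmax_cell L x y : L != [::] -> cell L x y ->
  pmax L y = hmax (slopes L x) (y - x) + pmax L x.
Proof.
move=> L0 xy; apply/le_anti/andP; split; last exact: pmax_slopes_le.
apply: lmax_le => // a aL; have [aA|aA] := boolP (a \in active L x); last first.
  by apply/ltW/xy; rewrite mem_filter aA.
have := aA; rewrite mem_active => /andP[/eqP<- _].
rewrite hmax_slopes; have := lmax_ge (fun a : V * R => dotp a.1 (y - x)) aA.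
by rewrite dotpBr; lra.
Qed.

(** Between two points of one stratum every active affine piece has the same increment, which places
    the slopes in a hyperplane unless the points coincide. *)
Lemma flat_slopes L x y : L != [::] -> active L y = active L x -> ~ flat (slopes L x) -> y = x.
Proof.
move=> L0 yx nflat; apply/eqP; apply: contra_notT nflat => yx'.
exists (y - x), (pmax L y - pmax L x); split; first by rewrite subr_eq0.
move=> _ /mapP[a aA ->]; rewrite dotpBr.
have := aA; rewrite mem_active => /andP[/eqP<- _].
have := aA; rewrite -yx mem_active => /andP[/eqP<- _].
by ring.
Qed.

Lemma subdiff_pmax (U : set V) L x : open U -> Defs.convex_set U -> L != [::] -> U x ->
  subdiff U (pmax L) x = body (slopes L x).
Proof.
move=> Uo Uc L0 Ux; rewrite -(subdiff_hmax _ Uo Ux).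
have xx : cell L x x by exact: active_cell.
have [d d0 dC] := (open_normP (cell L x)).1 (@cell_open L x) x xx.
apply/seteqP; split=> p pJ.
  apply: (subdiff_local Uc _ Ux d0); first exact: hmax_convex.
  move=> y Uy yx; have := pJ y Uy; rewrite (pmax_cell L0 (dC y (ltW yx))).
  by rewrite subrr hmax0; lra.
move=> y Uy; have := pJ y Uy; have := pmax_slopes_le x y L0.
by rewrite subrr hmax0; lra.
Qed.

Definition cone_list (J : seq V) x : seq (V * R) := [seq (w, - dotp w x) | w <- J].

Lemma pmax_cone_list J x y : pmax (cone_list J x) y = hmax J (y - x).
Proof.
by rewrite /pmax lmax_map; apply: eq_lmax => w _ /=; rewrite dotpBr.
Qed.

Lemma cone_flat J x y : y != x -> flat (slopes (cone_list J x) y).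
Proof.
move=> yx; exists (y - x), (pmax (cone_list J x) y); split; first by rewrite subr_eq0.
move=> _ /mapP[a aA ->]; move: aA; rewrite mem_active => /andP[/eqP<- /mapP[w _ ->]] /=.
by rewrite dotpBr.
Qed.

End Strata.

(** * Point masses and compactly supported test functions *)

Section MALocal.
Variables (R : realType) (n : nat).
Notation V := 'rV[R]_n.
Hypothesis n_gt0 : (0 < n)%N.
Variable U : set V.
Hypothesis U_open : open U.
Hypothesis U_convex : Defs.convex_set U.
Implicit Types (f g : V -> R) (m : {measure set (Vb R n) -> \bar R}).

Lemma MA_loc_finite f m : convex_on U f -> is_MA U f m -> loc_finite U m.
Proof.
move=> cf mf K cK KU; rewrite mf//; last exact: compact_borel.
by apply: leb_outer_compact => //; exact: subdiff_image_compact.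
Qed.

Lemma MA_set1 f m x : is_MA U f m -> U x -> m [set x] = leb_outer (subdiff U f x).
Proof.
move=> mf Ux; rewrite mf ?/subdiff_img ?bigcup_set1//; first exact: set1_borel.
by move=> _ ->.
Qed.

Lemma Rintegral_set1 m g x :
  Rintegral m ([set x] : set (Vb R n)) g = g x * fine (m [set x]).
Proof.
rewrite -(Rintegral_cst m (set1_borel x)); apply: eq_Rintegral => y.
by rewrite inE => ->.
Qed.

(** [rho] is continuous on [U] only; away from [U] the product is locally zero, because the support
    of [phi] is closed. *)
Lemma Cc_mul (phi rho : V -> R) : Cc U phi -> (forall x, U x -> {for x, continuous rho}) ->
  Cc U (fun x => phi x * rho x).
Proof.
move=> phiC rhoc; have [K [cK KU phi0]] := Cc_support phiC.
apply: (Cc_intro _ cK KU); last by move=> x /phi0 ->; rewrite mul0r.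
move=> x; have [Ux|nUx] := pselect (U x).
  by apply: continuousM; [exact: phiC.1|exact: rhoc].
have /open_normP/(_ x) : open (~` K) by apply: closed_openC; exact: compact_closed_rV.
move=> /(_ (fun Kx => nUx (KU x Kx)))[d d0 dK].
apply/continuous_normP => e e0; exists d => // y yd.
by rewrite phi0 ?phi0 ?mul0r ?subrr ?normr0//; [exact: (fun Kx => nUx (KU x Kx))|exact/dK/ltW].
Qed.

Lemma Cc_bump x : U x -> exists phi : V -> R, [/\ Cc U phi, phi x = 1 & forall y, 0 <= phi y].
Proof.
move=> Ux; have [d d0 dU] := (open_normP U).1 U_open x Ux.
exists (fun y => Num.max 0 (1 - `|y - x| / d)); split; last 2 first.
- by rewrite subrr normr0 mul0r subr0 max_r.
- by move=> y; rewrite le_max lexx.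
apply: (Cc_intro _ (@closed_ball_compact _ _ x d) dU); last first.
  move=> y /= /negP; rewrite -ltNge => yd; rewrite max_l// subr_le0.
  by rewrite ler_pdivlMr// mul1r ltW.
move=> y; apply/continuous_normP => e e0; exists (e * d); first by rewrite mulr_gt0.
move=> z zy; have : `| `|z - x| / d - `|y - x| / d| < e.
  rewrite -mulrBl normrM (gtr0_norm (_ : 0 < d^-1)) ?invr_gt0// ltr_pdivrMr//.
  apply: le_lt_trans zy; apply: (le_trans (ler_dist_dist _ _)).
  by rewrite opprB addrA subrK.
move: (`|z - x| / d) (`|y - x| / d) => u v; rewrite !ltr_norml => /andP[? ?].
by case: (leP 0 (1 - u)) => ?; case: (leP 0 (1 - v)) => ?; apply/andP; split; lra.
Qed.

End MALocal.

(** * Real-valued local valuations of top degree *)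

Section Valuation.
Variables (R : realType) (n : nat).
Notation V := 'rV[R]_n.
Hypothesis n_gt0 : (0 < n)%N.
Variable U : set V.
Hypothesis U_open : open U.
Hypothesis U_convex : Defs.convex_set U.
Implicit Types (f g h : V -> R) (x y z : V) (A B K : set V) (J : seq V) (L : seq (V * R)).
Variables (P M : (V -> R) -> {measure set (Vb R n) -> \bar R}).

Definition val f B : R := fine (P f B) - fine (M f B).
Definition test_int f (phi : V -> R) : R :=
  Rintegral (P f) (setT : set (Vb R n)) phi - Rintegral (M f) (setT : set (Vb R n)) phi.

Hypothesis P_locfin : forall f, loc_finite U (P f).
Hypothesis M_locfin : forall f, loc_finite U (M f).
Hypothesis val_maxmin : forall f g, convex_on U f -> convex_on U g ->
  convex_on U (fun x => Num.min (f x) (g x)) -> forall B, borel B -> rel_compact U B ->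
  val (fun x => Num.max (f x) (g x)) B + val (fun x => Num.min (f x) (g x)) B =
  val f B + val g B.
Hypothesis test_int_cvg : forall (f_ : nat -> V -> R) f, (forall j, convex_on U (f_ j)) ->
  convex_on U f -> loc_unif_cvg U f_ f -> forall phi, Cc U phi ->
  (fun j => test_int (f_ j) phi) @ \oo --> test_int f phi.
Hypothesis val_affine : forall f l, convex_on U f -> affine l ->
  forall B, borel B -> rel_compact U B -> val (f \+ l) B = val f B.
Hypothesis val_homog : forall f (t : R), convex_on U f -> 0 <= t ->
  forall B, borel B -> rel_compact U B -> val (fun x => t * f x) B = t ^+ n * val f B.
Hypothesis val_local : forall f h (W : set V), convex_on U f -> convex_on U h -> open W ->
  W `<=` U -> (forall x, W x -> f x = h x) ->
  forall B, borel B -> rel_compact U B -> val f (B `&` W) = val h (B `&` W).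

(** The value at [c] lies between those at [a] and [b]. The identities translate the valuation
    property for maxima and minima into [Z_cut]; the minimum is convex, being the support function
    of the common face. *)
Lemma hmax_cut a b (G : seq V) (t : R) z : 0 <= t <= 1 -> let c := (1 - t) *: a + t *: b in
  Num.max (hmax (a :: c :: G) z) (hmax (c :: b :: G) z) = hmax (a :: b :: G) z /\
  Num.min (hmax (a :: c :: G) z) (hmax (c :: b :: G) z) = hmax (c :: G) z.
Proof.
move=> /andP[t0 t1] c.
have cE : dotp c z = (1 - t) * dotp a z + t * dotp b z by rewrite dotpDl !dotpZl.
have cab : (dotp a z <= dotp c z /\ dotp c z <= dotp b z) \/
    (dotp b z <= dotp c z /\ dotp c z <= dotp a z).
  by rewrite cE; case: (leP (dotp a z) (dotp b z)) => ab; [left|right]; split; nra.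
have [->|G0] := eqVneq G [::].
  rewrite ![lmax _ [:: _; _]]lmax_cons// !lmax1; case: cab => -[h1 h2]; have h := le_trans h1 h2.
    by rewrite (max_r h1) (max_r h2) (max_r h) (max_r h2) (min_l h2).
  by rewrite (max_l h2) (max_l h1) (max_l h) (max_l h2) (min_r h2).
rewrite !lmax_cons//; move: (dotp a z) (dotp b z) (dotp c z) (hmax G z) cab => u v w k uvw.
have up p q : p <= q -> Num.max p (Num.max q k) = Num.max q k.
  by move=> pq; rewrite max_r// le_max pq.
have down p q : p <= q -> Num.max q (Num.max p k) = Num.max q k.
  by move=> pq; rewrite maxA (max_l pq).
have mono p q : p <= q -> Num.max p k <= Num.max q k.
  by move=> pq; rewrite ge_max !le_max pq lexx orbT.
case: uvw => -[h1 h2]; have h := le_trans h1 h2.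
  by rewrite (up _ _ h1) (up _ _ h2) (up _ _ h) max_r ?min_l ?mono.
by rewrite (down _ _ h2) (down _ _ h1) (down _ _ h) max_l ?min_r ?mono.
Qed.

Section Cone.
Variables (x : V) (B : set V).
Hypotheses (bB : borel B) (rB : rel_compact U B).

Definition cone_val J := val (fun y => hmax J (y - x)) B.

Lemma cone_val_ext J J' : (forall z, hmax J z = hmax J' z) -> cone_val J = cone_val J'.
Proof. by move=> JJ'; congr (val _ B); apply/funext => y. Qed.

Lemma cone_val_translate J v : cone_val [seq w + v | w <- J] = cone_val J.
Proof.
have [->//|J0] := eqVneq J [::].
rewrite /cone_val -(val_affine (hmax_convex J x) (l := fun y => dotp v y - dotp v x))//.
  by congr (val _ B); apply/funext => y; rewrite hmax_translate// dotpBr.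
by exists v, (- dotp v x).
Qed.

Lemma cone_val_homog J (t : R) : 0 <= t -> cone_val [seq t *: w | w <- J] = t ^+ n * cone_val J.
Proof.
move=> t0; rewrite /cone_val -val_homog//; last exact: hmax_convex.
by congr (val _ B); apply/funext => y; rewrite hmax_scale.
Qed.

Lemma cone_val_cut a b (g : seq V) (t : R) : 0 <= t <= 1 ->
  let c := (1 - t) *: a + t *: b in
  cone_val (a :: b :: g) + cone_val (c :: g) = cone_val (a :: c :: g) + cone_val (c :: b :: g).
Proof.
move=> t01 c; have mE y := hmax_cut a b g (y - x) t01; rewrite -/c in mE.
have fE : (fun y => hmax (a :: b :: g) (y - x)) = (fun y =>
    Num.max (hmax (a :: c :: g) (y - x)) (hmax (c :: b :: g) (y - x))).
  by apply/funext => y; rewrite (mE y).1.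
have gE : (fun y => hmax (c :: g) (y - x)) = (fun y =>
    Num.min (hmax (a :: c :: g) (y - x)) (hmax (c :: b :: g) (y - x))).
  by apply/funext => y; rewrite (mE y).2.
rewrite /cone_val fE gE; apply: val_maxmin => //; rewrite -?gE; exact: hmax_convex.
Qed.

Lemma cone_val_flat J : flat J -> cone_val J = 0.
Proof.
move=> [v [k [v0 Jk]]].
exact: (Z_hyperplane n_gt0 cone_val_ext cone_val_translate cone_val_homog cone_val_cut v0 Jk).
Qed.

End Cone.

(** Normalised by a simplex and not by the ball: the cone over the ball is not polyhedral and
    becomes accessible only once [val_density] is available. *)
Definition density y : R := cone_val y [set y] (std_simplex R n) / bodyvol (std_simplex R n).

Lemma set1_rel_compact y : U y -> rel_compact U [set y].
Proof. by move=> Uy; apply: (rel_compact_sub (@compact_set1 _ y)) => // _ ->. Qed.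

(** The difference of the two sides satisfies the hypotheses of [Z_eq0] and vanishes on the standard
    simplex by the choice of [density]. *)
Lemma cone_val_point y J : U y -> cone_val y [set y] J = density y * bodyvol J.
Proof.
move=> Uy; have b1 := set1_borel y; have r1 := set1_rel_compact Uy.
pose Z J := cone_val y [set y] J - density y * bodyvol J.
suff /(_ J)/eqP : forall J, Z J = 0 by rewrite subr_eq0 => /eqP.
move=> J'; apply: (@Z_eq0 R n Z n_gt0) => [J1 J2 J12|J1 v|J1 t t0|a b g t t01 c|]; rewrite /Z.
- by rewrite (cone_val_ext y [set y] J12) (bodyvol_ext J12).
- by rewrite cone_val_translate// bodyvol_translate.
- by rewrite cone_val_homog// bodyvol_homog//; ring.
- have := cone_val_cut y b1 r1 a b g t01; have := bodyvol_cut n_gt0 a b g t01.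
  rewrite -/c => h1 h2.
  have -> : cone_val y [set y] (a :: b :: g) = cone_val y [set y] (a :: c :: g) +
    cone_val y [set y] (c :: b :: g) - cone_val y [set y] (c :: g) by rewrite -h2; ring.
  have -> : bodyvol (a :: b :: g) = bodyvol (a :: c :: g) +
    bodyvol (c :: b :: g) - bodyvol (c :: g) by rewrite -h1; ring.
  by ring.
- by rewrite /density -/(std_simplex R n) divfK ?subrr//; exact: bodyvol_std_neq0.
Qed.

Lemma val_active L x A : L != [::] -> borel A -> rel_compact U A ->
  (forall y, A y -> active L y = active L x) -> val (pmax L) A = cone_val x A (slopes L x).
Proof.
move=> L0 bA rA Ax; have AU : A `<=` U by apply: subset_trans rA.2; exact: subset_closure.
pose W := cell L x `&` U.
have AW : A `&` W = A.
  by apply/seteqP; split=> [y []//|y Ay]; split=> //; split; [exact/active_cell/Ax|exact: AU].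
pose h := (fun y => hmax (slopes L x) (y - x)) \+ (fun=> pmax L x).
have hc : convex_on U h.
  move=> y z t Uy Uz t01; rewrite /h /=.
  by have := hmax_convex (slopes L x) x Uy Uz t01; lra.
rewrite -AW (@val_local _ h W)//; last 4 first.
- exact: pmax_convex.
- by apply: openI => //; exact: cell_open.
- by move=> y [].
- by move=> y [xy _]; exact: pmax_cell.
rewrite AW /h val_affine//; first exact: hmax_convex.
by exists 0, (pmax L x) => y; rewrite dotp0l add0r.
Qed.

Lemma MA_active L x A (m : {measure set (Vb R n) -> \bar R}) : L != [::] -> borel A -> A `<=` U ->
  (forall y, A y -> active L y = active L x) -> is_MA U (pmax L) m -> flat (slopes L x) ->
  m A = 0%E.
Proof.
move=> L0 bA AU Ax mL [v [k [v0 Jk]]]; rewrite mL//.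
apply/eqP; rewrite eq_le leb_outer_ge0 andbT -(body_flat n_gt0 v0 Jk).
apply: le_leb_outer => p [y Ay]; rewrite subdiff_pmax//; last exact: AU.
by rewrite /slopes Ax.
Qed.

Lemma fine_eq (mu nu : {measure set (Vb R n) -> \bar R}) A K : loc_finite U mu ->
  loc_finite U nu -> compact K -> K `<=` U -> borel A -> A `<=` K ->
  fine (mu A) - fine (nu A) = 0 -> mu A = nu A.
Proof.
move=> lmu lnu cK KU bA AK /eqP; rewrite subr_eq0 => /eqP e.
have fin (la : {measure set (Vb R n) -> \bar R}) : loc_finite U la -> la A \is a fin_num.
  move=> lla; rewrite ge0_fin_numE//.
  exact: (measure_sub_lty (lla K cK KU) bA (compact_borel cK) AK).
by rewrite -(fineK (fin mu lmu)) -(fineK (fin nu lnu)) e.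
Qed.

(** [rho] has to agree with [density] only at the points whose active slopes are not flat. This
    freedom allows a constant [rho] for simplicial cones, before [density] is known to be
    continuous. *)
Lemma test_int_polyhedral L (m : {measure set (Vb R n) -> \bar R}) (phi rho : V -> R) :
  is_MA U (pmax L) m -> Cc U phi -> (forall x, U x -> {for x, continuous rho}) ->
  (forall x, U x -> ~ flat (slopes L x) -> rho x = density x) ->
  test_int (pmax L) phi = Rintegral m (setT : set (Vb R n)) (fun x => phi x * rho x).
Proof.
wlog L0 : L / L != [::].
  move=> H; have [->|L0] := eqVneq L [::]; last exact: H.
  (* Both lists describe the zero function, whose only slope is flat. *)
  have E : pmax [::] = pmax [:: (0, 0)] :> (V -> R).
    by apply/funext => x; rewrite /pmax lmax_nil lmax1 dotp0l addr0.
  rewrite E => mL phiC rhoc _; apply: H => // x Ux nflat; exfalso; apply: nflat.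
  exists (delta_mx 0 (Ordinal n_gt0)), 0; split.
    apply/eqP => /rowP/(_ (Ordinal n_gt0)); rewrite !mxE !eqxx /= => /eqP.
    by rewrite oner_eq0.
  move=> w /mapP[a + ->]; rewrite mem_active inE => /andP[_ /eqP->].
  exact: dotp0l.
move=> mL phiC rhoc rhoE; have [K [cK KU phi0]] := Cc_support phiC.
have bK := compact_borel cK; have lm := MA_loc_finite n_gt0 U_open U_convex (pmax_convex L) mL.
have phic x : U x -> {for x, continuous phi} by move=> _; exact: phiC.1.
have prc x : U x -> {for x, continuous (fun x => phi x * rho x)}.
  by move=> Ux; apply: continuousM; [exact: phic|exact: rhoc].
rewrite /test_int !(@Rintegral_support _ _ _ _ K)//; last by move=> x /phi0 ->; rewrite mul0r.
pose Phi A := Rintegral (P (pmax L)) (A : set (Vb R n)) phi -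
  Rintegral (M (pmax L)) (A : set (Vb R n)) phi -
  Rintegral m (A : set (Vb R n)) (fun x => phi x * rho x).
suff /eqP : Phi K = 0 by rewrite subr_eq0 => /eqP.
apply: (@finite_strata _ _ _ (active_class L)) => //.
- by rewrite /Phi !Rintegral_set0 !subr0.
- move=> A B bA bB AK BK AB0; rewrite /Phi !(Rintegral_split U_open _ cK KU)//.
  by ring.
- exact: borel_active_class.
move=> s; set A := K `&` _.
have bA : borel A by apply: borelI => //; exact: borel_active_class.
have AK : A `<=` K by move=> x [].
have [->|/set0P[x [Kx xs]]] := eqVneq A set0; first by rewrite /Phi !Rintegral_set0 !subr0.
have AE y : A y -> active L y = active L x.
  by move=> [_ ys]; apply: active_classP; rewrite ys.
have rA : rel_compact U A by exact: rel_compact_sub AK.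
have Ux := KU x Kx.
have [fl|nfl] := pselect (flat (slopes L x)); last first.
  have -> : A = [set x].
    apply/seteqP; split=> [y Ay|_ ->]; last by split.
    exact: (flat_slopes L0 (AE y Ay) nfl).
  rewrite /Phi !Rintegral_set1 rhoE// (MA_set1 mL Ux) subdiff_pmax// -/(bodyvol _).
  rewrite -mulrBr -/(val _ _) (@val_active L x)//; last 3 first.
  - exact: set1_borel.
  - exact: set1_rel_compact.
  - by move=> y ->.
  by rewrite cone_val_point// mulrA subrr.
(* Every Borel part of a flat stratum has value [0], so the two measures coincide on [A] as measures
   and not merely in total mass. *)
have PM : Rintegral (P (pmax L)) (A : set (Vb R n)) phi =
    Rintegral (M (pmax L)) (A : set (Vb R n)) phi.
  congr fine; apply: eq_measure_integral => A' bA' A'A.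
  apply: (@fine_eq _ _ _ K) => //; first exact: subset_trans AK.
  have rA' : rel_compact U A' by apply: (rel_compact_sub cK) => //; exact: subset_trans AK.
  rewrite -/(val _ _) (@val_active L x)//; last by move=> y /A'A/AE.
  by rewrite cone_val_flat.
have mA : m A = 0%E.
  by apply: (@MA_active L x) => //; exact: subset_trans KU.
have [c cP] := compact_bounded_fun cK (fun x Kx => prc x (KU x Kx)).
rewrite /Phi PM subrr sub0r; apply/eqP; rewrite oppr_eq0 -normr_le0.
have -> : 0 = c * fine (m A) by rewrite mA mulr0.
apply: Rintegral_bound => //; first by rewrite mA.
  by apply: (@integrable_sub _ _ _ _ K) => //; exact: (continuous_integrable U_open lm cK KU).
by move=> y /AK; exact: cP.
Qed.

Lemma cone_cvg J (y_ : nat -> V) y :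
  (forall e : R, 0 < e -> exists N, forall j, (N <= j)%N -> `|y_ j - y| < e) ->
  loc_unif_cvg U (fun j z => hmax J (z - y_ j)) (fun z => hmax J (z - y)).
Proof.
move=> yc K _ _ e e0; have [c c0 cP] := hmax_lip J.
have [N NP] := yc (e / c) ltac:(by rewrite divr_gt0).
exists N => // j /= Nj z _; apply: (le_lt_trans (cP _ _)).
rewrite -ltr_pdivlMl// mulrC (_ : z - y_ j - (z - y) = - (y_ j - y)) ?normrN ?NP//.
by apply/rowP => i; rewrite !mxE; ring.
Qed.

(** For the simplicial cone with apex [z], the test integral is [kap z * density z], where [kap z]
    integrates [phi] against the Monge-Ampere measure of the cone. Both the product and [kap]
    converge when the apex moves, and the limit of [kap] is positive. *)
Lemma density_continuous y : U y -> {for y, continuous density}.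
Proof.
move=> Uy; apply/continuous_normP => e e0; apply: contrapT => nH.
have [d d0 dU] := (open_normP U).1 U_open y Uy.
have ex (j : nat) : exists z, `|z - y| < Num.min d j.+1%:R^-1 /\ e <= `|density z - density y|.
  have d1 : 0 < Num.min d j.+1%:R^-1 by rewrite lt_min d0 /= invr_gt0 ltr0n.
  apply: contrapT => nz; apply: nH; exists (Num.min d j.+1%:R^-1) => // z zy.
  by rewrite ltNge; apply/negP => ez; apply: nz; exists z.
have [y_ y_P] := choice ex.
have yU j : U (y_ j).
  by apply: dU; have [] := y_P j; rewrite lt_min => /andP[/ltW].
have yc (a : R) : 0 < a -> exists N, forall j, (N <= j)%N -> `|y_ j - y| < a.
  move=> a0; have [N NP] := eventually_natr_gt a^-1; exists N => j Nj.
  have [+ _] := y_P j; rewrite lt_min => /andP[_ /lt_trans]; apply.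
  by rewrite invf_plt ?posrE//; apply: NP; exact: leqW.
have [phi [phiC phi1 phi_ge0]] := Cc_bump U_open Uy.
pose S := std_simplex R n.
pose f z := fun w => hmax S (w - z).
have fc z : convex_on U (f z) by exact: hmax_convex.
have [m_ m_P] := choice (fun z => MA_exists n_gt0 U_open U_convex (fc z)).
have lm z := MA_loc_finite n_gt0 U_open U_convex (fc z) (m_P z).
have fE z : f z = pmax (cone_list S z).
  by apply/funext => w; rewrite pmax_cone_list.
pose kap z := Rintegral (m_ z) (setT : set (Vb R n)) phi.
have phic x : U x -> {for x, continuous phi} by move=> _; exact: phiC.1.
have [K [cK KU phi0]] := Cc_support phiC; have bK := compact_borel cK.
have tE z : U z -> test_int (f z) phi = kap z * density z.
  move=> Uz; rewrite fE (@test_int_polyhedral _ (m_ z) phi (fun=> density z))//.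
  - rewrite (@Rintegral_support _ _ _ _ K); last by move=> w /phi0 ->; rewrite mul0r.
    rewrite /kap (@Rintegral_support _ _ _ phi K)// RintegralZr//.
    exact: (continuous_integrable U_open (lm z) cK KU).
  - by rewrite -fE; exact: m_P.
  - by move=> w _; exact: cst_continuous.
  - move=> w _ nfl; congr density; apply/eqP; apply: contra_notT nfl; rewrite eq_sym.
    exact: cone_flat.
have kc : (fun j => kap (y_ j)) @ \oo --> kap y.
  apply: (MA_weak_continuity n_gt0 U_open U_convex (f_ := fun j => f (y_ j)) (f := f y)) => //.
  exact: cone_cvg.
have tc : (fun j => kap (y_ j) * density (y_ j)) @ \oo --> kap y * density y.
  rewrite -(funext (fun j => tE (y_ j) (yU j))) -tE//.
  by apply: test_int_cvg => //; exact: cone_cvg.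
(* The apex carries the mass [bodyvol S > 0], [phi y] is [1], and the rest of the integral is
   nonnegative. *)
have k0 : kap y != 0.
  have Ky : K y.
    by apply: contrapT => /phi0; rewrite phi1 => /eqP; rewrite oner_eq0.
  have b1 : borel [set y] by exact: set1_borel.
  have bD : borel (K `\ y) by exact: borelD.
  have s1 : [set y] `<=` K by move=> _ ->.
  have s2 : K `\ y `<=` K by move=> w [].
  have dj : [set y] `&` (K `\ y) = set0 by apply/seteqP; split=> // w [-> [_]]; exact.
  rewrite /kap (@Rintegral_support _ _ _ phi K)// -[K](setDUK s1).
  rewrite (Rintegral_split U_open (lm y) cK KU phic b1 bD s1 s2 dj).
  rewrite Rintegral_set1 phi1 mul1r (MA_set1 (m_P y) Uy) subdiff_hmax// -/(bodyvol S).
  have b0 : 0 < bodyvol S.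
    rewrite lt_def bodyvol_std_neq0//=; exact/fine_ge0/leb_outer_ge0.
  rewrite gt_eqF// ltr_pwDl//; apply: Rintegral_ge0 => w _; exact: phi_ge0.
have dc : (fun j => density (y_ j)) @ \oo --> density y.
  have dc : (fun j => kap (y_ j) * density (y_ j) / kap (y_ j)) @ \oo --> density y.
    have -> : density y = kap y * density y / kap y by rewrite mulrAC mulfV// mul1r.
    by apply: cvgM => //; exact: cvgV.
  apply: cvg_trans dc; apply: near_eq_cvg; near=> j.
  rewrite /= mulrAC mulfV ?mul1r//; near: j.
  exact: cvgr_neq0 kc k0.
have /cvgrPdist_lt/(_ e e0)[N _ /(_ N (leqnn N))] := dc.
by rewrite /= distrC ltNge (y_P N).2.
Unshelve. all: by end_near.
Qed.

Lemma val_density f (m : {measure set (Vb R n) -> \bar R}) B : convex_on U f -> is_MA U f m ->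
  borel B -> rel_compact U B -> val f B = Rintegral m (B : set (Vb R n)) density.
Proof.
move=> fc mf bB rB; have lm := MA_loc_finite n_gt0 U_open U_convex fc mf.
apply: (radon_eq U_open) => // [|phi phiC]; first exact: density_continuous.
have [L_ Lf] := polyhedral_approx n_gt0 U_open U_convex fc.
have Lc j : convex_on U (pmax (L_ j)) by exact: pmax_convex.
have [m_ m_P] := choice (fun j => MA_exists n_gt0 U_open U_convex (Lc j)).
have prC : Cc U (fun x => phi x * density x) by apply: Cc_mul => //; exact: density_continuous.
have c1 := test_int_cvg Lc fc Lf phiC.
have c2 := MA_weak_continuity n_gt0 U_open U_convex Lc fc Lf m_P mf prC.
apply: (cvg_unique (@Rhausdorff R) c1).
rewrite (_ : (fun j => test_int (pmax (L_ j)) phi) = (fun j => Rintegral (m_ j) (setT : set (Vb R n))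
  (fun x => phi x * density x)))//.
by apply/funext => j; apply: test_int_polyhedral => //; exact: density_continuous.
Qed.

Definition ball_density x : R := (omega R n)^-1 * val (fun y => enorm (y - x)) [set x].

Lemma ball_densityE x : U x -> ball_density x = density x.
Proof.
move=> Ux; have ec := enorm_convex (U := U) x.
have [m mP] := MA_exists n_gt0 U_open U_convex ec.
rewrite /ball_density (val_density ec mP (set1_borel x) (set1_rel_compact Ux)).
rewrite Rintegral_set1 (MA_set1 mP Ux) subdiff_enorm// -/(omega R n).
by rewrite mulrCA mulVf ?mulr1//; exact: omega_neq0.
Qed.

(** [ball_density] is identified with [density] only on [U]; openness of [U] transfers the
    continuity. *)
Lemma ball_density_continuous x : U x -> {for x, continuous ball_density}.
Proof.
move=> Ux; have [d d0 dU] := (open_normP U).1 U_open x Ux.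
apply/continuous_normP => e e0.
have [d' d'0 d'P] := (continuous_normP x density).1 (density_continuous Ux) e e0.
exists (Num.min d d'); first by rewrite lt_min d0.
move=> y; rewrite lt_min => /andP[/ltW/dU Uy /d'P].
by rewrite !ball_densityE.
Qed.

Lemma val_ball_density f (m : {measure set (Vb R n) -> \bar R}) B : convex_on U f ->
  is_MA U f m -> borel B -> rel_compact U B ->
  val f B = Rintegral m (B : set (Vb R n)) ball_density.
Proof.
move=> fc mf bB rB; rewrite (val_density fc mf bB rB); apply: eq_Rintegral => x.
rewrite inE => Bx; symmetry; apply: ball_densityE.
by apply: rB.2; exact: subset_closure.
Qed.

End Valuation.

(** * The complex measure, through its real and imaginary parts *)

Unset Implicit Arguments.

Theorem theorem4p8 (R : realType) (n : nat) (U : set 'rV[R]_n)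
  (Psi : ('rV[R]_n -> R) -> cradon U) :
  (0 < n)%N -> open U -> Defs.convex_set U ->
  is_VConv Psi -> locally_determined Psi ->
  let psi := fun x : 'rV[R]_n =>
    ((omega R n)^-1%:C * cval (Psi (fun y => enorm (y - x))) [set x])%C in
  [/\ continuous_on_C U psi,
      represents Psi psi &
      forall psi' : 'rV[R]_n -> R[i], continuous_on_C U psi' -> represents Psi psi' ->
        forall x, U x -> psi' x = psi x].
Proof.
move=> n_gt0 U_open U_convex [Pmm [Pcv [Paff Phom]]] Ploc psi.
pose mu1 f := cr1 (Psi f); pose mu2 f := cr2 (Psi f).
pose mu3 f := cr3 (Psi f); pose mu4 f := cr4 (Psi f).
have l1 f : loc_finite U (mu1 f) by move=> K cK KU; case: (cr_locfin (Psi f) cK KU).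
have l2 f : loc_finite U (mu2 f) by move=> K cK KU; case: (cr_locfin (Psi f) cK KU).
have l3 f : loc_finite U (mu3 f) by move=> K cK KU; case: (cr_locfin (Psi f) cK KU).
have l4 f : loc_finite U (mu4 f) by move=> K cK KU; case: (cr_locfin (Psi f) cK KU).
have ReM (t : R) (z : R[i]) : complex.Re (t%:C * z)%C = t * complex.Re z.
  by case: z => a b /=; rewrite mul0r subr0.
have ImM (t : R) (z : R[i]) : complex.Im (t%:C * z)%C = t * complex.Im z.
  by case: z => a b /=; rewrite mul0r addr0.
(* The real part of [cval] is [val mu1 mu2] and the imaginary part is [val mu3 mu4], so the
   hypotheses of the real theory are the components of those on [Psi]. *)
have re_mm f g fc gc mc B bB rB :=
  congr1 (@complex.Re R) (Pmm f g fc gc mc B bB rB).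
have im_mm f g fc gc mc B bB rB :=
  congr1 (@complex.Im R) (Pmm f g fc gc mc B bB rB).
have re_cv f_ f fc_ fc ff phi phiC := (Pcv f_ f fc_ fc ff phi phiC).1.
have im_cv f_ f fc_ fc ff phi phiC := (Pcv f_ f fc_ fc ff phi phiC).2.
have re_aff f l fc al B bB rB := congr1 (@complex.Re R) (Paff f l fc al B bB rB).
have im_aff f l fc al B bB rB := congr1 (@complex.Im R) (Paff f l fc al B bB rB).
have re_hom f t fc t0 B bB rB :=
  etrans (congr1 (@complex.Re R) (Phom f t fc t0 B bB rB)) (ReM _ _).
have im_hom f t fc t0 B bB rB :=
  etrans (congr1 (@complex.Im R) (Phom f t fc t0 B bB rB)) (ImM _ _).
have re_loc f h W fc hc oW WU fh B bB rB :=
  congr1 (@complex.Re R) (Ploc f h W fc hc oW WU fh B bB rB).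
have im_loc f h W fc hc oW WU fh B bB rB :=
  congr1 (@complex.Im R) (Ploc f h W fc hc oW WU fh B bB rB).
have psiRe : (fun x => complex.Re (psi x)) = ball_density mu1 mu2.
  by apply/funext => x; rewrite /psi ReM.
have psiIm : (fun x => complex.Im (psi x)) = ball_density mu3 mu4.
  by apply/funext => x; rewrite /psi ImM.
split.
- move=> x Ux; rewrite psiRe psiIm; split.
    exact: (ball_density_continuous n_gt0 U_open U_convex l1 l2 re_mm re_cv re_aff re_hom re_loc).
  exact: (ball_density_continuous n_gt0 U_open U_convex l3 l4 im_mm im_cv im_aff im_hom im_loc).
- move=> f fc; have [m mf] := MA_exists n_gt0 U_open U_convex fc.
  exists m; split=> // B bB rB; rewrite /cintegral psiRe psiIm.
  rewrite -(val_ball_density n_gt0 U_open U_convex l1 l2 re_mm re_cv re_aff re_hom re_loc fc mf bB rB).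
  by rewrite -(val_ball_density n_gt0 U_open U_convex l3 l4 im_mm im_cv im_aff im_hom im_loc fc mf bB rB).
(* The value of a representing function at [x] is read off from the ball cone with apex [x], whose
   Monge-Ampere measure gives the apex the mass [omega]. *)
- move=> psi' _ psi'P x Ux; have ec := enorm_convex (U := U) x.
  have [m [mf /(_ _ (set1_borel x) (set1_rel_compact Ux)) mE]] := psi'P _ ec.
  rewrite /psi mE /cintegral !Rintegral_set1 (MA_set1 mf Ux) subdiff_enorm// -/(omega R n).
  have w0 := omega_neq0 R n_gt0.
  by apply/eqP; rewrite eq_complex ReM ImM /= !(mulrC _ (omega R n)) !mulKf ?eqxx.
Qed.
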